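(* Assume the axiom of determinacy $\mathsf{AD}$. Let $d\ge1$ be an integer and let $\delta$ be a real number. Suppose $R\subseteq\mathbb{R}^d\times\omega^\omega$ and $\mathrm{dom}(R)$ has Hausdorff dimension at least $\delta$. Then for any $\delta'<\delta$ there are a set $B\subseteq\mathrm{dom}(R)$ with $\mathrm{HD}(B)\ge\delta'$ and a continuous function $f\colon B\to\omega^\omega$ which uniformizes $R$, that is, $R(x,f(x))$ holds for all $x\in B$.
   Context: $\omega^\omega$ is the Baire space of sequences of natural numbers with the product of the discrete topologies on $\omega=\mathbb{N}$. $\mathrm{dom}(R)=\{x\in\mathbb{R}^d:\exists y\in\omega^\omega\ (x,y)\in R\}$, and $R(x,y)$ means $(x,y)\in R$. $\mathrm{HD}$ denotes Hausdorff dimension, defined for arbitrary subsets of $\mathbb{R}^d$. $\mathsf{AD}$ is the statement that every two-player perfect-information game of length $\omega$ on $\omega$ is determined. As $\mathsf{AD}$ contradicts the full axiom of choice, the result is understood over $\mathsf{ZF}$ without the full axiom of choice. *)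

(* Defs.v *)
From HB Require Import structures.
From mathcomp Require Import all_boot all_order all_algebra.

Set Implicit Arguments.
Unset Strict Implicit.
Unset Printing Implicit Defensive.

Import Order.TTheory GRing.Theory Num.Theory.
Local Open Scope ring_scope.

(* In the presence of a global choice operator, determinacy of all games on *)
(* the type nat -> nat is refutable, so a hypothesis of that form would be *)
(* void.  A theorem of ZF + AD is instead expressed as a statement about every *)
(* model of ZF + AD.  Separation and Replacement are the first-order schemas, *)
(* so that choice at the level of Rocq does not yield choice in the model. *)
(* All quantifiers in the definitions below that concern M range over M (or *)
(* over the elements of its real line): each of them is the interpretation in *)
(* M of the set-theoretic definition.  In particular natural numbers, *)
(* sequences, reals and strategies are those of M, and omega may be *)
(* nonstandard. *)

Record set_structure := SetStructure {
  univ :> Type;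
  elem : univ -> univ -> Prop
}.

Notation "x ∈ y" := (elem x y) (at level 70, no associativity).

(* Formulas of set theory; variables are de Bruijn indices, and [Fall], [Fex] *)
(* bind the variable 0. *)
Inductive formula :=
| Fmem of nat & nat
| Feq of nat & nat
| Fbot
| Fimp of formula & formula
| Fand of formula & formula
| For of formula & formula
| Fall of formula
| Fex of formula.

Definition push (M : set_structure) (x : M) (v : nat -> M) : nat -> M :=
  fun n => if n is m.+1 then v m else x.

Fixpoint sat (M : set_structure) (v : nat -> M) (phi : formula) : Prop :=
  match phi with
  | Fmem i j => v i ∈ v j
  | Feq i j => v i = v j
  | Fbot => False
  | Fimp p q => sat v p -> sat v q
  | Fand p q => sat v p /\ sat v q
  | For p q => sat v p \/ sat v q
  | Fall p => forall x : M, sat (push x v) p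
  | Fex p => exists x : M, sat (push x v) p
  end.

Definition is_empty (M : set_structure) (e : M) : Prop :=
  forall z : M, ~ z ∈ e.

Definition incl (M : set_structure) (x y : M) : Prop :=
  forall z : M, z ∈ x -> z ∈ y.

Definition is_upair (M : set_structure) (x y p : M) : Prop :=
  forall z : M, z ∈ p <-> z = x \/ z = y.

Definition is_succ (M : set_structure) (x y : M) : Prop :=
  forall z : M, z ∈ y <-> z ∈ x \/ z = x.

Definition inductive_set (M : set_structure) (w : M) : Prop :=
  (exists e : M, is_empty e /\ e ∈ w) /\
  (forall x : M, x ∈ w -> exists y : M, is_succ x y /\ y ∈ w).

Record ZF (M : set_structure) : Prop := {
  zf_extensionality : forall x y : M, (forall z : M, z ∈ x <-> z ∈ y) -> x = y;
  zf_foundation : forall x : M, ~ is_empty x ->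
    exists y : M, y ∈ x /\ forall z : M, ~ (z ∈ y /\ z ∈ x);
  zf_pairing : forall x y : M, exists p : M, is_upair x y p;
  zf_union : forall x : M, exists u : M,
    forall z : M, z ∈ u <-> exists y : M, y ∈ x /\ z ∈ y;
  zf_powerset : forall x : M, exists p : M, forall z : M, z ∈ p <-> incl z x;
  zf_infinity : exists w : M, inductive_set w;
  zf_separation : forall (phi : formula) (v : nat -> M) (a : M),
    exists b : M, forall x : M, x ∈ b <-> x ∈ a /\ sat (push x v) phi;
  zf_replacement : forall (phi : formula) (v : nat -> M) (a : M),
    (forall x y z : M, x ∈ a -> sat (push y (push x v)) phi ->
       sat (push z (push x v)) phi -> y = z) ->
    exists b : M, forall y : M,
      y ∈ b <-> exists x : M, x ∈ a /\ sat (push y (push x v)) phi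
}.

Definition is_omega (M : set_structure) (w : M) : Prop :=
  inductive_set w /\ forall w' : M, inductive_set w' -> incl w w'.

(* Kuratowski pair *)
Definition is_opair (M : set_structure) (x y p : M) : Prop :=
  exists s t : M, is_upair x x s /\ is_upair x y t /\ is_upair s t p.

(* (x, y) ∈ f; when f is a function, f(x) = y *)
Definition inrel (M : set_structure) (f x y : M) : Prop :=
  exists p : M, is_opair x y p /\ p ∈ f.

(* f is a function with domain the set a and values in the class Q *)
Definition is_fun (M : set_structure) (f a : M) (Q : M -> Prop) : Prop :=
  (forall p : M, p ∈ f -> exists x y : M, x ∈ a /\ Q y /\ is_opair x y p) /\
  (forall x : M, x ∈ a -> exists! y : M, inrel f x y).

(* f|a *)
Definition is_restr (M : set_structure) (f a g : M) : Prop :=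
  forall p : M, p ∈ g <-> p ∈ f /\ exists x y : M, x ∈ a /\ is_opair x y p.

(* omega^omega; w stands for omega throughout *)
Definition baire (M : set_structure) (w x : M) : Prop :=
  is_fun x w (fun n => n ∈ w).

Definition is_evens (M : set_structure) (w E : M) : Prop :=
  incl E w /\ (forall e : M, is_empty e -> e ∈ E) /\
  (forall n m : M, n ∈ w -> is_succ n m -> (m ∈ E <-> ~ n ∈ E)).

(* S is the set of finite sequences of natural numbers (game positions) *)
Definition is_positions (M : set_structure) (w S : M) : Prop :=
  forall p : M,
    p ∈ S <-> exists n : M, n ∈ w /\ is_fun p n (fun k => k ∈ w).

(* sigma assigns a move to every position; a given player uses it only at the *)
(* positions where that player is to move *)
Definition is_strategy (M : set_structure) (w sigma : M) : Prop :=
  exists S : M, is_positions w S /\ is_fun sigma S (fun k => k ∈ w).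

(* x(n) = sigma(x|n) for all n in the class T of turns of a player *)
Definition follows (M : set_structure) (T : M -> Prop) (sigma x : M) : Prop :=
  forall n p k : M, T n -> is_restr x n p -> (inrel x n k <-> inrel sigma p k).

(* Player I moves at even stages and wins the run x iff x ∈ A . *)
Definition wins_I (M : set_structure) (w A sigma : M) : Prop :=
  exists E : M, is_evens w E /\
  forall x : M, baire w x -> follows (fun n => n ∈ E) sigma x -> x ∈ A.

Definition wins_II (M : set_structure) (w A sigma : M) : Prop :=
  exists E : M, is_evens w E /\
  forall x : M, baire w x ->
    follows (fun n => n ∈ w /\ ~ n ∈ E) sigma x -> ~ x ∈ A.

Definition determined (M : set_structure) (w A : M) : Prop :=
  exists sigma : M, is_strategy w sigma /\ (wins_I w A sigma \/ wins_II w A sigma).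

Definition AD (M : set_structure) : Prop :=
  forall w A : M, is_omega w -> (forall x : M, x ∈ A -> baire w x) ->
  determined w A.

(* The real line of M: a complete ordered field in the sense of M, which M *)
(* proves to be unique up to isomorphism.  [code] identifies the elements of *)
(* the set [line] with an ordered field of Rocq; the operations and the order *)
(* are sets of M, and completeness is only required for subsets of the line *)
(* that belong to M. *)
Record real_line (M : set_structure) := RealLine {
  reals :> realFieldType;
  code : reals -> M;
  line : M;
  code_inj : injective code;
  lineP : forall x : M, x ∈ line <-> exists r : reals, x = code r;
  add_internal : exists g : M, forall p : M, p ∈ g <->
    exists (a b : reals) (q : M),
      is_opair (code a) (code b) q /\ is_opair q (code (a + b)) p;
  mul_internal : exists g : M, forall p : M, p ∈ g <->
    exists (a b : reals) (q : M),
      is_opair (code a) (code b) q /\ is_opair q (code (a * b)) p;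
  le_internal : exists g : M, forall p : M, p ∈ g <->
    exists a b : reals, a <= b /\ is_opair (code a) (code b) p;
  line_complete : forall S : M, incl S line -> ~ is_empty S ->
    (exists b : reals, forall a : reals, code a ∈ S -> a <= b) ->
    exists s : reals, (forall a : reals, code a ∈ S -> a <= s) /\
      forall b : reals, (forall a : reals, code a ∈ S -> a <= b) -> s <= b
}.

Arguments code {M K} r : rename.
Arguments line {M} K : rename.

(* R^d, as the class of functions from d = {0, ..., d-1} to the line *)
Definition euclidean (M : set_structure) (K : real_line M) (d x : M) : Prop :=
  is_fun x d (fun a => a ∈ line K).

(* t = u(0) + ... + u(n-1); s is the sequence of partial sums *)
Definition is_sum (M : set_structure) (K : real_line M) (n u : M) (t : K) : Prop :=
  exists n' s : M, is_succ n n' /\ is_fun s n' (fun a => a ∈ line K) /\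
    (forall e : M, is_empty e -> inrel s e (code (0 : K))) /\
    (forall (i j : M) (a b : K), i ∈ n -> is_succ i j ->
       inrel s i (code a) -> inrel u i (code b) -> inrel s j (code (a + b))) /\
    inrel s n (code t).

Definition is_dist (M : set_structure) (K : real_line M) (d x y : M) (r : K) : Prop :=
  0 <= r /\
  exists u : M, is_fun u d (fun a => a ∈ line K) /\
    (forall (i : M) (a b : K), i ∈ d -> inrel x i (code a) -> inrel y i (code b) ->
       inrel u i (code ((a - b) ^+ 2))) /\
    is_sum d u (r ^+ 2).

Definition diam_le (M : set_structure) (K : real_line M) (d U : M) (r : K) : Prop :=
  forall (x y : M) (t : K), x ∈ U -> y ∈ U -> is_dist d x y t -> t <= r.

(* For U nonempty; the empty set has no least upper bound in K here. *)
Definition is_diam (M : set_structure) (K : real_line M) (d U : M) (r : K) : Prop :=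
  diam_le d U r /\ forall r' : K, diam_le d U r' -> r <= r'.

(* v = r ^ s for r, s >= 0.  For r > 0, t |-> r ^ t is the unique monotone *)
(* homomorphism from the additive group of reals to the multiplicative group *)
(* of positive reals taking 1 to r; moreover 0 ^ 0 = 1 and 0 ^ s = 0 for *)
(* s > 0. *)
Definition is_rpow (M : set_structure) (K : real_line M) (r s v : K) : Prop :=
  (0 < r /\ exists g : M, is_fun g (line K) (fun a => a ∈ line K) /\
     (forall a b x y : K, inrel g (code a) (code x) -> inrel g (code b) (code y) ->
        inrel g (code (a + b)) (code (x * y))) /\
     ((forall a b x y : K, inrel g (code a) (code x) -> inrel g (code b) (code y) ->
         a <= b -> x <= y) \/
      (forall a b x y : K, inrel g (code a) (code x) -> inrel g (code b) (code y) ->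
         a <= b -> y <= x)) /\
     inrel g (code (1 : K)) (code r) /\ inrel g (code s) (code v)) \/
  (r = 0 /\ ((s = 0 /\ v = 1) \/ (0 < s /\ v = 0))).

(* v = diam(U) ^ s, with the usual convention that the empty set contributes 0 *)
Definition is_gauge (M : set_structure) (K : real_line M) (d U : M) (s v : K) : Prop :=
  (is_empty U /\ v = 0) \/
  ((exists x : M, x ∈ U) /\ exists r : K, is_diam d U r /\ is_rpow r s v).

(* A is covered by a sequence (U_n) of subsets of R^d of diameter at most eps *)
(* with sum_n diam(U_n) ^ s <= eta; u is the sequence n |-> diam(U_n) ^ s. *)
Definition has_cover (M : set_structure) (K : real_line M) (w d A : M)
    (s eps eta : K) : Prop :=
  exists U u : M,
    is_fun U w (fun V => forall x : M, x ∈ V -> euclidean K d x) /\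
    is_fun u w (fun a => a ∈ line K) /\
    (forall x : M, x ∈ A -> exists n V : M, inrel U n V /\ x ∈ V) /\
    (forall n V : M, inrel U n V -> diam_le d V eps) /\
    (forall (n V : M) (v : K), inrel U n V -> inrel u n (code v) -> is_gauge d V s v) /\
    (forall (n : M) (t : K), n ∈ w -> is_sum n u t -> t <= eta).

(* H^s(A) = sup_{eps > 0} inf { sum_n diam(U_n) ^ s } = 0 *)
Definition hausdorff_null (M : set_structure) (K : real_line M) (w d A : M)
    (s : K) : Prop :=
  forall eps eta : K, 0 < eps -> 0 < eta -> has_cover w d A s eps eta.

(* h = inf { s >= 0 | H^s(A) = 0 } *)
Definition is_HD (M : set_structure) (K : real_line M) (w d A : M) (h : K) : Prop :=
  (forall s : K, 0 <= s -> hausdorff_null w d A s -> h <= s) /\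
  (forall h' : K, (forall s : K, 0 <= s -> hausdorff_null w d A s -> h' <= s) ->
     h' <= h).

Definition HD_ge (M : set_structure) (K : real_line M) (w d A : M) (delta : K) : Prop :=
  exists h : K, is_HD w d A h /\ delta <= h.

(* R is a subset of R^d x omega^omega *)
Definition is_relation (M : set_structure) (K : real_line M) (w d R : M) : Prop :=
  forall p : M, p ∈ R ->
    exists x y : M, euclidean K d x /\ baire w y /\ is_opair x y p.

Definition is_dom (M : set_structure) (K : real_line M) (w d R D : M) : Prop :=
  forall x : M,
    x ∈ D <-> euclidean K d x /\ exists y : M, baire w y /\ inrel R x y.

(* Continuity on B: the sets of sequences extending a given initial segment *)
(* y|n form a neighbourhood base of y in omega^omega. *)
Definition is_continuous (M : set_structure) (K : real_line M) (w d B f : M) : Prop :=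
  forall x y n : M, x ∈ B -> inrel f x y -> n ∈ w ->
  exists e : K, 0 < e /\
    forall (x' y' : M) (r : K),
      x' ∈ B -> inrel f x' y' -> is_dist d x x' r -> r < e ->
      forall i k : M, i ∈ n -> (inrel y i k <-> inrel y' i k).

(* Main.v *)
Require Import Defs.
From Stdlib Require Import Classical ClassicalEpsilon FunctionalExtensionality.
From mathcomp Require Import all_boot all_order all_algebra.
From mathcomp Require Import ring lra.

(** The statement concerns the interior of a model of ZF + AD, so every argument by induction,
    separation or completeness of the reals is restricted to predicates definable in the model.
    The first parts set up a language in which such arguments look like ordinary ones: Rocq types
    embedded in the model as sorts, a closure calculus for definability (the tactic dfn), recursion
    (fix_ex) and determinacy in terms of strategies as causal operators (determinacy).

    Let t = delta' > 0 and let s be strictly between t and the dimension of dom R.  A game is played in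
    which a bit sequence is produced that codes a point x, a sequence y and a bound on x (codes).  In
    each block of bits, the low digit of every coordinate and one bit of the code of y are announced
    by player I.  At the other rounds I divides the current mass, initially 1, between the two bits
    in multiples of 1 / g, and player II chooses the bit.  Player I wins if R (x, y) holds and the mass
    after k blocks, that is at cubes of side 2 ^ (- k L), is at most 2 ^ (- t k L) for all
    large k (payoff).

    Suppose that I has a winning strategy.  The plays against it form a binary tree on which the
    mass is a probability measure.  As the low digits of a block are announced before the others
    are chosen, points on different branches are at a distance comparable with the side of the cube
    where the branches part (codes_sep, branch_sep).  Hence a point determines its branch, and y is a
    continuous function of x on the set B of all these points.  A cover of B of small total t-gauge
    is impossible by the mass distribution principle, here without measures: going down the tree one
    always finds a child whose mass is not exhausted by the sets that meet it (Inv_step), so that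
    some point of B is not covered (branch_uncovered).  Thus HD (B) >= t.

    Suppose that II has a winning strategy.  At every round there is a division j / g at which the
    answer of II switches, so either bit can be obtained by I with fractions of sum 1 + 1 / g.  Hence
    I can steer the play along the code of any pair in R, and the masses obtained satisfy a
    Kraft inequality up to a factor of 2 for each announced bit and 1 + 1 / g for the others
    (steer_mass_split).  Since I loses, every point of dom R lies in a cube of some side 2 ^ (- k L)
    with mass above 2 ^ (- t k L).  The gain 2 ^ ((s - t) L k) outweighs the factors lost, about
    2 ^ ((d + 2) k), when L is large.  So the total s-gauge of these cubes is as small as desired
    (win_II_covers), contrary to the choice of s.

    No choice is used in the model: a single strategy serves for all points, and the
    constructions that depend on it take least elements or are determined by recursion. *)

Set Implicit Arguments.
Unset Strict Implicit.
Unset Printing Implicit Defensive.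

Import Order.TTheory GRing.Theory Num.Theory.
Local Open Scope ring_scope.

(** * Predicates definable with parameters *)

(** The data are bundled in a class so that sets, naturals and reals need not mention the model. *)
Class world := World {
  wM : set_structure;
  wZF : ZF wM;
  wK : real_line wM;
  wo : wM;
  wo_omega : is_omega wo
}.

Notation V := (univ (@wM _)).
Notation R := (Num.RealField.sort (reals (@wK _))).

Lemma funext (A B : Type) (f g : A -> B) : (forall x, f x = g x) -> f = g.
Proof. exact: functional_extensionality. Qed.

Fixpoint ren (r : nat -> nat) (phi : formula) : formula :=
  let lift r := fun n => if n is m.+1 then (r m).+1 else 0%N in
  match phi with
  | Fmem i j => Fmem (r i) (r j)
  | Feq i j => Feq (r i) (r j)
  | Fbot => Fbot
  | Fimp p q => Fimp (ren r p) (ren r q)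
  | Fand p q => Fand (ren r p) (ren r q)
  | For p q => For (ren r p) (ren r q)
  | Fall p => Fall (ren (lift r) p)
  | Fex p => Fex (ren (lift r) p)
  end.

Lemma sat_ren (M : set_structure) phi : forall r (v : nat -> M),
  sat v (ren r phi) <-> sat (fun n => v (r n)) phi.
Proof.
have E (x : M) r v : (fun n => push x v (if n is m.+1 then (r m).+1 else 0%N))
    = push x (fun n => v (r n)).
  by apply: funext => -[].
elim: phi => //=.
- by move=> p IHp q IHq r v; rewrite IHp IHq.
- by move=> p IHp q IHq r v; rewrite IHp IHq.
- by move=> p IHp q IHq r v; rewrite IHp IHq.
- by move=> p IH r v; split=> H x; move: (H x); rewrite IH E.
- by move=> p IH r v; split=> -[x H]; exists x; move: H; rewrite IH E.
Qed.

Section Definability.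
Context {W : world}.

Definition look (rho : nat -> nat + V) (v : nat -> V) : nat -> V :=
  fun n => match rho n with inl i => v i | inr c => c end.

(** A type embedded as a definable class of the model, so that a quantifier over it can be
    relativized to a formula. *)
Class Srt (T : Type) := {
  enc : T -> V;
  enc_inj : injective enc;
  enc_img : exists phi rho, forall y : V,
    sat (look rho (fun _ => y)) phi <-> exists x : T, y = enc x
}.

Lemma encI T (s : Srt T) (x y : T) : enc x = enc y -> x = y.
Proof. exact: enc_inj. Qed.

(** Contexts are nested pairs of values of sorts; the last component is the variable 0. *)
Class Ctx (G : Type) := cenc : G -> nat -> V.
Global Instance ctx_unit : Ctx unit := fun _ _ => wo.
Global Instance ctx_ext G T (c : Ctx G) (s : Srt T) : Ctx (G * T) :=
  fun g => push (enc g.2) (cenc g.1).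

(** Separation, replacement, induction and completeness of the reals hold in the model for these
    predicates only.  As parameters are allowed, whatever does not depend on the context is definable. *)
Definition Dfn G {c : Ctx G} (P : G -> Prop) := exists phi rho,
  forall g, P g <-> sat (look rho (cenc g)) phi.

Definition Tm G {c : Ctx G} T {s : Srt T} (t : G -> T) :=
  Dfn (fun g : G * T => g.2 = t g.1).

(** Maps of contexts that only select variables or insert parameters. *)
Definition Cm G {c : Ctx G} D {c' : Ctx D} (f : G -> D) :=
  exists rho, forall g n, cenc (f g) n = look rho (cenc g) n.

Lemma Dfn_ext G (c : Ctx G) (P Q : G -> Prop) :
  (forall g, P g <-> Q g) -> Dfn P -> Dfn Q.
Proof. by move=> PQ [phi [rho H]]; exists phi, rho => g; rewrite -PQ H. Qed.

Lemma Tm_char G (c : Ctx G) T (s : Srt T) (t : G -> T) (P : G * T -> Prop) :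
  (forall g y, P (g, y) <-> y = t g) -> Dfn P -> Tm t.
Proof. by move=> H; apply: Dfn_ext => -[g y]; rewrite H. Qed.

Lemma Dfn_const G (c : Ctx G) (P : Prop) : Dfn (fun _ : G => P).
Proof.
case: (classic P) => HP; first by exists (Fimp Fbot Fbot), (fun n => inl n) => g /=; split.
by exists Fbot, (fun n => inl n) => g /=; split.
Qed.

(** Two formulas with parameters can be put over a common parameter assignment. *)
Lemma merge G (c : Ctx G) (P Q : G -> Prop) : Dfn P -> Dfn Q ->
  exists phi psi rho, (forall g, P g <-> sat (look rho (cenc g)) phi) /\
                 (forall g, Q g <-> sat (look rho (cenc g)) psi).
Proof.
move=> [phi [rho H]] [psi [sig H']].
exists (ren (fun n => n.*2) phi), (ren (fun n => n.*2.+1) psi),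
  (fun n => if odd n then sig n./2 else rho n./2); split=> g; rewrite sat_ren.
  rewrite H /look; set u := (fun n : nat => _); set v := (fun n : nat => _).
  suff -> : v = u by [].
  by apply: funext => n; rewrite /u /v /= odd_double doubleK.
rewrite H' /look; set u := (fun n : nat => _); set v := (fun n : nat => _).
suff -> : v = u by [].
by apply: funext => n; rewrite /u /v /= odd_double /= uphalf_double.
Qed.

Lemma Dfn_and G (c : Ctx G) (P Q : G -> Prop) :
  Dfn P -> Dfn Q -> Dfn (fun g => P g /\ Q g).
Proof.
move=> HP HQ; have [phi [psi [rho [H1 H2]]]] := merge HP HQ.
by exists (Fand phi psi), rho => g /=; rewrite H1 H2.
Qed.
Lemma Dfn_or G (c : Ctx G) (P Q : G -> Prop) :
  Dfn P -> Dfn Q -> Dfn (fun g => P g \/ Q g).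
Proof.
move=> HP HQ; have [phi [psi [rho [H1 H2]]]] := merge HP HQ.
by exists (For phi psi), rho => g /=; rewrite H1 H2.
Qed.
Lemma Dfn_imp G (c : Ctx G) (P Q : G -> Prop) :
  Dfn P -> Dfn Q -> Dfn (fun g => P g -> Q g).
Proof.
move=> HP HQ; have [phi [psi [rho [H1 H2]]]] := merge HP HQ.
by exists (Fimp phi psi), rho => g /=; rewrite H1 H2.
Qed.
Lemma Dfn_not G (c : Ctx G) (P : G -> Prop) : Dfn P -> Dfn (fun g => ~ P g).
Proof. by move=> HP; apply: Dfn_imp => //; apply: Dfn_const. Qed.
Lemma Dfn_iff G (c : Ctx G) (P Q : G -> Prop) :
  Dfn P -> Dfn Q -> Dfn (fun g => P g <-> Q g).
Proof. by move=> HP HQ; apply: Dfn_and; apply: Dfn_imp. Qed.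

Lemma Cm_id G (c : Ctx G) : Cm (fun g : G => g).
Proof. by exists (fun n => inl n). Qed.
Lemma Cm_tt G (c : Ctx G) : Cm (fun g : G => tt).
Proof. by exists (fun n => inr wo). Qed.
Lemma Cm_fst G (c : Ctx G) D (d : Ctx D) T (s : Srt T) (f : G -> D * T) :
  Cm f -> Cm (fun g => (f g).1).
Proof. by case=> rho H; exists (fun n => rho n.+1) => g n; exact: (H g n.+1). Qed.
Lemma Cm_pair G (c : Ctx G) D (d : Ctx D) E (e : Ctx E) T (s : Srt T)
    (f : G -> D) (h : G -> E * T) :
  Cm f -> Cm h -> Cm (fun g => (f g, (h g).2)).
Proof.
case=> rho H [sig H']; exists (fun n => if n is m.+1 then rho m else sig 0%N) => g [|n].
  exact: (H' g 0%N).
exact: (H g n).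
Qed.

Lemma Dfn_cm G (c : Ctx G) D (d : Ctx D) (f : G -> D) (P : D -> Prop) :
  Cm f -> Dfn P -> Dfn (fun g => P (f g)).
Proof.
case=> rho H [phi [sig H']].
exists phi, (fun n => match sig n with inl i => rho i | inr x => inr x end) => g.
rewrite H' /look; set u := (fun n : nat => _); set v := (fun n : nat => _).
suff -> : v = u by [].
apply: funext => n; rewrite /u /v; case: (sig n) => // i.
Qed.

Lemma Tm_cm G (c : Ctx G) D (d : Ctx D) T (s : Srt T) (f : G -> D) (t : D -> T) :
  Cm f -> Tm t -> Tm (fun g => t (f g)).
Proof.
move=> Hf Ht; apply: (Dfn_cm (f := fun g : G * T => (f g.1, g.2))) Ht.
apply: Cm_pair; last exact: Cm_id.
by case: Hf => rho H; exists (fun n => match rho n with inl i => inl i.+1 | inr x => inr x end)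
  => g n; rewrite H /look; case: (rho n).
Qed.

(** The quantifier is relativized to the image of the sort.  Even and odd slots separate the
    parameters of the formula from those of the definition of the image. *)
Lemma Dfn_all G (c : Ctx G) T (s : Srt T) (P : G -> T -> Prop) :
  Dfn (fun g : G * T => P g.1 g.2) -> Dfn (fun g => forall x : T, P g x).
Proof.
move=> HP.
have [psi [sig Hi]] := enc_img (T := T).
case: HP => phi [rho H].
pose r1 n := if n is m.+1 then (m.*2).+1 else 0%N.
pose f1 n := match rho n with inl 0 => 0%N | _ => n.*2.+1 end.
pose f2 n := match sig n with inl _ => 0%N | _ => n.*2.+2 end.
pose t n := if odd n then (match sig n./2 with inl _ => inl 0%N | inr x => inr x end)
            else match rho n./2 with inl i => inl i.-1 | inr x => inr x end.
exists (Fall (Fimp (ren f2 psi) (ren f1 phi))), t => g /=.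
have E1 y : sat (push y (look t (cenc g))) (ren f2 psi) <-> exists x, y = enc x.
  rewrite sat_ren -Hi; set u := (fun n : nat => _).
  suff -> : u = look sig (fun=> y) by [].
  apply: funext => n; rewrite /u /look /f2.
  by case E : (sig n) => [i|x] //=; rewrite /look /t /= odd_double /= uphalf_double E.
have E2 x : sat (push (enc x) (look t (cenc g))) (ren f1 phi) <-> P g x.
  rewrite sat_ren (H (g, x)); set u := (fun n : nat => _).
  set v := look rho _; suff -> : u = v by [].
  apply: funext => n; rewrite /u /v /look /f1.
  by case E : (rho n) => [[|i]|y] //=; rewrite /look /t /= odd_double /= doubleK E.
split=> [HP y /E1 [x ->]|HP x]; first by apply/E2.
by apply/E2/HP/E1; exists x.
Qed.

Lemma Dfn_ex G (c : Ctx G) T (s : Srt T) (P : G -> T -> Prop) :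
  Dfn (fun g : G * T => P g.1 g.2) -> Dfn (fun g => exists x : T, P g x).
Proof.
move=> HP; apply: (@Dfn_ext _ _ (fun g => ~ forall x : T, ~ P g x)).
  move=> g; split=> [H|[x Hx] H]; last exact: (H x).
  by apply: NNPP => H'; apply: H => x Hx; apply: H'; exists x.
by apply: Dfn_not; apply: Dfn_all; apply: Dfn_not.
Qed.

Lemma Tm_const G (c : Ctx G) T (s : Srt T) (x : T) : Tm (fun _ : G => x).
Proof.
exists (Feq 0 1), (fun n => if n is 1%N then inr (enc x) else inl n) => -[g y].
by rewrite /look /=; split=> [->//|]; apply: enc_inj.
Qed.

Lemma Tm_var G (c : Ctx G) D (d : Ctx D) T (s : Srt T) (f : G -> D * T) :
  Cm f -> Tm (fun g => (f g).2).
Proof.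
case=> rho H.
exists (Feq 0 1), (fun n => if n is 1%N then match rho 0%N with inl i => inl i.+1 | inr x => inr x end
   else inl 0%N) => -[g y].
have := H g 0%N; rewrite /look /cenc /ctx_ext /= => E; case: (rho 0%N) E => [i|x] /= E.
  by rewrite /cenc -E; split=> [->//|]; apply: enc_inj.
by rewrite -E; split=> [->//|]; apply: enc_inj.
Qed.

Lemma Tm_wk G (c : Ctx G) S (s' : Srt S) T (s : Srt T) (t : G -> T) :
  Tm t -> Tm (fun g : G * S => t g.1).
Proof. apply: (Tm_cm (f := fun g : G * S => g.1)); apply: Cm_fst; apply: Cm_id. Qed.

Lemma Dfn_eq G (c : Ctx G) T (s : Srt T) (a b : G -> T) :
  Tm a -> Tm b -> Dfn (fun g => a g = b g).
Proof.
move=> Ha Hb; apply: (@Dfn_ext _ _ (fun g => exists x, x = a g /\ x = b g)).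
  by move=> g; split=> [[x [-> ]]|->] //; exists (b g).
by apply: Dfn_ex; apply: Dfn_and; [exact: Ha | exact: Hb].
Qed.

Global Instance srtV : Srt V.
Proof.
apply: (@Build_Srt _ id) => //; exists (Fimp Fbot Fbot), (fun n => inl n) => y /=.
by split=> // _; exists y.
Defined.

Definition DP1 A {s : Srt A} (P : A -> Prop) := Dfn (fun g : unit * A => P g.2).
Definition DP2 A B {s : Srt A} {s' : Srt B} (P : A -> B -> Prop) :=
  Dfn (fun g : unit * A * B => P g.1.2 g.2).
Definition DP3 A B C {s : Srt A} {s' : Srt B} {s'' : Srt C} (P : A -> B -> C -> Prop) :=
  Dfn (fun g : unit * A * B * C => P g.1.1.2 g.1.2 g.2).
Definition DF1 A B {s : Srt A} {s' : Srt B} (f : A -> B) :=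
  Tm (fun g : unit * A => f g.2).
Definition DF2 A B C {s : Srt A} {s' : Srt B} {s'' : Srt C} (f : A -> B -> C) :=
  Tm (fun g : unit * A * B => f g.1.2 g.2).
Definition DF3 A B C D {s : Srt A} {s' : Srt B} {s'' : Srt C} {s''' : Srt D}
   (f : A -> B -> C -> D) :=
  Tm (fun g : unit * A * B * C => f g.1.1.2 g.1.2 g.2).

(** Terms are substituted by quantifying over their values, since formulas have no terms. *)
Lemma Dfn_sub1 A (s : Srt A) (P : A -> Prop) : DP1 P ->
  forall G (c : Ctx G) (a : G -> A), Tm a -> Dfn (fun g => P (a g)).
Proof.
move=> HP G c a Ha; apply: (@Dfn_ext _ _ (fun g => exists x, x = a g /\ P x)).
  by move=> g; split=> [[x [-> ]]|Px] //; exists (a g).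
apply: Dfn_ex; apply: Dfn_and; first exact: Ha.
apply: (Dfn_cm (f := fun g : G * A => (tt, g.2))) HP.
by apply: Cm_pair; [apply: Cm_tt|apply: Cm_id].
Qed.

Lemma Dfn_sub2 A B (s : Srt A) (s' : Srt B) (P : A -> B -> Prop) : DP2 P ->
  forall G (c : Ctx G) (a : G -> A) (b : G -> B), Tm a -> Tm b ->
  Dfn (fun g => P (a g) (b g)).
Proof.
move=> HP G c a b Ha Hb.
apply: (@Dfn_ext _ _ (fun g => exists x, x = a g /\ exists y, y = b g /\ P x y)).
  by move=> g; split=> [[x [-> [y [-> ]]]]|Px] //; exists (a g); split=> //; exists (b g).
apply: Dfn_ex; apply: Dfn_and; first exact: Ha.
apply: Dfn_ex; apply: Dfn_and.
  exact: (@Tm_wk _ _ A _ _ _ b Hb).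
apply: (Dfn_cm (f := fun g : G * A * B => (tt, g.1.2, g.2))) HP.
apply: (Cm_pair (h := fun g : G * A * B => g)); last exact: Cm_id.
apply: (Cm_pair (h := fun g : G * A * B => g.1)); first exact: Cm_tt.
by apply: Cm_fst; apply: Cm_id.
Qed.

Lemma Dfn_sub3 A B C (s : Srt A) (s' : Srt B) (s'' : Srt C) (P : A -> B -> C -> Prop) : DP3 P ->
  forall G (c : Ctx G) (a : G -> A) (b : G -> B) (d : G -> C), Tm a -> Tm b -> Tm d ->
  Dfn (fun g => P (a g) (b g) (d g)).
Proof.
move=> HP G c a b d Ha Hb Hd.
apply: (@Dfn_ext _ _ (fun g => exists x, x = a g /\ exists y, y = b g /\
   exists z, z = d g /\ P x y z)).
  move=> g; split=> [[x [-> [y [-> [z [->]]]]]]|Px] //.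
  by exists (a g); split=> //; exists (b g); split=> //; exists (d g).
apply: Dfn_ex; apply: Dfn_and; first exact: Ha.
apply: Dfn_ex; apply: Dfn_and.
  exact: (@Tm_wk _ _ A _ _ _ b Hb).
apply: Dfn_ex; apply: Dfn_and.
  exact: (@Tm_wk _ _ B _ _ _ _ (@Tm_wk _ _ A _ _ _ d Hd)).
apply: (Dfn_cm (f := fun g : G * A * B * C => (tt, g.1.1.2, g.1.2, g.2))) HP.
apply: (Cm_pair (h := fun g : G * A * B * C => g)); last exact: Cm_id.
apply: (Cm_pair (h := fun g : G * A * B * C => g.1)); last by apply: Cm_fst; exact: Cm_id.
apply: (Cm_pair (h := fun g : G * A * B * C => g.1.1)); first exact: Cm_tt.
by apply: Cm_fst; apply: Cm_fst; apply: Cm_id.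
Qed.

Lemma Tm_sub1 A B (s : Srt A) (s' : Srt B) (f : A -> B) : DF1 f ->
  forall G (c : Ctx G) (a : G -> A), Tm a -> Tm (fun g => f (a g)).
Proof.
move=> Hf G c a Ha; apply: (Dfn_sub2 (P := fun x y => y = f x)); first exact: Hf.
- exact: Tm_wk.
- by apply: (Tm_var (f := fun g => g)); apply: Cm_id.
Qed.
Lemma Tm_sub2 A B C (s : Srt A) (s' : Srt B) (s'' : Srt C) (f : A -> B -> C) : DF2 f ->
  forall G (c : Ctx G) (a : G -> A) (b : G -> B), Tm a -> Tm b -> Tm (fun g => f (a g) (b g)).
Proof.
move=> Hf G c a b Ha Hb; apply: (Dfn_sub3 (P := fun x y z => z = f x y)); first exact: Hf.
- exact: Tm_wk.
- exact: Tm_wk.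
- by apply: (Tm_var (f := fun g => g)); apply: Cm_id.
Qed.
Lemma Tm_sub3 A B C D (s : Srt A) (s' : Srt B) (s'' : Srt C) (s''' : Srt D)
   (f : A -> B -> C -> D) : DF3 f ->
  forall G (c : Ctx G) (a : G -> A) (b : G -> B) (d : G -> C), Tm a -> Tm b -> Tm d ->
  Tm (fun g => f (a g) (b g) (d g)).
Proof.
move=> Hf G c a b d Ha Hb Hd.
apply: (@Tm_char _ _ _ _ _ (fun gy => exists x, x = a gy.1 /\ gy.2 = f x (b gy.1) (d gy.1))).
  by move=> g y; split=> [[x [-> ]]|->] //; exists (a g).
apply: Dfn_ex; apply: Dfn_and.
  by apply: (Dfn_cm (f := fun g : G * D * A => (g.1.1, g.2))) Ha;
   apply: (Cm_pair (h := fun g : G * D * A => g)); [do 2 apply: Cm_fst|]; apply: Cm_id.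
(* the remaining four variables are reduced to three by fixing y first *)
apply: (@Dfn_ext _ _ (fun g : G * D * A => exists z, z = d g.1.1 /\
  exists y, y = b g.1.1 /\ g.1.2 = f g.2 y z)).
  move=> g; split=> [[z [-> [y [-> ]]]]|H] //.
  by exists (d g.1.1); split=> //; exists (b g.1.1).
apply: Dfn_ex; apply: Dfn_and.
  by apply: (Dfn_cm (f := fun g : G * D * A * C => (g.1.1.1, g.2))) Hd;
   apply: (Cm_pair (h := fun g : G * D * A * C => g)); [do 3 apply: Cm_fst|]; apply: Cm_id.
apply: Dfn_ex; apply: Dfn_and.
  by apply: (Dfn_cm (f := fun g : G * D * A * C * B => (g.1.1.1.1, g.2))) Hb;
   apply: (Cm_pair (h := fun g : G * D * A * C * B => g)); [do 4 apply: Cm_fst|]; apply: Cm_id.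
apply: (Dfn_cm (f := fun g : G * D * A * C * B => (tt, g.1.1.2, g.2, g.1.2, g.1.1.1.2))) Hf.
apply: (Cm_pair (h := fun g : G * D * A * C * B => g.1.1.1)); last by do 3 apply: Cm_fst; apply: Cm_id.
apply: (Cm_pair (h := fun g : G * D * A * C * B => g.1)); last by apply: Cm_fst; apply: Cm_id.
apply: (Cm_pair (h := fun g : G * D * A * C * B => g)); last exact: Cm_id.
apply: (Cm_pair (h := fun g : G * D * A * C * B => g.1.1)); last by do 2 apply: Cm_fst; apply: Cm_id.
exact: Cm_tt.
Qed.

Lemma Dfn_mem G (c : Ctx G) (a b : G -> V) : Tm a -> Tm b -> Dfn (fun g => a g ∈ b g).
Proof.
apply: (Dfn_sub2 (P := fun x y : V => x ∈ y)).
by exists (Fmem 1 0), (fun n => inl n) => g /=.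
Qed.

Lemma Tm_enc G (c : Ctx G) T (s : Srt T) (a : G -> T) : Tm a -> Tm (fun g => enc (a g)).
Proof.
apply: (Tm_sub1 (f := @enc _ s)).
by exists (Feq 0 1), (fun n => inl n) => g /=.
Qed.

Lemma separation (a : V) (P : V -> Prop) : DP1 P ->
  exists b : V, forall x, x ∈ b <-> x ∈ a /\ P x.
Proof.
move=> [phi [rho H]].
pose r n := match rho n with inl 0 => 0%N | _ => n.+1 end.
have [b Hb] := zf_separation wZF (ren r phi)
  (fun n => match rho n with inl _ => wo | inr x => x end) a.
exists b => x; rewrite Hb (H (tt, x)) sat_ren.
set u := (fun n : nat => _); set v := look _ _.
suff -> : u = v by [].
apply: funext => n; rewrite /u /v /r /look /cenc /ctx_ext /=.
by case E: (rho n) => [[|i]|y] //=; rewrite E.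
Qed.

Lemma replacement (a : V) (F : V -> V) : DF1 F ->
  exists b : V, forall y, y ∈ b <-> exists x, x ∈ a /\ y = F x.
Proof.
move=> [phi [rho H]].
pose r n := match rho n with inl 0 => 0%N | inl 1 => 1%N | _ => n.+2 end.
pose v n := match rho n with inl _ => wo | inr x => x end.
have E x y : sat (push y (push x v)) (ren r phi) <-> y = F x.
  rewrite sat_ren (H (tt, x, y)).
  set u := (fun n : nat => _); set v' := look _ _.
  suff -> : u = v' by [].
  apply: funext => n; rewrite /u /v' /r /look /cenc /ctx_ext /=.
  by case E: (rho n) => [[|[|i]]|z] //=; rewrite /v E.
have [|b Hb] := @zf_replacement _ wZF (ren r phi) v a.
  by move=> x y z _ /E -> /E ->.
by exists b => y; rewrite Hb; split=> -[x [xa /E]] e; exists x.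
Qed.

End Definability.

(** Otherwise a sort that is still unknown would be taken to be the first one found. *)
Global Hint Mode Srt - ! : typeclass_instances.

Ltac cm := repeat first [exact: Cm_id | exact: Cm_tt
   | match goal with
     | |- Cm fst => refine (@Cm_fst _ _ _ _ _ _ _ (fun g => g) _)
     | |- Cm (fun g => fst (@?f g)) => refine (@Cm_fst _ _ _ _ _ _ _ f _)
     end ].
(** The tactic dfn proves definability by following the syntax of the predicate.  Operations defined
    later join it through a chain of hooks that starts here. *)
Ltac dfn_fun := fail.
Ltac dfn_hyp :=
  match goal with
  | H : DP1 ?P |- Dfn (fun g => ?P _) => simple apply (Dfn_sub1 H)
  | H : DP2 ?P |- Dfn (fun g => ?P _ _) => simple apply (Dfn_sub2 H)
  | H : DP3 ?P |- Dfn (fun g => ?P _ _ _) => simple apply (Dfn_sub3 H)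
  | H : DF1 ?P |- Tm (fun g => ?P _) => simple apply (Tm_sub1 H)
  | H : DF2 ?P |- Tm (fun g => ?P _ _) => simple apply (Tm_sub2 H)
  | H : DF3 ?P |- Tm (fun g => ?P _ _ _) => simple apply (Tm_sub3 H)
  end.
Ltac dfn_step :=
  first [ match goal with H : Dfn _ |- _ => exact H | H : Tm _ |- _ => exact H end
  | simple apply Dfn_const | simple apply Tm_const
  | match goal with
    | |- Tm snd => refine (@Tm_var _ _ _ _ _ _ _ (fun g => g) _); solve [cm]
    | |- Tm (fun g => snd (@?f g)) => refine (@Tm_var _ _ _ _ _ _ _ f _); solve [cm]
    end
  | simple apply Dfn_and | simple apply Dfn_or
  | simple apply Dfn_not | simple apply Dfn_iff | simple apply Dfn_imp
  | match goal with
    | |- Dfn (fun g => forall x : ?T, @?P g x) => refine (@Dfn_all _ _ _ T _ P _)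
    | |- Dfn (fun g => exists x : ?T, @?P g x) => refine (@Dfn_ex _ _ _ T _ P _)
    end
  | simple apply Dfn_mem
  | match goal with
    | |- Dfn (fun g => @eq ?T (@?a g) (@?b g)) => refine (@Dfn_eq _ _ _ T _ a b _ _)
    | |- Tm (fun g => @enc _ ?T _ (@?a g)) => refine (@Tm_enc _ _ _ T _ a _)
    end
  | dfn_hyp | dfn_fun ].
Ltac dfn := rewrite /DP1 /DP2 /DP3 /DF1 /DF2 /DF3; repeat (cbv beta; dfn_step).

(** A term is definable if its graph is; P describes the graph. *)
Tactic Notation "by_char" uconstr(P) :=
  rewrite /DF1 /DF2 /DF3;
  match goal with |- @Tm _ ?G ?c ?T ?s ?t => refine (@Tm_char _ G c T s t P _ _) end.

Tactic Notation "by_equiv" uconstr(P) :=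
  rewrite /DP1 /DP2 /DP3;
  match goal with |- @Dfn _ ?G ?c ?Q => refine (@Dfn_ext _ G c P Q _ _) end.

(** * Sets and functions of the model *)

Section Sorts.
Context {W : world}.

(** Hilbert's choice operator; as the model need not satisfy choice, its values are definable
    only for predicates that determine them. *)
Definition eps (T : Type) (x0 : T) (P : T -> Prop) : T :=
  match excluded_middle_informative (exists x, P x) with
  | left H => proj1_sig (constructive_indefinite_description _ H)
  | right _ => x0
  end.

Lemma epsP (T : Type) (x0 : T) (P : T -> Prop) : (exists x, P x) -> P (eps x0 P).
Proof.
rewrite /eps; case: excluded_middle_informative => // H _.
exact: proj2_sig (constructive_indefinite_description _ H).
Qed.

Lemma epsU (T : Type) (x0 : T) (P : T -> Prop) x : P x -> (forall y, P y -> y = x) -> eps x0 P = x.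
Proof. by move=> Px H; apply: H; apply: epsP; exists x. Qed.

Lemma epsN (T : Type) (x0 : T) (P : T -> Prop) : ~ (exists x, P x) -> eps x0 P = x0.
Proof. by rewrite /eps; case: excluded_middle_informative. Qed.

Definition ite (T : Type) (P : Prop) (a b : T) : T := if excluded_middle_informative P then a else b.
Lemma iteT (T : Type) (P : Prop) (a b : T) : P -> ite P a b = a.
Proof. by rewrite /ite; case: excluded_middle_informative. Qed.
Lemma iteF (T : Type) (P : Prop) (a b : T) : ~ P -> ite P a b = b.
Proof. by rewrite /ite; case: excluded_middle_informative. Qed.
Lemma Tm_ite G (c : Ctx G) T (s : Srt T) (P : G -> Prop) (a b : G -> T) :
  Dfn P -> Tm a -> Tm b -> Tm (fun g => ite (P g) (a g) (b g)).
Proof.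
move=> HP Ha Hb; by_char (fun g => (P g.1 /\ g.2 = a g.1) \/ (~ P g.1 /\ g.2 = b g.1)).
  move=> g y /=; case: (classic (P g)) => h; rewrite ?(iteT _ _ h) ?(iteF _ _ h).
    by split=> [[[_ ->]|[]]|->] //; left.
  by split=> [[[]|[_ ->]]|->] //; right.
have HP' : Dfn (fun g : G * T => P g.1) by apply: (Dfn_cm (f := fun g : G * T => g.1)) HP; cm.
by apply: Dfn_or; apply: Dfn_and => //; apply: Dfn_not.
Qed.

Lemma ext (x y : V) : (forall z, z ∈ x <-> z ∈ y) -> x = y.
Proof. by move=> H; apply: (zf_extensionality wZF H). Qed.

Definition upair (x y : V) : V := eps wo (is_upair x y).
Lemma upairP x y : is_upair x y (upair x y).
Proof. by apply: epsP; apply: (zf_pairing wZF). Qed.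
Definition opair (x y : V) : V := upair (upair x x) (upair x y).

Lemma upair_eq x y p : is_upair x y p -> p = upair x y.
Proof. by move=> H; apply: ext => z; rewrite H upairP. Qed.

Lemma is_opairE x y p : is_opair x y p <-> p = opair x y.
Proof.
split=> [[s [t [/upair_eq -> [/upair_eq -> /upair_eq ->]]]]|->] //.
by exists (upair x x), (upair x y); split; [|split]; apply: upairP.
Qed.

Lemma upair_inj x y z t : upair x y = upair z t -> (x = z /\ y = t) \/ (x = t /\ y = z).
Proof.
move=> E.
have Ex : x = z \/ x = t by apply/upairP; rewrite -E; apply/upairP; left.
have Ey : y = z \/ y = t by apply/upairP; rewrite -E; apply/upairP; right.
have Ez : z = x \/ z = y by apply/upairP; rewrite E; apply/upairP; left.
have Et : t = x \/ t = y by apply/upairP; rewrite E; apply/upairP; right.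
by case: Ex Ey Ez Et => -> [] -> [] ? [] ?; subst; auto.
Qed.

Lemma opair_inj x y z t : opair x y = opair z t -> x = z /\ y = t.
Proof.
case/upair_inj => [[E F]|[E F]].
  have xz : x = z by case: (upair_inj E) => -[].
  by subst z; split=> //; case: (upair_inj F) => -[] E1 E2; congruence.
by case: (upair_inj E) => -[] ? ?; case: (upair_inj F) => -[] ? ?; split; congruence.
Qed.

Lemma DF2_opair : DF2 opair.
Proof.
by_char (fun g => is_opair g.1.1.2 g.1.2 g.2).
  by move=> g y /=; rewrite is_opairE.
rewrite /is_opair /is_upair; dfn.
Qed.

Lemma inrelE (f x y : V) : inrel f x y <-> opair x y ∈ f.
Proof.
split=> [[p [/is_opairE -> //]]|H]; by exists (opair x y); rewrite is_opairE.
Qed.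

Lemma DP3_inrel : DP3 (fun f x y : V => inrel f x y).
Proof. rewrite /inrel /is_opair /is_upair; dfn. Qed.

Lemma img_dfn (P : V -> Prop) : DP1 P ->
  exists phi rho, forall y : V, sat (look rho (fun _ => y)) phi <-> P y.
Proof.
case=> phi [rho H].
exists phi, (fun n => match rho n with inl 0 => inl 0%N | inl _ => inr wo | inr x => inr x end).
move=> y; rewrite (H (tt, y)).
set u := look _ _; set v := look _ _; have -> : u = v; last by [].
apply: funext => n; rewrite /u /v /look /cenc /ctx_ext /=.
by case: (rho n) => [[|i]|x].
Qed.

(** * Natural numbers of the model *)

Definition N := {n : V | n ∈ wo}.

Lemma N_inj : injective (fun n : N => proj1_sig n).
Proof. by move=> [x hx] [y hy] /= E; subst; congr exist; apply: proof_irrelevance. Qed.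

Global Instance srtN : Srt N.
Proof.
apply: (@Build_Srt _ N (fun n => proj1_sig n)); first exact: N_inj.
have [|phi [rho H]] := @img_dfn (fun y => y ∈ wo); first by dfn.
exists phi, rho => y; rewrite H; split=> [h|[[x hx] -> //]].
by exists (exist _ y h).
Defined.

Lemma encNI (i n : N) : enc i = enc n -> i = n.
Proof. exact: encI. Qed.

Definition natv (x : V) (h : x ∈ wo) : N := exist _ x h.
Lemma encN (n : N) : enc n ∈ wo.
Proof. by case: n. Qed.

Lemma zero_ex : exists n : N, is_empty (enc n).
Proof. by case: wo_omega => -[[e [he ew]] _] _; exists (natv ew). Qed.
Definition zero : N := proj1_sig (constructive_indefinite_description _ zero_ex).
Lemma zeroP z : ~ z ∈ enc zero.
Proof. exact: (proj2_sig (constructive_indefinite_description _ zero_ex)). Qed.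

Lemma suc_ex (n : N) : exists m : N, is_succ (enc n) (enc m).
Proof.
case: wo_omega => -[_ H] _; have [y [hy yw]] := H _ (encN n).
by exists (natv yw).
Qed.
Definition suc (n : N) : N := proj1_sig (constructive_indefinite_description _ (suc_ex n)).
Lemma sucP n z : z ∈ enc (suc n) <-> z ∈ enc n \/ z = enc n.
Proof. exact: (proj2_sig (constructive_indefinite_description _ (suc_ex n))). Qed.

Lemma is_succE (n m : N) : is_succ (enc n) (enc m) <-> m = suc n.
Proof.
split=> [H|->]; last exact: sucP.
by apply: encI; apply: ext => z; rewrite sucP H.
Qed.

Lemma DF1_suc : DF1 suc.
Proof.
by_char (fun g => is_succ (enc g.1.2) (enc g.2)).
  by move=> g y; rewrite is_succE.
rewrite /is_succ; dfn.
Qed.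

(** omega is the least inductive set, and a definable predicate cuts out a set. *)
Lemma N_ind (P : N -> Prop) : DP1 P -> P zero -> (forall n, P n -> P (suc n)) ->
  forall n, P n.
Proof.
move=> HP P0 PS n.
have [|b Hb] := @separation _ wo (fun x => exists m : N, x = enc m /\ P m); first by dfn.
have bi : inductive_set b.
  split; first by exists (enc zero); split; [exact: zeroP | apply/Hb; split; [exact: encN | exists zero]].
  move=> x /Hb [xw [m [-> Pm]]]; exists (enc (suc m)); split; first exact: sucP.
  by apply/Hb; split; [exact: encN | exists (suc m); split=> //; apply: PS].
have [_ /(_ b bi) wb] := wo_omega.
have /Hb [_ [m [E Pm]]] := wb _ (encN n).
by rewrite (encI E).
Qed.

Definition nlt (i n : N) : Prop := enc i ∈ enc n.

Lemma DP2_nlt : DP2 nlt.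
Proof. rewrite /nlt; dfn. Qed.

Lemma nlt0 i : ~ nlt i zero. Proof. exact: zeroP. Qed.
Lemma nltS i n : nlt i (suc n) <-> nlt i n \/ i = n.
Proof.
rewrite /nlt sucP; split=> -[]; auto; last by move->; right.
by move/encNI; right.
Qed.
Lemma nltnn n : ~ nlt n n.
Proof.
move=> H; have [|y [/upairP Hy]] := zf_foundation wZF (x := upair (enc n) (enc n)).
  by move/(_ (enc n)); apply; apply/upairP; left.
move/(_ (enc n)); apply; split; last by apply/upairP; left.
by case: Hy => ->.
Qed.
Lemma in_omega_nat (n : N) z : z ∈ enc n -> z ∈ wo.
Proof.
move: n z; apply: N_ind; first by dfn.
  by move=> z /zeroP.
by move=> n IH z /sucP [/IH //|->]; apply: encN.
Qed.
Lemma nlt_trans i j n : nlt i j -> nlt j n -> nlt i n.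
Proof.
move: n; apply: N_ind; first by have ? := DP2_nlt; dfn.
  by move=> _ /nlt0.
move=> n IH ij /nltS [jn|<-]; apply/nltS; left=> //; exact: IH.
Qed.
Lemma nltSS i n : nlt i n -> nlt (suc i) (suc n).
Proof.
move: n; apply: N_ind; first by have ? := DP2_nlt; have ? := DF1_suc; dfn.
  by move/nlt0.
move=> n IH /nltS [/IH h|->]; apply/nltS; first by left.
by right.
Qed.
Lemma suc_inj : injective suc.
Proof.
move=> m n E.
have: nlt m (suc n) by rewrite -E; apply/nltS; right.
case/nltS=> // mn.
have: nlt n (suc m) by rewrite E; apply/nltS; right.
by case/nltS=> // nm; case: (@nltnn n); apply: nlt_trans nm mn.
Qed.
Lemma suc_neq0 n : suc n <> zero.
Proof. by move=> E; apply: (@nlt0 n); rewrite -E; apply/nltS; right. Qed.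
Lemma zero_or_suc n : n = zero \/ exists m, n = suc m.
Proof.
move: n; apply: N_ind; first by have ? := DF1_suc; dfn.
  by left.
by move=> n _; right; exists n.
Qed.

(** * Reals, booleans and sequences as sorts *)

Global Instance srtR : Srt R.
Proof.
apply: (@Build_Srt _ R (fun r => code r)); first exact: code_inj.
have [|phi [rho H]] := @img_dfn (fun y => y ∈ line wK); first by dfn.
by exists phi, rho => y; rewrite H lineP.
Defined.

Global Instance srtB : Srt bool.
Proof.
apply: (@Build_Srt _ bool (fun b => if b then wo else enc zero)).
  have H : wo <> enc zero by move=> E; apply: (@zeroP (enc zero)); rewrite -{2}E; apply: encN.
  by case=> -[] // /esym.
have [|phi [rho H]] := @img_dfn (fun y => y = wo \/ y = enc zero); first by dfn.
exists phi, rho => y; rewrite H; split=> [[]->|[[] ->]]; first by exists true.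
- by exists false.
- by left.
- by right.
Defined.

Lemma graph_of A (sA : Srt A) (a : V) (F : A -> V) : DF1 F ->
  exists g, forall p, p ∈ g <-> exists x : A, enc x ∈ a /\ p = opair (enc x) (F x).
Proof.
move=> HF; have ? := DF2_opair.
pose (H := fun x : V => eps wo (fun p => exists r : A, x = enc r /\ p = opair (enc r) (F r))).
have HE r : H (enc r) = opair (enc r) (F r).
  by apply: epsU; [exists r | move=> p [r' [/(@encI _ A) <- ->]]].
have HN x : (~ exists r : A, x = enc r) -> H x = wo.
  by move=> h; apply: epsN => -[p [r [E _]]]; apply: h; exists r.
have [|b Hb] := @replacement _ a H.
  by_char (fun g => (exists r : A, g.1.2 = enc r /\ g.2 = opair (enc r) (F r))
     \/ ((~ exists r : A, g.1.2 = enc r) /\ g.2 = wo)); last by dfn.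
  move=> [[] x] y /=; split=> [[[r [-> ->]]|[/HN -> //]]|->]; first by rewrite HE.
  case: (classic (exists r : A, x = enc r)) => [[r ->]|h]; last by right; rewrite HN.
  by left; exists r; rewrite HE.
have [|g Hg] := @separation _ b (fun p => exists x : A, enc x ∈ a /\ p = opair (enc x) (F x)).
  by dfn.
exists g => p; rewrite Hg; split=> [[]|[x [xa ->]]] //.
split; last by exists x.
by apply/Hb; exists (enc x); rewrite HE.
Qed.

Section Functions.
Context {T : Type} {s : Srt T}.

Lemma encTI (x y : T) : enc x = enc y -> x = y.
Proof. exact: encI. Qed.

Definition is_graph (f : N -> T) (g : V) : Prop :=
  forall p, p ∈ g <-> exists n, p = opair (enc n) (enc (f n)).

(** Sequences that belong to the model. *)
Definition fn := {f : N -> T | exists g, is_graph f g}.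
Definition ap (f : fn) : N -> T := proj1_sig f.
Coercion ap : fn >-> Funclass.

Definition graph (f : fn) : V := proj1_sig (constructive_indefinite_description _ (proj2_sig f)).
Lemma graphP (f : fn) : is_graph f (graph f).
Proof. exact: proj2_sig (constructive_indefinite_description _ (proj2_sig f)). Qed.

Lemma graph_app (f : fn) n x : opair (enc n) (enc x) ∈ graph f <-> x = f n.
Proof.
rewrite graphP; split=> [[m /opair_inj [/encNI -> /encTI //]]|->].
by exists n.
Qed.

Lemma fn_ext (f g : fn) : (forall n, f n = g n) -> f = g.
Proof.
case: f g => [f hf] [g hg] /= E.
have fg : f = g by apply: funext.
by subst g; congr exist; apply: proof_irrelevance.
Qed.

Lemma graph_inj : injective graph.
Proof. by move=> f g E; apply: fn_ext => n; apply/graph_app; rewrite -E; apply/graph_app. Qed.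

Definition graph_like (y : V) : Prop :=
  (forall p, p ∈ y -> exists (n : N) (x : T), p = opair (enc n) (enc x)) /\
  (forall n : N, exists x : T, opair (enc n) (enc x) ∈ y /\
     forall x' : T, opair (enc n) (enc x') ∈ y -> x' = x).

Lemma graph_likeP y : graph_like y <-> exists f : fn, y = graph f.
Proof.
split=> [[H1 H2]|[f ->]]; last first.
  split; first by move=> p; rewrite graphP => -[n ->]; exists n, (f n).
  by move=> n; exists (f n); split; [apply/graph_app | move=> x' /graph_app].
have h n := constructive_indefinite_description _ (H2 n).
have G : is_graph (fun n => proj1_sig (h n)) y.
  move=> p; split=> [py|[n ->]]; last by case: (proj2_sig (h n)).
  have [n [x E]] := H1 p py; exists n; rewrite E; congr (opair _ (enc _)).
  by case: (proj2_sig (h n)) => _; apply; rewrite -E.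
pose f : fn := exist _ _ (ex_intro _ y G).
by exists f; apply: ext => p; rewrite G graphP.
Qed.

Global Instance srtF : Srt fn.
Proof.
apply: (@Build_Srt _ fn graph); first exact: graph_inj.
have [|phi [rho H]] := @img_dfn graph_like.
  by rewrite /graph_like; have ? := DF2_opair; dfn.
by exists phi, rho => y; rewrite H graph_likeP.
Defined.

Lemma Tm_ap G (c : Ctx G) (f : G -> fn) (a : G -> N) :
  Tm f -> Tm a -> Tm (fun g => ap (f g) (a g)).
Proof.
apply: (Tm_sub2 (f := ap)).
by_char (fun g => opair (enc g.1.2) (enc g.2) ∈ enc g.1.1.2).
  by move=> g y; apply: graph_app.
by have ? := DF2_opair; dfn.
Qed.

Lemma mkfn (f : N -> T) : DF1 f -> exists h : fn, forall n, h n = f n.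
Proof.
move=> Hf.
have [|b Hb] := @graph_of N _ wo (fun n => enc (f n)); first by dfn.
suff G : is_graph f b by exists (exist _ f (ex_intro _ b G)).
move=> p; rewrite Hb; split=> [[n [_ ->]]|[n ->]]; exists n; split=> //.
exact: encN.
Qed.

(** The solution is glued from total functions that obey the recursion below some n; changing one
    value of such a function extends its validity by one step, so that no finite partial functions
    are needed. *)
Lemma fix_ex (t0 : T) (F : fn -> N -> T) : DF2 F ->
  (forall (x x' : fn) n, (forall i, nlt i n -> x i = x' i) -> F x n = F x' n) ->
  exists x : fn, forall n, x n = F x n.
Proof.
move=> DF na; have Dn := DP2_nlt; have Ds := DF1_suc.
have un n : forall (x x' : fn), (forall i, nlt i n -> x i = F x i) ->
    (forall i, nlt i n -> x' i = F x' i) -> forall i, nlt i n -> x i = x' i.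
  move: n; apply: N_ind; first by dfn; apply: Tm_ap; dfn.
    by move=> x x' _ _ i /nlt0.
  move=> n IH x x' H H' i /nltS [|->].
    apply: IH; move=> j jn; first by apply: H; apply/nltS; left.
    by apply: H'; apply/nltS; left.
  have nn : nlt n (suc n) by apply/nltS; right.
  rewrite (H _ nn) (H' _ nn); apply: na.
  apply: IH => j jn; first by apply: H; apply/nltS; left.
  by apply: H'; apply/nltS; left.
have exi : forall n, exists x : fn, forall i, nlt i n -> x i = F x i.
  apply: N_ind; first by dfn; apply: Tm_ap; dfn.
    have [|h _] := @mkfn (fun _ => t0); first by dfn.
    by exists h => i /nlt0.
  move=> n [x H].
  pose (f := fun i : N => ite (i = n) (F x n) (x i)).
  have [|h Hh] := @mkfn f.
    by rewrite /f /DF1; apply: Tm_ite; dfn; apply: Tm_ap; dfn.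
  exists h.
  have agr i : nlt i n -> h i = x i.
    by move=> li; rewrite Hh /f iteF // => E; case: (@nltnn n); rewrite -{1}E.
  move=> i /nltS [li|->].
    rewrite agr // H //; apply: na => j lj; rewrite agr //; exact: nlt_trans lj li.
  rewrite {1}Hh /f iteT //.
  by apply: na => j lj; rewrite agr.
pose (f := fun n : N => eps t0 (fun y => exists x : fn, (forall i, nlt i (suc n) -> x i = F x i) /\ y = x n)).
have fP n (x : fn) : (forall i, nlt i (suc n) -> x i = F x i) -> f n = x n.
  move=> H; apply: epsU; first by exists x.
  by move=> y [x' [H' ->]]; apply: (un _ _ _ H' H); apply/nltS; right.
have [|h Hh] := @mkfn f.
  by_char (fun g => exists x : fn, (forall i, nlt i (suc g.1.2) -> x i = F x i) /\ g.2 = x g.1.2).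
    move=> [[] n] y /=; split=> [[x [H ->]]|->]; first by rewrite (fP _ _ H).
    by have [x H] := exi (suc n); exists x; rewrite (fP _ _ H).
  by dfn; apply: Tm_ap; dfn.
exists h => n.
have [x H] := exi (suc n).
rewrite Hh (fP _ _ H); rewrite H; last by apply/nltS; right.
apply: na => i li; rewrite Hh (fP _ x) // => j lj; apply: H; apply/nltS.
by left; case/nltS: lj => [lj|-> //]; apply: nlt_trans lj li.
Qed.

Lemma rec_ex (a : T) (G : N -> T -> T) : DF2 G ->
  exists x : fn, x zero = a /\ forall n, x (suc n) = G n (x n).
Proof.
move=> DG; have Ds := DF1_suc.
pose (F := fun (x : fn) n => eps a (fun y => exists m, n = suc m /\ y = G m (x m))).
have F0 x : F x zero = a.
  by apply: epsN => -[y [m [/esym /suc_neq0]]].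
have FS x n : F x (suc n) = G n (x n).
  by apply: epsU; [exists n | move=> y [m [/suc_inj -> ->]]].
have [||x Hx] := @fix_ex a F.
- by_char (fun g => (g.1.2 = zero /\ g.2 = a) \/
     exists m, g.1.2 = suc m /\ g.2 = G m (g.1.1.2 m)).
    move=> [[[] x] n] y /=; split=> [[[-> ->]|[m [-> ->]]]|->]; rewrite ?F0 ?FS //.
    by case: (zero_or_suc n) => [->|[m ->]]; [left; rewrite F0|right; exists m; rewrite FS].
  by dfn; apply: Tm_ap; dfn.
- move=> x x' n H; case: (zero_or_suc n) H => [->|[m ->]] H; rewrite ?F0 ?FS //.
  by rewrite H //; apply/nltS; right.
by exists x; split=> [|n]; rewrite Hx ?F0 ?FS.
Qed.

End Functions.
Lemma Tm_suc G (c : Ctx G) (a : G -> N) : Tm a -> Tm (fun g => suc (a g)).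
Proof. exact: (Tm_sub1 DF1_suc). Qed.
Lemma Dfn_nlt G (c : Ctx G) (a b : G -> N) : Tm a -> Tm b -> Dfn (fun g => nlt (a g) (b g)).
Proof. exact: (Dfn_sub2 DP2_nlt). Qed.
Lemma Tm_opair G (c : Ctx G) (a b : G -> V) : Tm a -> Tm b -> Tm (fun g => opair (a g) (b g)).
Proof. exact: (Tm_sub2 DF2_opair). Qed.
End Sorts.
Arguments fn {W} T {s}.
Ltac dfn_real := fail.

Ltac dfn_fun ::=
  match goal with
  | |- Tm (fun g => @ap _ ?T _ (@?f g) (@?a g)) => refine (@Tm_ap _ T _ _ _ f a _ _)
  | |- Tm (fun g => @ite ?T (@?P g) (@?a g) (@?b g)) => refine (@Tm_ite _ _ _ T _ P a b _ _ _)
  | |- Tm (fun g => suc (@?a g)) => refine (@Tm_suc _ _ _ a _)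
  | |- Tm (fun g => opair (@?a g) (@?b g)) => refine (@Tm_opair _ _ _ a b _ _)
  | |- Dfn (fun g => nlt (@?a g) (@?b g)) => refine (@Dfn_nlt _ _ _ a b _ _)
  | |- _ => dfn_real
  end.

(** * Real arithmetic in the model *)

Section Reals.
Context {W : world}.

Section Rules.
Context {G : Type} {c : Ctx G}.

Lemma Tm_add (a b : G -> R) : Tm a -> Tm b -> Tm (fun g => a g + b g).
Proof.
apply: (Tm_sub2 (f := fun a b : R => a + b)).
have [h Hh] := @add_internal _ wK.
by_char (fun g => opair (opair (enc g.1.1.2) (enc g.1.2)) (enc g.2) ∈ h); last by dfn.
move=> [[u x] y] z /=; rewrite Hh; split=> [[a0 [b0 [q []]]]|->].
  by rewrite !is_opairE => -> /opair_inj [/opair_inj [/code_inj -> /code_inj ->] /code_inj].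
by exists x, y, (opair (code x) (code y)); rewrite !is_opairE.
Qed.

Lemma Tm_mul (a b : G -> R) : Tm a -> Tm b -> Tm (fun g => a g * b g).
Proof.
apply: (Tm_sub2 (f := fun a b : R => a * b)).
have [h Hh] := @mul_internal _ wK.
by_char (fun g => opair (opair (enc g.1.1.2) (enc g.1.2)) (enc g.2) ∈ h); last by dfn.
move=> [[u x] y] z /=; rewrite Hh; split=> [[a0 [b0 [q []]]]|->].
  by rewrite !is_opairE => -> /opair_inj [/opair_inj [/code_inj -> /code_inj ->] /code_inj].
by exists x, y, (opair (code x) (code y)); rewrite !is_opairE.
Qed.

Lemma Dfn_le (a b : G -> R) : Tm a -> Tm b -> Dfn (fun g => a g <= b g).
Proof.
apply: (Dfn_sub2 (P := fun a b : R => a <= b)).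
have [h Hh] := @le_internal _ wK.
by_equiv (fun g => opair (enc g.1.2) (enc g.2) ∈ h); last by dfn.
move=> [[u x] y] /=; rewrite Hh; split=> [[a0 [b0 []]]|h1].
  by rewrite !is_opairE => ab /opair_inj [/code_inj -> /code_inj ->].
by exists x, y; rewrite !is_opairE.
Qed.

Lemma Dfn_lt (a b : G -> R) : Tm a -> Tm b -> Dfn (fun g => a g < b g).
Proof.
move=> Ha Hb; by_equiv (fun g => ~ (b g <= a g)).
  by move=> g; rewrite ltNge; split=> /negP.
by apply: Dfn_not; apply: Dfn_le.
Qed.
End Rules.

Lemma Tm_opp G (c : Ctx G) (a : G -> R) : Tm a -> Tm (fun g => - a g).
Proof.
apply: (Tm_sub1 (f := fun a : R => - a)).
by_char (fun g => g.2 + g.1.2 = 0).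
  by move=> [u x] y /=; split=> [/eqP|->]; rewrite ?addNr // addr_eq0 => /eqP.
by dfn; apply: Tm_add; dfn.
Qed.

Lemma Tm_inv G (c : Ctx G) (a : G -> R) : Tm a -> Tm (fun g => (a g)^-1).
Proof.
apply: (Tm_sub1 (f := fun a : R => a^-1)).
by_char (fun g => (g.1.2 = 0 /\ g.2 = 0) \/ g.2 * g.1.2 = 1).
  move=> [u x] y /=; split=> [[[-> ->]|h]|->]; rewrite ?invr0 //.
    have x0 : x != 0 by apply/eqP => x0; move: h; rewrite x0 mulr0 => /esym/eqP; rewrite oner_eq0.
    by apply: (mulIf x0); rewrite h mulVf.
  by case: (eqVneq x 0) => [->|x0]; [left; rewrite invr0|right; rewrite mulVf].
by dfn; apply: Tm_mul; dfn.
Qed.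

Lemma Tm_sqr G (c : Ctx G) (a : G -> R) : Tm a -> Tm (fun g => a g ^+ 2).
Proof. by move=> Ha; apply: (Tm_mul Ha Ha). Qed.

Lemma Tm_norm G (c : Ctx G) (a : G -> R) : Tm a -> Tm (fun g => `|a g|).
Proof.
apply: (Tm_sub1 (f := fun a : R => `|a|)).
by_char (fun g => (0 <= g.1.2 /\ g.2 = g.1.2) \/ (g.1.2 <= 0 /\ g.2 = - g.1.2)).
  move=> [u x] y /=; split=> [[[h ->]|[h ->]]|->]; rewrite ?(ger0_norm h) ?(ler0_norm h) //.
  by case: (leP 0 x) => h; [left; rewrite ger0_norm|right; rewrite ltr0_norm // ltW].
by dfn; try (simple apply Tm_opp; dfn); apply: Dfn_le; dfn.
Qed.

Lemma sup_ex (P : R -> Prop) : DP1 P -> (exists a, P a) ->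
  (exists b, forall a, P a -> a <= b) ->
  exists s, (forall a, P a -> a <= s) /\ forall b, (forall a, P a -> a <= b) -> s <= b.
Proof.
move=> HP [a0 Pa0] [b0 hb0].
have [|S HS] := @separation _ (line wK) (fun x => exists r : R, x = enc r /\ P r); first by dfn.
have HS' (r : R) : code r ∈ S <-> P r.
  rewrite HS; split=> [[_ [r' [/code_inj -> //]]]|Pr].
  by split; [apply/lineP; exists r | exists r].
have [|||s [H1 H2]] := @line_complete _ wK S.
- by move=> x /HS [].
- by move/(_ (code a0)); apply; apply/HS'.
- by exists b0 => a /HS' /hb0.
exists s; split=> [a /HS'|b hb]; first exact: H1.
by apply: H2 => a /HS'; apply: hb.
Qed.

Section Build.
Context {T : Type} {s : Srt T}.

Lemma cfn_ex (a : T) : exists x : fn T, forall n, x n = a.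
Proof. by apply: mkfn; dfn. Qed.
Definition cfn (a : T) : fn T := proj1_sig (constructive_indefinite_description _ (cfn_ex a)).

Definition lam (t0 : T) (f : N -> T) : fn T := eps (cfn t0) (fun x => forall n, x n = f n).
Lemma lamE t0 f : DF1 f -> forall n, lam t0 f n = f n.
Proof. by move=> Hf; apply: (@epsP _ (cfn t0) (fun x : fn T => forall n, x n = f n)); apply: mkfn. Qed.

(** Fixing a value of the context turns it into parameters. *)
Lemma Tm_inst G (c : Ctx G) A (s1 : Srt A) B (s2 : Srt B) (F : G -> A -> B) (g : G) :
  Tm (fun h : G * A => F h.1 h.2) -> DF1 (F g).
Proof.
move=> H; rewrite /DF1.
apply: (Tm_cm (f := fun h : unit * A => (g, h.2))) H.
by exists (fun n => if n is m.+1 then inr (cenc g m) else inl 0%N) => h [|n].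
Qed.
Lemma Tm_inst2 G (c : Ctx G) A (s1 : Srt A) A' (s1' : Srt A') B (s2 : Srt B)
    (F : G -> A -> A' -> B) (g : G) :
  Tm (fun h : G * A * A' => F h.1.1 h.1.2 h.2) -> DF2 (F g).
Proof.
move=> H; rewrite /DF2.
apply: (Tm_cm (f := fun h : unit * A * A' => (g, h.1.2, h.2))) H.
by exists (fun n => match n with 0 => inl 0%N | 1 => inl 1%N | m.+2 => inr (cenc g m) end) => h [|[|n]].
Qed.

Lemma Tm_lam G (c : Ctx G) (t0 : T) (f : G -> N -> T) :
  Tm (fun h : G * N => f h.1 h.2) -> Tm (fun g => lam t0 (f g)).
Proof.
move=> Hf; by_char (fun h : G * fn T => forall n, h.2 n = f h.1 n).
  move=> g y /=; have E := lamE t0 (Tm_inst g Hf).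
  split=> [H|->] //; by apply: fn_ext => n; rewrite H E.
dfn.
by apply: (Tm_cm (f := fun h : G * fn T * N => (h.1.1, h.2))) Hf;
  apply: (Cm_pair (h := fun h : G * fn T * N => h)); cm.
Qed.

Definition rec (a : T) (F : N -> T -> T) : fn T :=
  eps (cfn a) (fun x => x zero = a /\ forall n, x (suc n) = F n (x n)).
Lemma recP a F : DF2 F -> rec a F zero = a /\ forall n, rec a F (suc n) = F n (rec a F n).
Proof.
move=> HF; apply: (@epsP _ (cfn a) (fun x : fn T => x zero = a /\ forall n, x (suc n) = F n (x n))).
exact: rec_ex.
Qed.
Lemma rec_uniq a F (x : fn T) : DF2 F -> x zero = a -> (forall n, x (suc n) = F n (x n)) -> x = rec a F.
Proof.
move=> HF x0 xS; have [r0 rS] := recP a HF.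
apply: fn_ext; apply: N_ind; first by dfn.
  by rewrite x0.
by move=> n IH; rewrite xS rS IH.
Qed.
Lemma Tm_rec G (c : Ctx G) (a : G -> T) (F : G -> N -> T -> T) :
  Tm a -> Tm (fun h : G * N * T => F h.1.1 h.1.2 h.2) -> Tm (fun g => rec (a g) (F g)).
Proof.
move=> Ha HF.
by_char (fun h : G * fn T => h.2 zero = a h.1 /\ forall n, exists x, x = h.2 n /\ h.2 (suc n) = F h.1 n x).
  move=> g y /=; have HFg := Tm_inst2 g HF; have [r0 rS] := recP (a g) HFg.
  split=> [[y0 yS]|->].
    by apply: rec_uniq => // n; have [x [-> ->]] := yS n.
  by split=> // n; exists (rec (a g) (F g) n).
dfn.
  by apply: (Tm_cm (f := fun h : G * fn T => h.1)) Ha; cm.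
by apply: (Tm_cm (f := fun h : G * fn T * N * T => (h.1.1.1, h.1.2, h.2))) HF;
  apply: (Cm_pair (h := fun h : G * fn T * N * T => h));
  first apply: (Cm_pair (h := fun h : G * fn T * N * T => h.1)); cm.
Qed.
End Build.

Definition rn_fn : fn R := rec (0 : R) (fun _ x => x + 1).
(** The naturals of the model embedded in its reals, where their arithmetic is carried out. *)
Definition rn (n : N) : R := rn_fn n.
Lemma rnP : rn zero = 0 /\ forall n, rn (suc n) = rn n + 1.
Proof.
have H : DF2 (fun (_ : N) (x : R) => x + 1) by rewrite /DF2; apply: Tm_add; dfn.
exact: (recP 0 H).
Qed.
Lemma rn0 : rn zero = 0. Proof. by case: rnP. Qed.
Lemma rnS n : rn (suc n) = rn n + 1. Proof. by case: rnP => _; apply. Qed.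
Lemma Tm_rn G (c : Ctx G) (a : G -> N) : Tm a -> Tm (fun g => rn (a g)).
Proof. by move=> Ha; rewrite /rn; dfn. Qed.
End Reals.

Ltac dfn_nat := fail.
Ltac dfn_real ::=
  match goal with
  | |- Tm (fun g => rn (@?a g)) => refine (@Tm_rn _ _ _ a _)
  | |- Tm rn => refine (@Tm_rn _ _ _ (fun x => x) _)
  | |- Tm (fun g => @rec _ ?T _ (@?a g) (@?F g)) => refine (@Tm_rec _ T _ _ _ a F _ _)
  | |- Tm (fun g => @lam _ ?T _ ?t (@?F g)) => refine (@Tm_lam _ T _ _ _ t F _)
  | |- Tm (fun g => (@?a g) ^+ 2) => refine (@Tm_sqr _ _ _ a _)
  | |- Tm (fun g => (@?a g) + (@?b g)) => refine (@Tm_add _ _ _ a b _ _)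
  | |- Tm (fun g => `|(@?a g)|) => refine (@Tm_norm _ _ _ a _)
  | |- Tm (fun g => - (@?a g)) => refine (@Tm_opp _ _ _ a _)
  | |- Tm (fun g => (@?a g) * (@?b g)) => refine (@Tm_mul _ _ _ a b _ _)
  | |- Tm (fun g => (@?a g)^-1) => refine (@Tm_inv _ _ _ a _)
  | |- Dfn (fun g => is_true ((@?a g) <= (@?b g))) => refine (@Dfn_le _ _ _ a b _ _)
  | |- Dfn (fun g => is_true ((@?a g) < (@?b g))) => refine (@Dfn_lt _ _ _ a b _ _)
  | |- _ => dfn_nat
  end.

Section Naturals.
Context {W : world}.

Lemma rn_ge0 n : 0 <= rn n.
Proof. by move: n; apply: N_ind; [dfn | rewrite rn0 | move=> n IH; rewrite rnS; lra]. Qed.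

Lemma rn_discrete i n : rn i < rn n -> rn i + 1 <= rn n.
Proof.
move: n i; apply: N_ind; first by dfn.
  by move=> i; have := rn_ge0 i; rewrite rn0; lra.
move=> n IH i; case: (zero_or_suc i) => [->|[j ->]]; rewrite ?rn0 !rnS.
  by have := rn_ge0 n; lra.
by have := IH j; lra.
Qed.

Lemma rn_inj i n : rn i = rn n -> i = n.
Proof.
move: n i; apply: N_ind; first by dfn.
  move=> i; case: (zero_or_suc i) => [->|[j ->]] //.
  by have := rn_ge0 j; rewrite rn0 !rnS => ? ?; exfalso; lra.
move=> n IH i; case: (zero_or_suc i) => [->|[j ->]].
  by have := rn_ge0 n; rewrite rn0 !rnS => ? ?; exfalso; lra.
by rewrite !rnS => H; congr suc; apply: IH; lra.
Qed.

Lemma rn_between m i : rn m <= rn i -> rn i < rn m + 1 -> i = m.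
Proof.
move=> h1 h2; apply: rn_inj; apply/eqP; rewrite eq_le h1 andbT leNgt.
by apply/negP => /rn_discrete; lra.
Qed.

Lemma nltP i n : nlt i n <-> rn i < rn n.
Proof.
split; move: n i; apply: N_ind; try by dfn.
- by move=> i /nlt0.
- move=> n IH i /nltS [/IH|->]; rewrite rnS; lra.
- by move=> i; have := rn_ge0 i; rewrite rn0; lra.
move=> n IH i; case: (zero_or_suc i) => [->|[j ->]] H.
  move: n {IH H}; apply: N_ind; first by dfn.
    by apply/nltS; right.
  by move=> n IH; apply/nltS; left.
by apply: nltSS; apply: IH; move: H; rewrite !rnS; lra.
Qed.

Lemma N_sind (P : N -> Prop) : DP1 P ->
  (forall n, (forall i, rn i < rn n -> P i) -> P n) -> forall n, P n.
Proof.
move=> HP H n; apply: (H); move: n; apply: N_ind; first by dfn.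
  by move=> i; have := rn_ge0 i; rewrite rn0; lra.
move=> n IH i; rewrite -nltP => /nltS [/nltP /IH //|->]; exact: H.
Qed.

Lemma N_least (P : N -> Prop) : DP1 P -> (exists n, P n) ->
  exists n, P n /\ forall i, P i -> rn n <= rn i.
Proof.
move=> HP [n Pn]; apply: NNPP => H; move: n Pn; apply: N_sind; first by dfn.
move=> n IH Pn; apply: H; exists n; split=> // i Pi.
by rewrite leNgt; apply/negP => /IH; apply.
Qed.

Lemma archimedean x : exists n, x < rn n.
Proof.
apply: NNPP => H.
have hb n : rn n <= x by rewrite leNgt; apply/negP => h; apply: H; exists n.
have [|||s [H1 H2]] := @sup_ex _ (fun r => exists n, r = rn n); first by dfn.
- by exists (rn zero), zero.
- by exists x => a [n ->].
have : s <= s - 1.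
  apply: H2 => a [n ->]; have := H1 (rn (suc n)); rewrite rnS.
  by move/(_ (ex_intro _ (suc n) (esym (rnS n)))); lra.
by lra.
Qed.

Lemma floor_ex x : 0 <= x -> exists n, rn n <= x < rn n + 1.
Proof.
move=> x0; have [|n [xn ln]] := @N_least (fun n => x < rn n) _ (archimedean x); first by dfn.
case: (zero_or_suc n) xn ln => [->|[m ->]] xn ln; first by move: xn; rewrite rn0; lra.
exists m; rewrite -rnS xn andbT leNgt; apply/negP => /ln; rewrite rnS; lra.
Qed.

Lemma floor_uniq x m n : rn n <= x < rn n + 1 -> rn m <= x < rn m + 1 -> m = n.
Proof.
move=> /andP [h1 h2] /andP [h3 h4]; apply: rn_inj; apply/eqP; rewrite eq_le.
by apply/andP; split; rewrite leNgt; apply/negP => /rn_discrete; lra.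
Qed.

Definition flr (x : R) : N := eps zero (fun n => rn n <= x < rn n + 1).
Lemma flrP x : 0 <= x -> rn (flr x) <= x < rn (flr x) + 1.
Proof. by move=> x0; apply: (@epsP _ zero (fun n => rn n <= x < rn n + 1)); apply: floor_ex. Qed.
Lemma flr_uniq x n : rn n <= x < rn n + 1 -> flr x = n.
Proof. by move=> h; apply: epsU => // m; apply: floor_uniq. Qed.

Lemma Dfn_andb G (c : Ctx G) (a b : G -> bool) :
  Dfn (fun g => a g) -> Dfn (fun g => b g) -> Dfn (fun g => a g && b g).
Proof.
move=> Ha Hb; by_equiv (fun g => a g /\ b g); last exact: Dfn_and.
by move=> g; split=> /andP.
Qed.

Lemma Tm_flr G (c : Ctx G) (a : G -> R) : Tm a -> Tm (fun g => flr (a g)).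
Proof.
apply: (Tm_sub1 (f := flr)).
by_char (fun g => (rn g.2 <= g.1.2 < rn g.2 + 1) \/ (g.1.2 < 0 /\ g.2 = zero)).
  move=> [u x] n /=; split=> [[h|[x0 ->]]|->]; first by rewrite (flr_uniq h).
    rewrite /flr epsN // => -[m /andP [h _]]; have := rn_ge0 m; lra.
  case: (ltP x 0) => x0; last by left; apply: flrP.
  by right; split=> //; rewrite /flr epsN // => -[m /andP [h _]]; have := rn_ge0 m; lra.
by dfn; apply: Dfn_andb; dfn.
Qed.

Definition isn (x : R) := exists n, x = rn n.
Lemma isn_rn n : isn (rn n). Proof. by exists n. Qed.
Lemma isn0 : isn 0. Proof. by exists zero; rewrite rn0. Qed.
Lemma isn1 : isn 1. Proof. by exists (suc zero); rewrite rnS rn0 add0r. Qed.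
Lemma isnD x y : isn x -> isn y -> isn (x + y).
Proof.
move=> [m ->] [n ->]; move: n; apply: N_ind; first by rewrite /isn; dfn.
  by exists m; rewrite rn0 addr0.
by move=> n [k E]; exists (suc k); rewrite !rnS -E addrA.
Qed.
Lemma isnM x y : isn x -> isn y -> isn (x * y).
Proof.
move=> hm [n ->]; move: n; apply: N_ind; first by rewrite /isn; dfn.
  by rewrite rn0 mulr0; apply: isn0.
by move=> n IH; rewrite rnS mulrDr mulr1; apply: isnD.
Qed.
Lemma isnB x y : isn x -> isn y -> y <= x -> isn (x - y).
Proof.
move=> [m ->] [n ->]; move: n m; apply: N_ind; first by rewrite /isn; dfn.
  by move=> m _; exists m; rewrite rn0 subr0.
move=> n IH m; case: (zero_or_suc m) => [->|[j ->]]; rewrite ?rn0 !rnS => h.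
  by have ? := rn_ge0 n; exfalso; lra.
have [|k E] := IH j; first by lra.
by exists k; rewrite -E; ring.
Qed.
Lemma isn_flr x : isn x -> rn (flr x) = x.
Proof. by move=> [n ->]; congr rn; apply: flr_uniq; rewrite lexx /=; lra. Qed.
Lemma isn_discrete x y : isn x -> isn y -> x < y -> x + 1 <= y.
Proof. by move=> [m ->] [n ->]; apply: rn_discrete. Qed.

End Naturals.
Ltac dfn_nat ::=
  match goal with
  | |- Dfn (fun g => is_true ((@?a g) && (@?b g))) => refine (@Dfn_andb _ _ _ a b _ _)
  | |- Tm (fun g => flr (@?a g)) => refine (@Tm_flr _ _ _ a _)
  | |- _ => progress rewrite /isn
  end.

(** * Logarithm and exponential *)

Section Exponential.
Context {W : world}.

Lemma Tm_epsU G (c : Ctx G) T (s : Srt T) (x0 : T) (P : G -> T -> Prop) :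
  (forall g y y', P g y -> P g y' -> y = y') -> Dfn (fun h : G * T => P h.1 h.2) ->
  Tm (fun g => eps x0 (P g)).
Proof.
move=> U HP; by_char (fun h : G * T => P h.1 h.2 \/ ((forall z, ~ P h.1 z) /\ h.2 = x0)).
  move=> g y /=; split=> [[Py|[H ->]]|->].
  - by rewrite (epsU _ Py) // => z Pz; apply: U Pz Py.
  - by rewrite epsN // => -[z Pz]; apply: (H z).
  case: (classic (exists z, P g z)) => H; first by left; apply: (@epsP _ x0 (P g)).
  by right; rewrite epsN //; split=> // z Pz; apply: H; exists z.
dfn; by apply: (Dfn_cm (f := fun h : G * T * T => (h.1.1, h.2))) HP;
  apply: (Cm_pair (h := fun h : G * T * T => h)); cm.
Qed.

Definition pw (a : R) : fn R := rec (1 : R) (fun _ x => x * a).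
Lemma pwP (a : R) : pw a zero = 1 /\ forall n, pw a (suc n) = pw a n * a.
Proof.
have H : DF2 (fun (_ : N) (x : R) => x * a) by dfn.
exact: (recP 1 H).
Qed.
Lemma pw0 a : pw a zero = 1. Proof. by case: (pwP a). Qed.
Lemma pwS a n : pw a (suc n) = pw a n * a. Proof. by case: (pwP a). Qed.
Lemma Tm_pw G (c : Ctx G) (a : G -> R) : Tm a -> Tm (fun g => pw (a g)).
Proof.
move=> Ha; rewrite /pw; dfn; try done.
by apply: (Tm_cm (f := fun h : G * N * R => h.1.1)) Ha; cm.
Qed.
End Exponential.

Ltac by_eps := cbv beta;
  match goal with |- Tm (fun g => @eps ?T ?x (@?P g)) => refine (@Tm_epsU _ _ _ T _ x P _ _) end.
Ltac dfn_pow := fail.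
Ltac dfn_nat ::=
  match goal with
  | |- Dfn (fun g => is_true ((@?a g) && (@?b g))) => refine (@Dfn_andb _ _ _ a b _ _)
  | |- Tm (fun g => flr (@?a g)) => refine (@Tm_flr _ _ _ a _)
  | |- Tm (fun g => pw (@?a g)) => refine (@Tm_pw _ _ _ a _)
  | |- Tm (fun g => code (@?a g)) => refine (@Tm_enc _ _ _ R srtR a _)
  | |- _ => progress rewrite /isn
  | |- _ => dfn_pow
  end.

Section Powers.
Context {W : world}.
Implicit Types (a b x r : R) (m n k : N).

Lemma pw_gt0 a n : 0 < a -> 0 < pw a n.
Proof.
move=> a0; move: n; apply: N_ind; first by dfn.
  by rewrite pw0.
by move=> n IH; rewrite pwS mulr_gt0.
Qed.
Lemma pwD a m n k : rn k = rn m + rn n -> pw a k = pw a m * pw a n.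
Proof.
move: n k; apply: N_ind; first by dfn.
  by move=> k; rewrite rn0 addr0 => /rn_inj ->; rewrite pw0 mulr1.
move=> n IH k; rewrite rnS; case: (zero_or_suc k) => [->|[j ->]]; rewrite ?rn0 ?rnS => E.
  by have ? := rn_ge0 m; have ? := rn_ge0 n; exfalso; lra.
by rewrite !pwS (IH j) ?mulrA //; lra.
Qed.
Lemma pwMl a b n : pw (a * b) n = pw a n * pw b n.
Proof.
move: n; apply: N_ind; first by dfn.
  by rewrite !pw0 mulr1.
by move=> n IH; rewrite !pwS IH; ring.
Qed.
Lemma pwX a m n k : rn k = rn m * rn n -> pw a k = pw (pw a m) n.
Proof.
move: n k; apply: N_ind; first by dfn.
  by move=> k; rewrite rn0 mulr0 -rn0 => /rn_inj ->; rewrite !pw0.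
move=> n IH k; rewrite rnS mulrDr mulr1 => E.
have [j Ej] : isn (rn m * rn n) by apply: isnM; apply: isn_rn.
by rewrite pwS -(IH j) //; apply: pwD; rewrite E Ej.
Qed.
Lemma pw_le a b n : 0 < a -> a <= b -> pw a n <= pw b n.
Proof.
move=> a0 ab; move: n; apply: N_ind; first by dfn.
  by rewrite !pw0.
move=> n IH; rewrite !pwS; apply: ler_pM => //; last exact: ltW.
exact/ltW/pw_gt0.
Qed.
Lemma pw_bern x n : 0 <= x -> 1 + rn n * x <= pw (1 + x) n.
Proof.
move=> x0; move: n; apply: N_ind; first by dfn.
  by rewrite pw0 rn0; lra.
move=> n IH; rewrite pwS rnS.
have : (1 + rn n * x) * (1 + x) <= pw (1 + x) n * (1 + x) by apply: ler_wpM2r => //; lra.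
have : 0 <= rn n * (x * x) by rewrite mulr_ge0 ?rn_ge0 ?mulr_ge0.
by lra.
Qed.
Lemma pw2_mono m n : rn m <= rn n -> pw 2 m <= pw 2 n.
Proof.
move=> mn; have [j Ej] := isnB (isn_rn n) (isn_rn m) mn.
rewrite (@pwD 2 m j n); last by lra.
have p : 0 < pw 2 m by apply: pw_gt0; lra.
have b := @pw_bern 1 j ler01; have j0 := rn_ge0 j.
have -> : (2 : R) = 1 + 1 by lra.
have e : (1 + 1 : R) = 2 by lra.
rewrite -[leLHS]mulr1; apply: ler_wpM2l; first by rewrite e; lra.
by lra.
Qed.
Lemma pw2_lt m n : pw 2 m < pw 2 n -> rn m < rn n.
Proof. by rewrite !ltNge; apply: contra => /pw2_mono. Qed.
Lemma pw2_le m n : pw 2 m <= pw 2 n -> rn m <= rn n.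
Proof.
move=> h; rewrite leNgt; apply/negP => /rn_discrete; rewrite -rnS => /pw2_mono.
by rewrite pwS; have : 0 < pw 2 n; [apply: pw_gt0; lra | lra].
Qed.
Lemma pw2_large x : exists n, x < pw 2 n.
Proof.
have [n xn] := archimedean x; exists n.
have := @pw_bern 1 n ler01; have -> : (1 + 1 : R) = 2 by lra.
by lra.
Qed.
Lemma intlog x : 1 <= x -> exists n, pw 2 n <= x < pw 2 n * 2.
Proof.
move=> x1; have [|n [xn ln]] := @N_least _ (fun n => x < pw 2 n) _ (pw2_large x); first by dfn.
case: (zero_or_suc n) xn ln => [->|[m ->]] xn ln; first by move: xn; rewrite pw0; lra.
exists m; rewrite -pwS xn andbT leNgt; apply/negP => /ln; rewrite rnS; lra.
Qed.

(** The logarithm to base 2 of r >= 1, defined from powers with natural exponents alone. *)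
Definition lg_frac r (q : R) := exists m n, 0 < rn n /\ pw 2 m <= pw r n /\ q * rn n = rn m.
Definition lg1 r : R := eps 0 (fun s => (forall q, lg_frac r q -> q <= s) /\
  forall b, (forall q, lg_frac r q -> q <= b) -> s <= b).

Lemma lg1P r : 1 <= r -> (forall q, lg_frac r q -> q <= lg1 r) /\
  forall b, (forall q, lg_frac r q -> q <= b) -> lg1 r <= b.
Proof.
move=> r1; apply: (@epsP _ 0 (fun s => (forall q, lg_frac r q -> q <= s) /\
  forall b, (forall q, lg_frac r q -> q <= b) -> s <= b)).
apply: sup_ex; first by rewrite /lg_frac; dfn.
  exists 0, zero, (suc zero); rewrite rnS rn0 pwS !pw0; split; [lra|split; lra].
have [k /ltW rk] := pw2_large r.
exists (rn k) => q [m [n [n0 [mn E]]]].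
have [j Ej] : isn (rn k * rn n) by apply: isnM; apply: isn_rn.
have h : rn m <= rn j.
  apply: pw2_le; apply: le_trans mn _; rewrite (@pwX 2 k n) //.
  by apply: pw_le => //; lra.
by rewrite -(ler_pM2r n0) E Ej.
Qed.

Lemma Tm_lg1 G (c : Ctx G) (a : G -> R) : Tm a -> Tm (fun g => lg1 (a g)).
Proof.
apply: (Tm_sub1 (f := lg1)); rewrite /DF1 /lg1; by_eps.
  move=> [u r] y y' /= [h1 h2] [h1' h2']; apply/eqP; rewrite eq_le.
  by rewrite (h2 _ h1') (h2' _ h1).
by rewrite /lg_frac; dfn.
Qed.

(** Rounding the logarithms of a ^ k and b ^ k down to integers costs at most 2, which becomes
    negligible after division by k. *)
Lemma lg1D a b : 1 <= a -> 1 <= b -> lg1 (a * b) = lg1 a + lg1 b.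
Proof.
move=> a1 b1; have ab1 : 1 <= a * b by rewrite -[1]mulr1 ler_pM.
have a0 : 0 < a by lra. have b0 : 0 < b by lra.
have [A1 A2] := lg1P a1; have [B1 B2] := lg1P b1; have [C1 C2] := lg1P ab1.
apply/eqP; rewrite eq_le; apply/andP; split; last first.
  rewrite -lerBrDr; apply: A2 => q1 [m1 [n1 [n10 [h1 E1]]]].
  rewrite lerBrDr addrC -lerBrDr; apply: B2 => q2 [m2 [n2 [n20 [h2 E2]]]].
  rewrite lerBrDr addrC; apply: C1.
  have [k Ek] : isn (rn n1 * rn n2) by apply: isnM; apply: isn_rn.
  have [i1 Ei1] : isn (rn m1 * rn n2) by apply: isnM; apply: isn_rn.
  have [i2 Ei2] : isn (rn m2 * rn n1) by apply: isnM; apply: isn_rn.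
  have [m Em] : isn (rn i1 + rn i2) by apply: isnD; apply: isn_rn.
  exists m, k; split; first by rewrite -Ek mulr_gt0.
  split; last by rewrite -Em -Ek -Ei1 -Ei2 -E1 -E2; ring.
  rewrite pwMl (@pwD 2 i1 i2 m) // (@pwX 2 m1 n2 i1) // (@pwX 2 m2 n1 i2) //.
  rewrite (@pwX a n1 n2 k) // (@pwX b n2 n1 k); last by rewrite mulrC.
  apply: ler_pM; try (apply/ltW/pw_gt0/pw_gt0; lra).
    by apply: pw_le => //; apply: pw_gt0; lra.
  by apply: pw_le => //; apply: pw_gt0; lra.
apply: C2 => q [m [n [n0 [h E]]]].
rewrite leNgt; apply/negP => hq.
have e0 : 0 < (q - (lg1 a + lg1 b)) * rn n by rewrite mulr_gt0 // subr_gt0.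
have [j0 hj0] := archimedean (2 / ((q - (lg1 a + lg1 b)) * rn n)).
have hj : 2 < (q - (lg1 a + lg1 b)) * rn n * rn (suc j0).
  rewrite rnS mulrC -ltr_pdivrMr //; lra.
move: (suc j0) (rn_ge0 j0) (rnS j0) hj => j p0 p1 hj {hj0}.
have j1 : 0 < rn j by lra.
have [k Ek] : isn (rn n * rn j) by apply: isnM; apply: isn_rn.
have k0 : 0 < rn k by rewrite -Ek mulr_gt0.
have pk x : 1 <= x -> 1 <= pw x k.
  move=> x1; have := @pw_bern (x - 1) k; have -> : 1 + (x - 1) = x by lra.
  have : 0 <= rn k * (x - 1) by rewrite mulr_ge0 ?rn_ge0 //; lra.
  by move=> h1 h2; apply: le_trans (h2 _); [rewrite lerDl | rewrite subr_ge0].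
have [al /andP [al1 al2]] := intlog (pk _ a1).
have [be /andP [be1 be2]] := intlog (pk _ b1).
have ha : rn al <= lg1 a * rn k.
  rewrite -ler_pdivrMr //; apply: A1; exists al, k; split=> //; split=> //.
  by rewrite divfK // gt_eqF.
have hb : rn be <= lg1 b * rn k.
  rewrite -ler_pdivrMr //; apply: B1; exists be, k; split=> //; split=> //.
  by rewrite divfK // gt_eqF.
have [i Ei] : isn (rn m * rn j) by apply: isnM; apply: isn_rn.
have [s Es] : isn (rn (suc al) + rn (suc be)) by apply: isnD; apply: isn_rn.
have : rn i < rn s.
  apply: pw2_lt; rewrite (@pwX 2 m j i) //.
  apply: (@le_lt_trans _ _ (pw (pw (a * b) n) j)).
    by apply: pw_le => //; apply: pw_gt0; lra.
  rewrite -(@pwX _ n j k) // pwMl (@pwD 2 (suc al) (suc be) s) // !pwS.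
  by apply: ltr_pM => //; apply/ltW/pw_gt0.
rewrite -Es -Ei !rnS -E; move: hj; rewrite -Ek in ha hb; lra.
Qed.

Lemma lg1_2 : lg1 2 = 1.
Proof.
have [|h1 h2] := @lg1P 2; first by lra.
apply/eqP; rewrite eq_le; apply/andP; split.
  apply: h2 => q [m [n [n0 [/pw2_le mn E]]]].
  by rewrite -(ler_pM2r n0) E mul1r.
by apply: h1; exists (suc zero), (suc zero); rewrite rnS rn0; split; [lra|split=> //; lra].
Qed.
Lemma lg1_mono a b : 1 <= a -> a <= b -> lg1 a <= lg1 b.
Proof.
move=> a1 ab; have b1 : 1 <= b by lra.
have [A1 A2] := lg1P a1; have [B1 B2] := lg1P b1.
apply: A2 => q [m [n [n0 [h E]]]]; apply: B1; exists m, n; split=> //; split=> //.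
by apply: le_trans h _; apply: pw_le => //; lra.
Qed.
Lemma lg1_gt0 a : 1 < a -> 0 < lg1 a.
Proof.
move=> a1; have [A1 _] := lg1P (ltW a1).
have [n hn] := archimedean (1 / (a - 1)).
have a10 : 0 < a - 1 by lra.
have n0 : 0 < rn n by apply: le_lt_trans hn; apply: divr_ge0; lra.
rewrite ltr_pdivrMr // in hn.
apply: (@lt_le_trans _ _ (1 / rn n)); first by rewrite divr_gt0.
apply: A1; exists (suc zero), n; split=> //; split; last first.
  by rewrite rnS rn0 divfK ?add0r // gt_eqF.
rewrite pwS pw0; have := @pw_bern (a - 1) n; have -> : 1 + (a - 1) = a by lra.
by move=> h; have := h (ltW a10); lra.
Qed.
Lemma lg1_pw a n : 1 <= a -> 1 <= pw a n /\ lg1 (pw a n) = rn n * lg1 a.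
Proof.
move=> a1; have ? := @Tm_lg1.
have l1 : lg1 1 = 0.
  by have := @lg1D 1 1; rewrite mul1r => h; have := h (lexx _) (lexx _); lra.
move: n; apply: N_ind; first by dfn; apply: Tm_lg1; dfn.
  by rewrite pw0 rn0 l1 mul0r.
move=> n [h1 h2]; rewrite pwS lg1D // h2 rnS; split; last by ring.
by rewrite -[1]mulr1; apply: ler_pM.
Qed.

(** The witness 1 + 1 / (2 k) works because its k-th power is at most 2. *)
Lemma lg1_small e : 0 < e -> exists c, 1 < c /\ lg1 c < e.
Proof.
move=> e0; have [k hk] := archimedean (1 / e).
have k0 : 0 < rn k by apply: le_lt_trans hk; apply: divr_ge0; lra.
rewrite ltr_pdivrMr // in hk.
have [x [x0 kx]] : exists x : R, 0 < x /\ rn k * x = 1 / 2.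
  by exists (1 / (2 * rn k)); split; [rewrite divr_gt0 // mulr_gt0|field; rewrite gt_eqF].
exists (1 + x); split; first by lra.
have H : forall i, rn i <= rn k -> (1 - rn i * x) * pw (1 + x) i <= 1.
  apply: N_ind; first by dfn.
    by rewrite pw0 rn0; lra.
  move=> i IH; rewrite rnS pwS => ik.
  apply: le_trans (IH _); last by lra.
  have p0 : 0 < pw (1 + x) i by apply: pw_gt0; lra.
  rewrite mulrA [in leLHS]mulrAC; apply: ler_wpM2r; first exact: ltW.
  have : 0 <= rn i * (x * x) by rewrite mulr_ge0 ?rn_ge0 ?mulr_ge0 // ltW.
  have : 0 <= x * x by rewrite mulr_ge0 // ltW.
  by lra.
have := H k (lexx _); rewrite kx => hp.
have h1 : 1 <= 1 + x by lra.
have [q1 q2] := lg1_pw k h1.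
have : lg1 (pw (1 + x) k) <= lg1 2 by apply: lg1_mono => //; lra.
rewrite q2 lg1_2 => h3.
by rewrite -(ltr_pM2l k0); lra.
Qed.

(** Both 1 + r and (1 + r) / r are at least 1, and r is their quotient. *)
Definition lg r : R := lg1 (1 + r) - lg1 ((1 + r) / r).

Lemma lgM a b : 0 < a -> 0 < b -> lg (a * b) = lg a + lg b.
Proof.
move=> a0 b0; rewrite /lg.
have g x : 0 < x -> 1 <= (1 + x) / x by move=> x0; rewrite ler_pdivlMr //; lra.
have ab0 : 0 < a * b by rewrite mulr_gt0.
have E : (1 + a * b) * ((1 + a) / a) * ((1 + b) / b) = (1 + a) * (1 + b) * ((1 + a * b) / (a * b)).
  by field; rewrite !gt_eqF.
have h1 : 1 <= 1 + a * b by lra. have h2 : 1 <= 1 + a by lra. have h3 : 1 <= 1 + b by lra.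
have p x y : 1 <= x -> 1 <= y -> 1 <= x * y by move=> *; rewrite -[1]mulr1; apply: ler_pM.
move: E (g _ a0) (g _ b0) (g _ ab0).
move: ((1 + a) / a) ((1 + b) / b) ((1 + a * b) / (a * b)) => u v w /(congr1 lg1) E gu gv gw.
by move: E; rewrite !lg1D //; [lra | exact: p | exact: p].
Qed.
Lemma lg_ge1 c : 1 <= c -> lg c = lg1 c.
Proof.
move=> c1; have c0 : 0 < c by lra.
have u1 : 1 <= (1 + c) / c by rewrite ler_pdivlMr //; lra.
have Eu : 1 + c = (1 + c) / c * c by field; rewrite gt_eqF.
rewrite /lg; move: u1 Eu; move: ((1 + c) / c) => u u1 ->.
by rewrite lg1D //; lra.
Qed.
Lemma lg_lt a b : 0 < a -> a < b -> lg a < lg b.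
Proof.
move=> a0 ab; have -> : b = a * (b / a) by field; rewrite gt_eqF.
have h : 1 < b / a by rewrite ltr_pdivlMr //; lra.
rewrite lgM //; last by lra.
by rewrite (lg_ge1 (ltW h)); have := lg1_gt0 h; lra.
Qed.
Lemma lg2 : lg 2 = 1. Proof. by rewrite lg_ge1 ?lg1_2 //; lra. Qed.
Lemma lg_1 : lg 1 = 0.
Proof. by have := @lgM 1 1 ltr01 ltr01; rewrite mul1r; lra. Qed.
Lemma lg_le a b : 0 < a -> a <= b -> lg a <= lg b.
Proof. by move=> a0; rewrite le_eqVlt => /orP [/eqP -> //|/(lg_lt a0)/ltW]. Qed.
Lemma lg_inj a b : 0 < a -> 0 < b -> lg a = lg b -> a = b.
Proof.
move=> a0 b0 E; case: (ltgtP a b) => // h.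
  by have := lg_lt a0 h; rewrite E ltxx.
by have := lg_lt b0 h; rewrite E ltxx.
Qed.
Lemma Tm_lg G (c : Ctx G) (a : G -> R) : Tm a -> Tm (fun g => lg (a g)).
Proof.
apply: (Tm_sub1 (f := lg)); rewrite /DF1 /lg; dfn; apply: Tm_lg1; dfn.
Qed.

(** A supremum works since the logarithm is continuous by lg1_small. *)
Lemma lg_surj x : exists r, 0 < r /\ lg r = x.
Proof.
have l2 n : lg (pw 2 n) = rn n.
  have [|h1 h2] := @lg1_pw 2 n; first by lra.
  by rewrite lg_ge1 // h2 lg1_2 mulr1.
have [|||s [s1 s2]] := @sup_ex _ (fun r => 0 < r /\ lg r <= x).
- by dfn; apply: Tm_lg; dfn.
- have [n hn] := archimedean (- x).
  have p : 0 < pw 2 n by apply: pw_gt0; lra.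
  exists (pw 2 n)^-1; split; first by rewrite invr_gt0.
  have := @lgM (pw 2 n) (pw 2 n)^-1 p; rewrite mulfV ?gt_eqF // lg_1 l2 invr_gt0 => /(_ p).
  by lra.
- have [n hn] := archimedean x; exists (pw 2 n) => r [r0 rx].
  rewrite leNgt; apply/negP => h.
  by have := lg_lt (pw_gt0 n (ltr0n _ 2)) h; rewrite l2; lra.
have s0 : 0 < s.
  have [n hn] := archimedean (- x).
  have p : 0 < pw 2 n by apply: pw_gt0; lra.
  apply: (@lt_le_trans _ _ (pw 2 n)^-1); first by rewrite invr_gt0.
  apply: s1; split; first by rewrite invr_gt0.
  have := @lgM (pw 2 n) (pw 2 n)^-1 p; rewrite mulfV ?gt_eqF // lg_1 l2 invr_gt0 => /(_ p).
  by lra.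
exists s; split=> //; case: (ltgtP (lg s) x) => // h.
  have [|c [c1 hc]] := @lg1_small (x - lg s); first by lra.
  have : s * c <= s.
    apply: s1; split; first by rewrite mulr_gt0 //; lra.
    by rewrite lgM ?(lg_ge1 (ltW c1)) //; lra.
  by rewrite -[leRHS]mulr1 ler_pM2l //; lra.
have [|c [c1 hc]] := @lg1_small (lg s - x); first by lra.
have c0 : 0 < c by lra.
have sc : lg s = lg (s / c) + lg c by rewrite -lgM ?divr_gt0 // divfK // gt_eqF.
have : s <= s / c.
  apply: s2 => r [r0 rx]; rewrite leNgt; apply/negP => hr.
  have := @lg_lt (s / c) r; rewrite divr_gt0 // => /(_ isT hr).
  by move: sc; rewrite (lg_ge1 (ltW c1)); lra.
rewrite ler_pdivlMr // -[leRHS]mulr1 ler_pM2l //; lra.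
Qed.

(** The exponential function to base 2. *)
Definition E x : R := eps 1 (fun r => 0 < r /\ lg r = x).
Lemma EP x : 0 < E x /\ lg (E x) = x.
Proof. exact: (@epsP _ 1 (fun r => 0 < r /\ lg r = x) (lg_surj x)). Qed.
Lemma E_gt0 x : 0 < E x. Proof. by case: (EP x). Qed.
Lemma lgE x : lg (E x) = x. Proof. by case: (EP x). Qed.
Lemma Elg r : 0 < r -> E (lg r) = r.
Proof. by move=> r0; apply: lg_inj => //; [apply: E_gt0 | rewrite lgE]. Qed.
Lemma ED x (y : R) : E (x + y) = E x * E y.
Proof.
apply: lg_inj; first exact: E_gt0.
  by apply: mulr_gt0; apply: E_gt0.
by rewrite lgM; [rewrite !lgE | exact: E_gt0 | exact: E_gt0].
Qed.
Lemma E0 : E 0 = 1. Proof. by rewrite -lg_1; apply: Elg; lra. Qed.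
Lemma E1 : E 1 = 2. Proof. have h : E (lg 2) = 2 by apply: Elg; lra.
by rewrite lg2 in h. Qed.
Lemma EN x : E (- x) = (E x)^-1.
Proof.
have h : E x != 0 by rewrite gt_eqF ?E_gt0.
by apply: (mulIf h); rewrite mulVf // -ED addNr E0.
Qed.
Lemma E_lt x (y : R) : x < y -> E x < E y.
Proof.
move=> xy; rewrite ltNge; apply/negP => h.
by have := lg_le (E_gt0 _) h; rewrite !lgE; lra.
Qed.
Lemma E_le x (y : R) : x <= y -> E x <= E y.
Proof. by rewrite le_eqVlt => /orP [/eqP -> //|/E_lt/ltW]. Qed.
Lemma Tm_E G (c : Ctx G) (a : G -> R) : Tm a -> Tm (fun g => E (a g)).
Proof.
apply: (Tm_sub1 (f := E)); rewrite /DF1 /E; by_eps.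
  by move=> [u r] y y' /= [h1 h2] [h1' h2']; apply: lg_inj => //; rewrite h2.
by dfn; apply: Tm_lg; dfn.
Qed.

(** A monotone additive function is linear: at n x it lies between its values at two consecutive
    naturals, so its deviation from the linear function is at most h 1 / n for every n. *)
Lemma monotone_additive (h : R -> R) : (forall a n, h (rn n * a) = rn n * h a) ->
  (forall a b, h (a + b) = h a + h b) -> (forall a b, a <= b -> h a <= h b) ->
  forall a, 0 <= a -> h a = a * h 1.
Proof.
move=> hn hD hm.
have h0 : h 0 = 0 by have := hD 0 0; rewrite addr0; lra.
move=> a a0.
have h1 : 0 <= h 1 by rewrite -h0; apply: hm.
have B n : rn n * `|h a - a * h 1| <= h 1.
  have na : 0 <= rn n * a by rewrite mulr_ge0 ?rn_ge0.
  have /andP [f1 f2] := flrP na; set m := flr _ in f1 f2.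
  have u1 : rn m * h 1 <= rn n * h a by rewrite -!hn mulr1; apply: hm.
  have u2 : rn n * h a <= (rn m + 1) * h 1.
    by rewrite -rnS -!hn mulr1; apply: hm; rewrite rnS ltW.
  have u3 : rn m * h 1 <= rn n * a * h 1 by apply: ler_wpM2r.
  have u4 : rn n * a * h 1 <= (rn m + 1) * h 1 by apply: ler_wpM2r => //; apply: ltW.
  rewrite -{1}[rn n](ger0_norm (rn_ge0 n)) -normrM ler_norml; apply/andP; split; lra.
apply/eqP; rewrite -subr_eq0 -normr_le0 leNgt; apply/negP => p.
have [n hn'] := archimedean (h 1 / `|h a - a * h 1|).
by move: hn'; rewrite ltr_pdivrMr // ltNge B.
Qed.

End Powers.

Ltac dfn_log := fail.
Ltac dfn_pow ::=
  match goal with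
  | |- Tm (fun g => lg (@?a g)) => refine (@Tm_lg _ _ _ a _)
  | |- Tm (fun g => E (@?a g)) => refine (@Tm_E _ _ _ a _)
  | |- _ => dfn_log
  end.

(** * Sums, distances and covers *)

Section Interface.
Context {W : world}.
Implicit Types (m n i k : N) (r s t u v : R).

Lemma Dfn_inrel G (c : Ctx G) (f x y : G -> V) : Tm f -> Tm x -> Tm y ->
  Dfn (fun g => inrel (f g) (x g) (y g)).
Proof. exact: (Dfn_sub3 DP3_inrel). Qed.

Definition psum (f : fn R) : fn R := rec (0 : R) (fun i x => x + f i).
Lemma psumP (f : fn R) : psum f zero = 0 /\ forall n, psum f (suc n) = psum f n + f n.
Proof.
have H : DF2 (fun (i : N) (x : R) => x + f i) by dfn.
exact: (recP 0 H).
Qed.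
Lemma psum0 f : psum f zero = 0. Proof. by case: (psumP f). Qed.
Lemma psumS f n : psum f (suc n) = psum f n + f n. Proof. by case: (psumP f). Qed.
Lemma Tm_psum G (c : Ctx G) (f : G -> fn R) : Tm f -> Tm (fun g => psum (f g)).
Proof.
move=> Hf; rewrite /psum; dfn.
by apply: (Tm_cm (f := fun h : G * N * R => h.1.1)) Hf; cm.
Qed.
End Interface.

Ltac dfn_sum := fail.
Ltac dfn_log ::=
  match goal with
  | |- Dfn (fun g => inrel (@?f g) (@?x g) (@?y g)) => refine (@Dfn_inrel _ _ _ f x y _ _ _)
  | |- Tm (fun g => psum (@?a g)) => refine (@Tm_psum _ _ _ a _)
  | |- _ => dfn_sum
  end.

Section Sums.
Context {W : world}.
Implicit Types (m n i k : N) (r s t u v : R) (f g h : fn R).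

Lemma psum_le f g n : (forall i, rn i < rn n -> f i <= g i) -> psum f n <= psum g n.
Proof.
move: n; apply: N_ind; first by dfn.
  by rewrite !psum0.
move=> n IH H; rewrite !psumS; apply: lerD; last by apply: H; rewrite rnS; lra.
by apply: IH => i hi; apply: H; rewrite rnS; lra.
Qed.
Lemma psum_mono f m n : (forall i, 0 <= f i) -> rn m <= rn n -> psum f m <= psum f n.
Proof.
move=> f0; move: n; apply: N_ind; first by dfn.
  by rewrite rn0 => h; have -> : m = zero by apply: rn_inj; rewrite rn0; have := rn_ge0 m; lra.
move=> n IH; rewrite rnS psumS => h; have := f0 n.
case: (leP (rn m) (rn n)) => [/IH|/rn_discrete hn]; first by lra.
have -> : m = suc n by apply: rn_inj; rewrite rnS; lra.
by rewrite psumS.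
Qed.
Lemma psum_ge0 f n : (forall i, 0 <= f i) -> 0 <= psum f n.
Proof. by move=> f0; rewrite -(psum0 f); apply: psum_mono => //; rewrite rn0 rn_ge0. Qed.
Lemma psum_term f n i : (forall i, 0 <= f i) -> rn i < rn n -> f i <= psum f n.
Proof.
move=> f0 hi; apply: (@le_trans _ _ (psum f (suc i))).
  by rewrite psumS; have := psum_ge0 i f0; lra.
by apply: psum_mono => //; rewrite rnS; apply: rn_discrete.
Qed.
Lemma psum_add f g h n : (forall i, h i = f i + g i) -> psum h n = psum f n + psum g n.
Proof.
move=> E; move: n; apply: N_ind; first by dfn.
  by rewrite !psum0 addr0.
by move=> n IH; rewrite !psumS IH E; ring.
Qed.
Lemma psum_scale f g (c : R) n : (forall i, g i = c * f i) -> psum g n = c * psum f n.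
Proof.
move=> E; move: n; apply: N_ind; first by dfn.
  by rewrite !psum0 mulr0.
by move=> n IH; rewrite !psumS IH E mulrDr.
Qed.
(** The children of the node coded by i are coded by 2 i and 2 i + 1, so this compares a sum over
    nodes with the sum over their children. *)
Lemma psum_pairs h g n k : (forall i j, rn j = 2 * rn i -> g i = h j + h (suc j)) ->
  rn k = 2 * rn n -> psum h k = psum g n.
Proof.
move=> E; move: n k; apply: N_ind; first by dfn.
  by move=> k; rewrite rn0 mulr0 -rn0 => /rn_inj ->; rewrite !psum0.
move=> n IH k; rewrite rnS => hk.
have [j Ej] : isn (2 * rn n).
  have -> : 2 * rn n = rn n + rn n by lra.
  by apply: isnD; apply: isn_rn.
have -> : k = suc (suc j) by apply: rn_inj; rewrite !rnS; lra.
by rewrite !psumS (E n j) ?(IH j) //; lra.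
Qed.

Lemma graph_fun A (sA : Srt A) (a : V) (F : A -> V) (Q : V -> Prop) : DF1 F ->
  (forall x, x ∈ a -> exists r : A, x = enc r /\ Q (F r)) ->
  exists g : V, is_fun g a Q /\ forall (r : A) y, inrel g (enc r) y <-> enc r ∈ a /\ y = F r.
Proof.
move=> HF H; have [g Hg] := @graph_of _ _ _ a _ HF.
have I (r : A) y : inrel g (enc r) y <-> enc r ∈ a /\ y = F r.
  rewrite inrelE Hg; split=> [[x [xa /opair_inj [/(@encI _ A) -> ->]]]|[ra ->]] //.
  by exists r.
exists g; split=> //; split.
  move=> p /Hg [r [ra ->]]; exists (enc r), (F r); rewrite is_opairE; split=> //; split=> //.
  by have [r' [/(@encI _ A) -> ]] := H _ ra.
move=> x xa; have [r [E Q1]] := H _ xa; exists (F r); subst x.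
by split; [apply/I | move=> y /I [_ ->]].
Qed.

Lemma is_sumE (f : fn R) n (u : V) t :
  (forall i b, rn i < rn n -> inrel u (enc i) (code b) <-> b = f i) ->
  is_sum (enc n) u t <-> t = psum f n.
Proof.
move=> Hu; split=> [[n' [s [Hn [[_ Hs] [H0 [HS Ht]]]]]]|->].
  have C : forall i, rn i <= rn n -> inrel s (enc i) (code (psum f i)).
    apply: N_ind; first by dfn.
      by move=> _; rewrite psum0; apply: H0; exact: zeroP.
    move=> i IH hi; rewrite psumS.
    have lt : rn i < rn n by move: hi; rewrite rnS; lra.
    apply: (HS (enc i)); first exact/nltP.
    - exact: sucP.
    - by apply: IH; apply: ltW.
    - exact/Hu.
  have [|y [_ U]] := Hs (enc n); first by apply/Hn; right.
  apply: (@code_inj _ wK); rewrite -(U _ Ht); exact: U (C _ (lexx _)).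
have [||s [Fs Is]] := @graph_fun N _ (enc (suc n)) (fun i => enc (psum f i)) (fun a => a ∈ line wK).
- by dfn.
- move=> x xs; have xw := in_omega_nat xs; exists (natv xw); split=> //.
  by apply/lineP; exists (psum f (natv xw)).
exists (enc (suc n)), s; split; first exact: sucP.
split=> //; split.
  move=> e he; have -> : e = enc zero by apply: ext => z; split=> [/he|/zeroP].
  by apply/Is; rewrite psum0; split=> //; apply/nltP; rewrite rnS rn0; have := rn_ge0 n; lra.
split; last by apply/Is; split=> //; apply/nltP; rewrite rnS; lra.
move=> x y a b xn Sxy; have xw := in_omega_nat xn.
pose i := natv xw; have Ei : x = enc i by [].
have hi : rn i < rn n by apply/nltP; rewrite /nlt -Ei.
move: Sxy xn; rewrite Ei => Sxy xn /Is [_ Ea] /(Hu _ _ hi) ->.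
have -> : y = enc (suc i) by apply: ext => z; rewrite sucP; apply: Sxy.
apply/Is; split; first by apply/nltP; rewrite !rnS; lra.
by rewrite psumS; congr (code (_ + _)); apply: (@code_inj _ wK).
Qed.

End Sums.

Section Metric.
Context {W : world}.
Context (d : N).
Implicit Types (m n i k : N) (r s t u v : R) (x y : V).

(** The uniqueness clause makes the term definable for every x, a vector or not. *)
Definition coord x i : R := eps 0 (fun a => inrel x (enc i) (enc a) /\
  forall b : R, inrel x (enc i) (enc b) -> b = a).
Definition euc x := euclidean wK (enc d) x.

Lemma coordP x i (a : R) : euc x -> rn i < rn d -> inrel x (enc i) (code a) <-> a = coord x i.
Proof.
move=> [H1 H2] /nltP hi; have [y [Hy U]] := H2 _ hi.
have [b E] : exists b : R, y = code b.
  move: Hy => [p [Hp px]]; have [x' [y' [_ [/lineP [b Eb] Hp']]]] := H1 _ px.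
  by exists b; move: Hp Hp'; rewrite !is_opairE => -> /opair_inj [_ ->].
subst y; have B (c : R) : inrel x (enc i) (code c) -> c = b.
  by move/U/(@code_inj _ wK).
have -> : coord x i = b by apply: epsU => [|c [/B //]]; split=> // c /B.
by split=> [/B //|->].
Qed.

Lemma Tm_coord G (c : Ctx G) (x : G -> V) (i : G -> N) : Tm x -> Tm i -> Tm (fun g => coord (x g) (i g)).
Proof.
apply: (Tm_sub2 (f := coord)); rewrite /DF2 /coord; by_eps; last by dfn.
by move=> g a b [h1 h2] [h3 h4]; apply: h4.
Qed.
End Metric.

Ltac dfn_coord := fail.
Ltac dfn_sum ::=
  match goal with
  | |- Tm (fun g => coord (@?f g) (@?i g)) => refine (@Tm_coord _ _ _ f i _ _)
  | |- _ => dfn_coord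
  end.

Section Distance.
Context {W : world} (d : N).
Implicit Types (m n i k : N) (r s t u v : R) (x y z : V).

Definition sqd x y : fn R := lam (0 : R) (fun i => (coord x i - coord y i) ^+ 2).
Lemma sqdE x y i : sqd x y i = (coord x i - coord y i) ^+ 2.
Proof. by rewrite lamE //; dfn. Qed.

Lemma sqd_ge0 x y i : 0 <= sqd x y i.
Proof. by rewrite sqdE sqr_ge0. Qed.

Lemma is_distE x y r : euc d x -> euc d y ->
  is_dist (enc d) x y r <-> 0 <= r /\ r ^+ 2 = psum (sqd x y) d.
Proof.
move=> ex ey.
split=> [[r0 [u [[_ Hu] [Hxy Hs]]]]|[r0 E]]; split=> //.
  have H i (b : R) : rn i < rn d -> inrel u (enc i) (code b) <-> b = sqd x y i; last first.
    by case: (is_sumE (r ^+ 2) H) => h _; apply: h.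
  move=> hi.
  have hu : inrel u (enc i) (code (sqd x y i)).
    rewrite sqdE; apply: (Hxy (enc i)); first exact/nltP.
    - exact/(coordP _ ex hi).
    - exact/(coordP _ ey hi).
  have [|c [_ U]] := Hu (enc i); first exact/nltP.
  by split=> [h|-> //]; apply: (@code_inj _ wK); rewrite -(U _ hu); symmetry; apply: U.
have [||u [Fu Iu]] := @graph_fun _ N _ (enc d) (fun i => enc (sqd x y i)) (fun a => a ∈ line wK).
- by dfn.
- move=> z zd; have zw := in_omega_nat zd; exists (natv zw); split=> //.
  by apply/lineP; exists (sqd x y (natv zw)).
exists u; split=> //; split.
  move=> z a b zd; have zw := in_omega_nat zd.
  have hi : rn (natv zw) < rn d by apply/nltP.
  move=> /(coordP _ ex hi) -> /(coordP _ ey hi) ->.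
  by apply/(Iu (natv zw)); split=> //; rewrite sqdE.
have H i (b : R) : rn i < rn d -> inrel u (enc i) (code b) <-> b = sqd x y i.
  move=> hi; rewrite (Iu i (code b)); split=> [[_ /(@code_inj _ wK) //]|->].
  by split=> //; apply/nltP.
by case: (is_sumE (r ^+ 2) H) => _ h; apply: h.
Qed.

Lemma sqrt_ex v : 0 <= v -> exists r, 0 <= r /\ r ^+ 2 = v.
Proof.
rewrite le_eqVlt => /orP [/eqP <-|v0]; first by exists 0; rewrite expr0n.
exists (E (lg v / 2)); split; first exact/ltW/E_gt0.
by rewrite expr2 -ED -{3}(Elg v0); congr E; field.
Qed.

Lemma dist_ex x y : euc d x -> euc d y -> exists r, is_dist (enc d) x y r.
Proof.
move=> ex ey; have [|r [r0 E]] := @sqrt_ex (psum (sqd x y) d).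
  by apply: psum_ge0 => i; apply: sqd_ge0.
by exists r; apply/is_distE.
Qed.

Lemma coord_le_dist x y r i : euc d x -> euc d y -> is_dist (enc d) x y r ->
  rn i < rn d -> `|coord x i - coord y i| <= r.
Proof.
move=> ex ey /(is_distE _ ex ey) [r0 E] hi.
rewrite -(@ler_pXn2r _ 2) // ?nnegrE ?normr_ge0 // E real_normK ?num_real // -sqdE.
by apply: psum_term => // j; apply: sqd_ge0.
Qed.

Lemma dist_le x y r t : euc d x -> euc d y -> is_dist (enc d) x y t -> 0 <= r ->
  (forall i, rn i < rn d -> `|coord x i - coord y i| <= r) -> t <= rn d * r.
Proof.
move=> ex ey /(is_distE _ ex ey) [t0 E] r0 H.
have B : forall n, rn n <= rn d -> psum (sqd x y) n <= rn n * r ^+ 2.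
  apply: N_ind; first by dfn.
    by rewrite psum0 rn0 mul0r.
  move=> n IH; rewrite rnS psumS mulrDl mul1r => h; apply: lerD; first by apply: IH; lra.
  rewrite sqdE -(real_normK (num_real (coord x n - coord y n))).
  by rewrite ler_pXn2r ?nnegrE // H //; lra.
have d0 := rn_ge0 d.
rewrite -(@ler_pXn2r _ 2) // ?nnegrE ?mulr_ge0 // E exprMn.
apply: le_trans (B _ (lexx _)) _; apply: ler_wpM2r; first exact: sqr_ge0.
case: (zero_or_suc d) => [->|[j ->]]; first by rewrite rn0 expr0n.
by rewrite rnS expr2; have := rn_ge0 j => j0; have := mulr_ge0 j0 j0; lra.
Qed.

Lemma dist0 x : euc d x -> is_dist (enc d) x x (0 : R).
Proof.
move=> ex; apply/is_distE => //; split=> //; rewrite expr0n /=.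
have : forall n, psum (sqd x x) n = 0.
  apply: N_ind; first by dfn.
    by rewrite psum0.
  by move=> n IH; rewrite psumS IH sqdE subrr expr0n addr0.
by move->.
Qed.

Lemma DP3_sum : DP3 (fun (n u : V) (t : R) => is_sum n u t).
Proof. by rewrite /is_sum /is_fun /is_succ /is_empty /is_opair /is_upair /unique; dfn. Qed.
Lemma DP3_dist : DP3 (fun (x y : V) (t : R) => is_dist (enc d) x y t).
Proof.
have ? := DP3_sum.
rewrite /is_dist /is_fun /is_succ /is_empty /is_opair /is_upair /unique; dfn.
Qed.
Lemma DP2_diam : DP2 (fun (x : V) (t : R) => is_diam (enc d) x t).
Proof. by have ? := DP3_dist; rewrite /is_diam /diam_le; dfn. Qed.
Lemma DP3_rpow : DP3 (fun r s v : R => is_rpow r s v).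
Proof. by rewrite /is_rpow /is_fun /is_opair /is_upair /unique; dfn. Qed.

(** The exponential function of base r is the only monotone homomorphism taking 1 to r, because
    its composition with the logarithm is additive and monotone. *)
Lemma rpowE r s v : 0 < r -> 0 <= s -> is_rpow r s v <-> v = E (s * lg r).
Proof.
move=> r0 s0; split; last first.
  move=> ->; left; split=> //.
  have [||g [Fg Ig]] := @graph_fun _ R _ (line wK) (fun a : R => enc (E (a * lg r))) (fun a => a ∈ line wK).
  - by dfn.
  - move=> x /lineP [a ->]; exists a; split=> //; apply/lineP; by exists (E (a * lg r)).
  have I (a b : R) : inrel g (code a) (code b) <-> b = E (a * lg r).
    rewrite (Ig a (code b)); split=> [[_ /(@code_inj _ wK) //]|->]; split=> //.
    by apply/lineP; exists a.
  exists g; split=> //; split.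
    by move=> a b x y /I -> /I ->; apply/I; rewrite mulrDl ED.
  split.
    case: (leP 0 (lg r)) => h; [left|right] => a b x y /I -> /I -> ab; apply: E_le.
      exact: ler_wpM2r.
    by apply: ler_wnM2r => //; apply: ltW.
  by split; apply/I => //; rewrite mul1r Elg.
case=> [[_ [g [[F1 Fg] [gM [gm [g1 gs]]]]]]|[e _]]; last by move: r0; rewrite e ltxx.
pose ga (a : R) : R := eps 0 (fun b : R => inrel g (code a) (code b)).
have gaP (a b : R) : inrel g (code a) (code b) <-> b = ga a.
  have [|y [Hy U]] := Fg (code a); first by apply/lineP; exists a.
  have [c Ec] : exists c : R, y = code c.
    move: Hy => [p [Hp pg]]; have [x' [y' [_ [/lineP [c Ec] Hp']]]] := F1 _ pg.
    by exists c; move: Hp Hp'; rewrite !is_opairE => -> /opair_inj [_ ->].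
  subst y; have -> : ga a = c.
    by apply: epsU => // b' Hb; apply: (@code_inj _ wK); rewrite (U _ Hb).
  by split=> [/U /(@code_inj _ wK)|->].
have gaD (a b : R) : ga (a + b) = ga a * ga b.
  by symmetry; apply/gaP; apply: gM; apply/gaP.
have ga1 : ga 1 = r by symmetry; apply/gaP.
have ga0 : ga 0 = 1.
  by have := gaD 1 0; rewrite addr0 ga1 -{1}[r]mulr1 => /(mulfI (negbT (gt_eqF r0))) <-.
have gan (a : R) : ga a != 0.
  apply/eqP => e; have := gaD a (- a); rewrite subrr ga0 e mul0r => /eqP.
  by rewrite oner_eq0.
have gap (a : R) : 0 < ga a.
  have -> : a = a / 2 + a / 2 by field.
  by rewrite gaD lt_def mulf_neq0 // -expr2 sqr_ge0.
pose h (a : R) := lg (ga a).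
have hD (a b : R) : h (a + b) = h a + h b by rewrite /h gaD lgM.
have hn (a : R) n : h (rn n * a) = rn n * h a.
  suff H : forall n (b : R), inrel g (code (rn n * a)) (code b) -> lg b = rn n * h a.
    by rewrite /h (H n (ga (rn n * a))) //; apply/gaP.
  apply: N_ind; first by dfn.
    by move=> b; rewrite !rn0 !mul0r => /gaP ->; rewrite ga0 lg_1.
  move=> m IH b /gaP ->; rewrite !rnS !mulrDl !mul1r gaD lgM //.
  by rewrite (IH (ga (rn m * a))) //; apply/gaP.
have {gs} -> : v = ga s by apply/gaP.
suff <- : h s = s * lg r by rewrite Elg.
rewrite -ga1 -/(h 1).
case: gm => gm.
  by apply: (@monotone_additive _ h) => // a b ab; apply: lg_le => //; apply: gm ab; apply/gaP.
have L : - h s = s * (- h 1).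
  apply: (@monotone_additive _ (fun a => - h a)) => //.
  - by move=> a n; rewrite hn mulrN.
  - by move=> a b; rewrite hD opprD.
  by move=> a b ab; rewrite lerN2; apply: lg_le => //; apply: gm ab; apply/gaP.
by rewrite -[LHS]opprK L mulrN opprK.
Qed.

Lemma rpow0E s v : 0 < s -> is_rpow (0 : R) s v <-> v = 0.
Proof.
move=> s0; split=> [[[]|[_ [[e _]|[_ ->]]]]|->] //; first by rewrite ltxx.
  by move: s0; rewrite e ltxx.
by right; split=> //; right.
Qed.

Lemma diam_uniq (U : V) r r' : is_diam (enc d) U r -> is_diam (enc d) U r' -> r = r'.
Proof. by move=> [h1 h2] [h3 h4]; apply/eqP; rewrite eq_le h2 ?h4. Qed.

Lemma diam_ex (U : V) (b : R) : (forall x, x ∈ U -> euc d x) -> (exists x, x ∈ U) ->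
  diam_le (enc d) U b -> exists r, is_diam (enc d) U r /\ 0 <= r.
Proof.
move=> HU [x0 xU] Hb; have ? := DP3_dist.
have [|||r [r1 r2]] := @sup_ex _ (fun t => exists x y, x ∈ U /\ y ∈ U /\ is_dist (enc d) x y t).
- by dfn.
- by exists 0, x0, x0; split=> //; split=> //; apply: dist0; apply: HU.
- by exists b => t [x [y [xu [yu /Hb]]]]; apply.
exists r; split; last by apply: r1; exists x0, x0; split=> //; split=> //; apply: dist0; apply: HU.
split=> [x y t xu yu h|r' h]; first by apply: r1; exists x, y.
by apply: r2 => t [x [y [xu [yu /h]]]]; apply.
Qed.

(** A sequence of sets with explicit bounds B on their diameters yields a cover in the sense of
    the definition of Hausdorff measure: the gauges are the powers of the actual diameters. *)
Lemma cover_intro (A : V) (U : N -> V) (h : fn R) s (eps0 eta : R) : DF1 U -> 0 < s ->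
  (forall n x, x ∈ U n -> euc d x) -> (forall x, x ∈ A -> exists n, x ∈ U n) ->
  0 < eps0 -> (forall n, 0 <= h n) ->
  (forall n, (exists x, x ∈ U n) -> exists B : R, 0 < B /\ B <= eps0 /\ E (s * lg B) <= h n /\
     diam_le (enc d) (U n) B) ->
  (forall n, psum h n <= eta) -> has_cover wo (enc d) A s eps0 eta.
Proof.
move=> HU s0 Ue Uc e0 h0 HB Hs; have ? := DP2_diam.
pose (gv := fun (n : N) (v : R) => (is_empty (U n) /\ v = 0) \/ ((exists x, x ∈ U n) /\
  exists r, is_diam (enc d) (U n) r /\ ((0 < r /\ v = E (s * lg r)) \/ (r = 0 /\ v = 0)))).
have gvU n v v' : gv n v -> gv n v' -> v = v'.
  move=> [[e ->]|[[x xu] [r [hr hv]]]] [[e' ->]|[[x' xu'] [r' [hr' hv']]]] //.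
  - by case: (e x').
  - by case: (e' x).
  have E' := diam_uniq hr hr'; subst r'.
  case: hv hv' => -[r0 ->] [] [r1 ->] //.
    by move: r0; rewrite r1 ltxx.
  by move: r1; rewrite r0 ltxx.
have gvE n : exists v, gv n v /\ 0 <= v /\ v <= h n.
  case: (classic (exists x, x ∈ U n)) => [ne|em]; last first.
    by exists 0; split; [left; split=> // z hz; apply: em; exists z | split].
  have [B [B0 [Be [Bh Bd]]]] := HB n ne.
  have [r [hr r0]] := diam_ex (Ue n) ne Bd.
  have rB : r <= B by case: hr => _; apply.
  move: r0; rewrite le_eqVlt => /orP [/eqP r0|r0].
    exists 0; split=> //; right; split=> //; exists r; split=> //; by right.
  exists (E (s * lg r)); split; last split; first by right; split=> //; exists r; split=> //; left.
    exact/ltW/E_gt0.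
  apply: le_trans Bh; apply: E_le; apply: ler_wpM2l; first exact: ltW.
  exact: lg_le.
pose (gf := fun n : N => eps (0 : R) (gv n)).
have gfP n : gv n (gf n) by apply: epsP; have [v [hv _]] := gvE n; exists v.
have gfB n : 0 <= gf n <= h n.
  have [v [hv [v0 v1]]] := gvE n; have -> : gf n = v by apply: gvU hv; apply: gfP.
  by rewrite v0.
have Dgf : DF1 gf.
  rewrite /DF1 /gf; by_eps; first by move=> g; apply: gvU.
  by rewrite /gv /is_empty; dfn.
have [Uf HUf] := mkfn HU.
have [u Hu] := mkfn Dgf.
have fU (f : fn V) (Q : V -> Prop) : (forall n, Q (f n)) -> is_fun (enc f) wo Q.
  move=> HQ; split.
    move=> p /graphP [n ->]; exists (enc n), (enc (f n)); rewrite is_opairE.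
    by split; [exact: encN | split=> //; apply: HQ].
  move=> x xw; exists (f (natv xw)); split.
    by apply/inrelE; apply/(graph_app f (natv xw) (f (natv xw))).
  by move=> y /inrelE /(graph_app f (natv xw) y) ->.
have fR (f : fn R) : is_fun (enc f) wo (fun a => a ∈ line wK).
  split.
    move=> p /graphP [n ->]; exists (enc n), (enc (f n)); rewrite is_opairE.
    by split; [exact: encN | split=> //; apply/lineP; exists (f n)].
  move=> x xw; exists (code (f (natv xw))); split.
    by apply/inrelE; apply/(graph_app f (natv xw) (f (natv xw))).
  move=> y /inrelE /graphP [n /opair_inj [E1 ->]].
  by have -> : natv xw = n by apply: N_inj.
have inU x V0 : inrel (enc Uf) x V0 -> exists n, x = enc n /\ V0 = U n.
  by move=> /inrelE /graphP [n /opair_inj [-> ->]]; exists n; rewrite HUf.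
exists (enc Uf), (enc u); split; first by apply: fU => n x; rewrite HUf; apply: Ue.
split; first exact: fR.
split.
  move=> x /Uc [n xu]; exists (enc n), (U n); split=> //.
  by apply/inrelE; apply/(graph_app Uf n (U n)).
split.
  move=> x V0 /inU [n [_ ->]] y z t yu zu.
  have [|B [B0 [Be [Bh Bd]]]] := HB n; first by exists y.
  by move=> h'; apply: le_trans Be; apply: Bd h'.
split.
  move=> x V0 v /inU [n [-> ->]] /inrelE /(graph_app u n v) ->; rewrite Hu.
  case: (gfP n) => [[e ->]|[ne [r [hr hv]]]]; [left|right] => //; split=> //.
  exists r; split=> //; case: hv => [[r0 ->]|[-> ->]]; last exact/rpow0E.
  by apply/rpowE => //; apply: ltW.
move=> x t xw.
have H i (b : R) : rn i < rn (natv xw) -> inrel (enc u) (enc i) (code b) <-> b = u i.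
  by move=> _; rewrite inrelE; apply: (graph_app u i b).
case: (is_sumE t H) => h1 _ h2; rewrite (h1 h2).
apply: le_trans (Hs (natv xw)); apply: psum_le => i _; rewrite Hu.
by case/andP: (gfB i).
Qed.

(** All the ingredients of a cover are sets of the model, hence functions fn.  The proviso 0 < r is
    there because for s = 0 a set of diameter 0 has gauge 1. *)
Lemma cover_elim (A : V) s (eps0 eta : R) : 0 <= s -> has_cover wo (enc d) A s eps0 eta ->
  exists (U : fn V) (v : fn R), (forall n x, x ∈ U n -> euc d x) /\
    (forall x, x ∈ A -> exists n, x ∈ U n) /\
    (forall n, is_empty (U n) \/ exists r, is_diam (enc d) (U n) r /\ r <= eps0 /\
       (0 < r -> v n = E (s * lg r))) /\
    (forall n, 0 <= v n) /\ (forall n, psum v n <= eta).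
Proof.
move=> s0 [Ug [ug [FU [Fu [Uc [Ud [Hg Hs]]]]]]].
have [|U EU] := (@graph_likeP _ V _ Ug).1.
  case: FU => F1 F2; split.
    move=> p /F1 [x [y [xw [_ /is_opairE ->]]]]; by exists (natv xw), y.
  move=> n; have [y [Hy U]] := F2 _ (encN n).
  by exists y; split; [apply/inrelE | move=> y' /inrelE /U ->].
have [|u Eu] := (@graph_likeP _ R _ ug).1.
  case: Fu => F1 F2; split.
    move=> p /F1 [x [y [xw [/lineP [a ->] /is_opairE ->]]]]; by exists (natv xw), a.
  move=> n; have [y [Hy U0]] := F2 _ (encN n).
  have /inrelE /F1 [x [y' [_ [/lineP [a ->] /is_opairE /opair_inj [_ Ey]]]]] := Hy.
  subst y; exists a; split; first exact/inrelE.
  by move=> b /inrelE /U0 /(@code_inj _ wK) ->.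
have IU n V0 : inrel Ug (enc n) V0 <-> V0 = U n.
  by rewrite inrelE EU; apply: (graph_app U n V0).
have Iu n (b : R) : inrel ug (enc n) (code b) <-> b = u n.
  by rewrite inrelE Eu; apply: (graph_app u n b).
have Ue n x : x ∈ U n -> euc d x.
  have : inrel Ug (enc n) (U n) by apply/IU.
  move/inrelE; case: FU => F1 _ /F1 [x' [y [_ [Q /is_opairE /opair_inj [_ ->]]]]].
  exact: Q.
have G n : is_gauge (enc d) (U n) s (u n).
  by apply: (Hg (enc n)); [apply/IU | apply/Iu].
exists U, u; split=> //; split.
  move=> x /Uc [n [V0 [h xV]]].
  have := h; move/inrelE; case: FU => F1 _ /F1 [x' [y [xw [_ /is_opairE /opair_inj [E1 _]]]]].
  by subst x'; exists (natv xw); move: (h) => /(IU (natv xw)) <-.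
split; last split.
- move=> n; case: (G n) => [[e _]|[[x xu] [r [hr hp]]]]; [by left|right].
  exists r; split=> //; split.
    by case: hr => _; apply; apply: (Ud (enc n)); apply/IU.
  by move=> r0; apply/(rpowE _ r0 s0).
- move=> n; case: (G n) => [[_ ->] //|[[x xu] [r [hr hp]]]].
  have r0 : 0 <= r.
    case: hr => hr _; apply: (hr x x 0) => //; apply: dist0; exact: Ue xu.
  move: r0; rewrite le_eqVlt => /orP [/eqP r0|r0].
    move: hp; rewrite -r0 => -[[]|[_ [[_ ->]|[_ ->]]]] //; by rewrite ltxx.
  by move: hp => /(rpowE _ r0 s0) ->; apply/ltW/E_gt0.
move=> n; apply: (Hs (enc n)); first exact: encN.
by apply/(@is_sumE _ u) => // i b _; apply: Iu.
Qed.

Lemma DP1_null (A : V) : DP1 (fun s : R => hausdorff_null wo (enc d) A s).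
Proof.
have ? := DP3_rpow; have ? := DP2_diam; have ? := DP3_dist; have ? := DP3_sum.
by rewrite /hausdorff_null /has_cover /is_gauge /is_fun /diam_le /is_empty
  /euclidean /is_fun /is_opair /is_upair /unique; dfn.
Qed.

(** The infimum that is the dimension of B exists because some exponent is null for A: otherwise
    no real could be the greatest lower bound of the null exponents of A. *)
Lemma HD_subset (A B : V) (a b : R) : incl B A -> HD_ge wo (enc d) A a ->
  (forall s, 0 <= s -> hausdorff_null wo (enc d) B s -> b <= s) -> HD_ge wo (enc d) B b.
Proof.
move=> BA [h [[h1 h2] _]] HB.
have [s [s0 sA]] : exists s, 0 <= s /\ hausdorff_null wo (enc d) A s.
  apply: NNPP => H; have := h2 (h + 1); have : h < h + 1 by lra.
  rewrite ltNge => /negP X Y; apply: X; apply: Y => s s0 sA; case: H; by exists s.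
have sB : hausdorff_null wo (enc d) B s.
  move=> e t e0 t0; have [U [u [F1 [F2 [F3 F4]]]]] := sA e t e0 t0.
  by exists U, u; do 2!split=> //; split=> // x /BA; apply: F3.
have ? := DP1_null B.
have [|||g [g1 g2]] := @sup_ex _ (fun c => forall s, 0 <= s -> hausdorff_null wo (enc d) B s -> c <= s).
- by dfn.
- by exists b.
- by exists s => c; apply.
exists g; split; last exact: g1.
split=> [s' s'0 nB|c Hc]; last exact: g1.
by apply: g2 => c; apply.
Qed.

End Distance.

(** * Determined games *)

Section Games.
Context {W : world}.
Implicit Types (m n i k : N).

Definition dbl m : N := flr (2 * rn m).
Lemma rn_dbl m : rn (dbl m) = 2 * rn m.
Proof.
apply: isn_flr; have -> : 2 * rn m = rn m + rn m by lra.
by apply: isnD; apply: isn_rn.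
Qed.
Definition halve n : N := flr (rn n / 2).
Lemma halve_dbl m : halve (dbl m) = m.
Proof. by apply: flr_uniq; rewrite rn_dbl; apply/andP; split; lra. Qed.
Lemma halve_dbl1 m : halve (suc (dbl m)) = m.
Proof. by apply: flr_uniq; rewrite rnS rn_dbl; apply/andP; split; lra. Qed.
Lemma dbl_zero : dbl zero = zero.
Proof. by apply: rn_inj; rewrite rn_dbl rn0 mulr0. Qed.
Lemma dbl_suc m : dbl (suc m) = suc (suc (dbl m)).
Proof. by apply: rn_inj; rewrite rn_dbl !rnS rn_dbl; lra. Qed.
Lemma dbl_cases n : (exists m, n = dbl m) \/ exists m, n = suc (dbl m).
Proof.
move: n; apply: N_ind; first by rewrite /dbl; dfn.
  by left; exists zero; rewrite dbl_zero.
move=> n [[m ->]|[m ->]]; first by right; exists m.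
by left; exists (suc m); rewrite dbl_suc.
Qed.
Lemma dbl_odd m i : dbl m <> suc (dbl i).
Proof.
move/(congr1 rn); rewrite rnS !rn_dbl => h.
by case: (ltgtP (rn m) (rn i)) => [/rn_discrete|/rn_discrete|]; lra.
Qed.
Definition even_turn n := exists m, n = dbl m.
Lemma DP1_even : DP1 even_turn. Proof. by rewrite /even_turn /dbl; dfn. Qed.

Section Run.
Context (mv : fn N -> N -> N) (Dmv : DF2 mv).
Context (mv_na : forall (x x' : fn N) n, (forall i, nlt i n -> x i = x' i) -> mv x n = mv x' n).
Context (turn : N -> Prop) (Dturn : DP1 turn).

Definition follow (z r : fn N) : Prop := forall n, r n = ite (turn n) (mv r n) (z n).

Lemma follow_ex z : exists r, follow z r.
Proof.
apply: (@fix_ex _ _ _ zero (fun r n => ite (turn n) (mv r n) (z n))); first by dfn.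
move=> x x' n H; case: (classic (turn n)) => t; last by rewrite !iteF.
by rewrite !iteT //; apply: mv_na.
Qed.

Lemma follow_agree (z z' r r' : fn N) n : follow z r -> follow z' r' ->
  (forall i, rn i < rn n -> ~ turn i -> z i = z' i) ->
  forall i, rn i < rn n -> r i = r' i.
Proof.
move=> h h' E; apply: N_sind; first by dfn.
move=> i IH hi; rewrite h h'.
case: (classic (turn i)) => t; last by rewrite !iteF // E.
rewrite !iteT //; apply: mv_na => j /nltP ji; apply: IH => //; exact: lt_trans ji hi.
Qed.

Lemma follow_uniq z r r' : follow z r -> follow z r' -> r = r'.
Proof.
move=> h h'; apply: fn_ext => n; apply: (@follow_agree z z r r' (suc n)) => //.
by rewrite rnS; lra.
Qed.

Definition run z : fn N := eps (cfn zero) (follow z).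
Lemma runP z : follow z (run z).
Proof. by apply: epsP; apply: follow_ex. Qed.
Lemma DF1_run : DF1 run.
Proof.
rewrite /DF1 /run; by_eps; last by rewrite /follow; dfn.
by move=> g y y'; apply: follow_uniq.
Qed.
End Run.

(** The value of a strategy, as a function of a whole run of which it only sees an initial part. *)
Lemma strategy_mv (sigma : V) : is_strategy wo sigma ->
  exists mv : fn N -> N -> N, DF2 mv /\
    (forall (x x' : fn N) n, (forall i, nlt i n -> x i = x' i) -> mv x n = mv x' n) /\
    forall (x : fn N) n p k, is_restr (enc x) (enc n) p ->
      (inrel sigma p (enc k) <-> k = mv x n).
Proof.
move=> [S [HS [F1 F2]]].
pose (Q := fun (x : fn N) n k => exists p, is_restr (enc x) (enc n) p /\ inrel sigma p (enc k)).
have rU (x : fn N) n p p' : is_restr (enc x) (enc n) p -> is_restr (enc x) (enc n) p' -> p = p'.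
  by move=> h h'; apply: ext => z; rewrite h h'.
have rS (x : fn N) n p : is_restr (enc x) (enc n) p -> p ∈ S.
  move=> hp; apply/HS; exists (enc n); split; first exact: encN.
  split.
    move=> z /hp [/graphP [m ->]] [a [b [an /is_opairE /opair_inj [Ea Eb]]]].
    exists (enc m), (enc (x m)); rewrite is_opairE; split; first by rewrite Ea.
    by split=> //; exact: encN.
  move=> i hi; have iw := in_omega_nat hi; exists (enc (x (natv iw))); split.
    apply/inrelE/hp; split; first exact/(graph_app x (natv iw)).
    by exists i, (enc (x (natv iw))); rewrite is_opairE.
  move=> y /inrelE /hp [/graphP [m /opair_inj [Em ->]] _].
  by have -> : natv iw = m by apply: N_inj.
have rE (x : fn N) n : exists p, is_restr (enc x) (enc n) p.
  apply: (@separation _ (enc x) (fun p => exists a b : V, a ∈ enc n /\ is_opair a b p)).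
  by rewrite /is_opair /is_upair; dfn.
have QU (x : fn N) n k k' : Q x n k -> Q x n k' -> k = k'.
  move=> [p [hp hk]] [p' [hp' hk']]; have e := rU _ _ _ _ hp hp'; subst p'.
  have [y [_ U]] := F2 _ (rS _ _ _ hp).
  by apply: encNI; rewrite -(U _ hk) -(U _ hk').
have QE (x : fn N) n : exists k, Q x n k.
  have [p hp] := rE x n; have [y [hy _]] := F2 _ (rS _ _ _ hp).
  have := hy; move/inrelE/F1 => [a [b [_ [bw /is_opairE /opair_inj [_ eb]]]]].
  by subst y; exists (natv bw), p.
pose (mv := fun (x : fn N) n => eps zero (Q x n)).
have mvP (x : fn N) n k : Q x n k <-> k = mv x n.
  have h : Q x n (mv x n) by apply: epsP; apply: QE.
  by split=> [hk|-> //]; apply: QU hk h.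
exists mv; split; last split.
- rewrite /DF2 /mv; by_eps; first by move=> g y y'; apply: QU.
  by rewrite /Q /is_restr /is_opair /is_upair; dfn.
- move=> x x' n H; apply/mvP; have [p [hp hk]] : Q x n (mv x n) by apply/mvP.
  exists p; split=> // z; rewrite hp.
  have aux (u v : fn N) : (forall i, nlt i n -> u i = v i) -> forall z,
     z ∈ enc u /\ (exists a b, a ∈ enc n /\ is_opair a b z) -> z ∈ enc v.
    move=> huv {}z [/graphP [m ->]] [a [b [an /is_opairE /opair_inj [Ea _]]]].
    by rewrite huv; [apply/graph_app | rewrite /nlt Ea].
  split=> -[h1 h2]; split=> //; first by apply: (aux x x').
  by apply: (aux x' x) => // i hi; rewrite H.
move=> x n p k hp; rewrite -mvP; split=> [h|[p' [hp' h]]]; first by exists p.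
by rewrite (rU _ _ _ _ hp hp').
Qed.

Lemma baireE x : baire wo x <-> exists f : fn N, x = enc f.
Proof.
rewrite -[X in _ <-> X](@graph_likeP _ N _ x); split=> -[F1 F2]; split.
- by move=> p /F1 [a [b [aw [bw /is_opairE ->]]]]; exists (natv aw), (natv bw).
- move=> n; have [y [Hy U]] := F2 _ (encN n).
  have := Hy; move/inrelE/F1 => [a [b [_ [bw /is_opairE /opair_inj [_ e]]]]].
  subst y; exists (natv bw); split; first exact/inrelE.
  by move=> k /inrelE /U h; apply: encNI; rewrite -h.
- move=> p /F1 [n [k ->]]; exists (enc n), (enc k); rewrite is_opairE.
  by split; [apply: encN | split=> //; apply: encN].
move=> n nw; have [k [Hk U]] := F2 (natv nw); exists (enc k); split; first exact/inrelE.
move=> y /inrelE hy; have := hy; move/F1 => [m [l /opair_inj [Em ey]]].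
by rewrite ey; rewrite (U l) // -ey.
Qed.

(** Pairs of naturals are in the second power set of omega, sequences in the third. *)
Lemma baire_set (P : fn N -> Prop) : DP1 P ->
  exists A : V, forall x, x ∈ A <-> exists f : fn N, x = enc f /\ P f.
Proof.
move=> HP.
have [p1 h1] := zf_powerset wZF wo; have [p2 h2] := zf_powerset wZF p1.
have [p3 h3] := zf_powerset wZF p2.
have [|A HA] := @separation _ p3 (fun x => exists f : fn N, x = enc f /\ P f); first by dfn.
exists A => x; rewrite HA; split=> [[]|[f [-> Pf]]] //; split; last by exists f.
apply/h3 => p /graphP [n ->]; apply/h2 => z /upairP hz; apply/h1 => u hu.
by case: hz hu => -> /upairP [] ->; apply: encN.
Qed.

Definition b2n (b : bool) : N := ite (b = true) (suc zero) zero.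
Definition n2b (n : N) : bool := ite (n = zero) false true.
Lemma b2nK b : n2b (b2n b) = b.
Proof.
rewrite /b2n /n2b; case: b; first by rewrite (iteT _ _ (erefl true)) iteF //; apply: suc_neq0.
by rewrite (@iteF _ (false = true)) // iteT.
Qed.

Definition movesI (r : fn N) : fn N := lam zero (fun m => r (dbl m)).
Definition movesII (r : fn N) : fn bool := lam false (fun m => n2b (r (suc (dbl m)))).
Lemma movesIE r m : movesI r m = r (dbl m).
Proof. by rewrite lamE //; rewrite /dbl; dfn. Qed.
Lemma movesIIE r m : movesII r m = n2b (r (suc (dbl m))).
Proof. by rewrite lamE //; rewrite /dbl /n2b; dfn. Qed.

(** Determinacy, with moves of I in the naturals and moves of II in bool, in terms of strategies
    as causal operators from the moves of the opponent to one's own. *)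
Theorem determinacy (P : fn N -> fn bool -> Prop) : AD wM -> DP2 P ->
  (exists S : fn bool -> N -> N, DF2 S /\
     (forall (q q' : fn bool) m, (forall i, rn i < rn m -> q i = q' i) -> S q m = S q' m) /\
     forall (p : fn N) (q : fn bool), (forall m, p m = S q m) -> P p q) \/
  (exists T : fn N -> N -> bool, DF2 T /\
     (forall (p p' : fn N) m, (forall i, rn i <= rn m -> p i = p' i) -> T p m = T p' m) /\
     forall (p : fn N) (q : fn bool), (forall m, q m = T p m) -> ~ P p q).
Proof.
move=> ad HP.
have [|A HA] := @baire_set (fun r => P (movesI r) (movesII r)).
  by rewrite /movesI /movesII /n2b /dbl; dfn.
have [|sigma [Hs Hwin]] := ad wo A wo_omega.
  by move=> x /HA [f [-> _]]; apply/baireE; exists f.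
have [mv [Dmv [na mvP]]] := strategy_mv Hs.
have evE (e : V) : is_evens wo e -> forall m, enc (dbl m) ∈ e /\ ~ enc (suc (dbl m)) ∈ e.
  move=> [_ [e0 eS]].
  have st n : enc (suc n) ∈ e <-> ~ enc n ∈ e by apply: eS; [apply: encN | exact: sucP].
  apply: N_ind; first by rewrite /dbl; dfn.
    rewrite dbl_zero; have h : enc zero ∈ e by apply: e0; exact: zeroP.
    by split=> //; rewrite st.
  move=> m [h1 h2]; rewrite dbl_suc; have h3 : enc (suc (suc (dbl m))) ∈ e by rewrite st.
  by split=> //; rewrite st.
have ru (r : fn N) n (x k : V) : x = enc n -> r n = mv r n -> forall p, is_restr (enc r) x p ->
    inrel (enc r) x k <-> inrel sigma p k.
  move=> -> hr p hp; split.
    by move/inrelE/graphP => [m /opair_inj [/encNI <- ->]]; apply/(mvP r n p (r n) hp).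
  move=> h; have [S [_ [F1 _]]] := Hs.
  have := h; move/inrelE/F1 => [a [b [_ [bw /is_opairE /opair_inj [_ e]]]]].
  subst k; have h' : inrel sigma p (enc (natv bw)) by [].
  by move: h' => /(mvP r n _ _ hp) h'; apply/inrelE; apply/(graph_app r n (natv bw)); rewrite h' hr.
case: Hwin => -[e [He wins]]; [left|right].
  pose (Z := fun q : fn bool => lam zero (fun n => b2n (q (halve n)))).
  have ZE q n : Z q n = b2n (q (halve n)) by rewrite /Z lamE // /halve /b2n; dfn.
  pose (S := fun (q : fn bool) (m : N) => run mv even_turn (Z q) (dbl m)).
  have Dr : DF1 (run mv even_turn) by apply: DF1_run => //; exact: DP1_even.
  have rP q := runP Dmv na DP1_even (Z q).
  exists S; split; first by rewrite /S /Z /dbl /halve /b2n; dfn.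
  split.
    move=> q q' m H; rewrite /S; apply: (follow_agree (n := suc (dbl m)) na (rP q) (rP q')).
      move=> i; rewrite rnS rn_dbl => hi.
      case: (dbl_cases i) => [ev|[j Ej]]; first by case.
      move=> _; rewrite !ZE Ej halve_dbl1 H //.
      by move: hi; rewrite Ej rnS rn_dbl; lra.
    by rewrite rnS; lra.
  move=> p q Hp; set r := run mv even_turn (Z q).
  have -> : p = movesI r by apply: fn_ext => m; rewrite movesIE Hp.
  have -> : q = movesII r.
    apply: fn_ext => m; rewrite movesIIE rP iteF; first by rewrite ZE halve_dbl1 b2nK.
    by move=> [j /esym]; apply: dbl_odd.
  have : enc r ∈ A; last by move=> /HA [f [Ef Pf]]; rewrite (encI Ef).
  apply: wins; first by apply/baireE; exists r.
  move=> n p' k ne; have nw : n ∈ wo by case: He => h _; apply: h.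
  apply: (@ru r (natv nw)) => //.
  case: (dbl_cases (natv nw)) => -[m Em]; first by rewrite {1}rP iteT //; exists m.
  by case: (evE e He m) => _ []; rewrite -Em.
pose (Z := fun p : fn N => lam zero (fun n => p (halve n))).
have ZE p n : Z p n = p (halve n) by rewrite /Z lamE // /halve; dfn.
pose (turn := fun n => ~ even_turn n).
have Dt : DP1 turn by rewrite /turn; have ? := DP1_even; dfn.
pose (T := fun (p : fn N) (m : N) => n2b (run mv turn (Z p) (suc (dbl m)))).
have Dr : DF1 (run mv turn) by apply: DF1_run.
have rP p := runP Dmv na Dt (Z p).
exists T; split; first by rewrite /T /Z /dbl /halve /n2b; dfn.
split.
  move=> p p' m H; rewrite /T; congr n2b.
  apply: (follow_agree (n := suc (suc (dbl m))) na (rP p) (rP p')).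
    move=> i; rewrite !rnS rn_dbl => hi.
    case: (dbl_cases i) => -[j Ej]; last by case=> -[l]; rewrite Ej => /esym; apply: dbl_odd.
    move=> _; rewrite !ZE Ej halve_dbl H //.
    move: hi; rewrite Ej rn_dbl leNgt => hi; apply/negP => /rn_discrete; lra.
  by rewrite !rnS; lra.
move=> p q Hq; set r := run mv turn (Z p).
have od m : turn (suc (dbl m)) by move=> [j /esym]; apply: dbl_odd.
have -> : q = movesII r by apply: fn_ext => m; rewrite movesIIE Hq.
have -> : p = movesI r.
  apply: fn_ext => m; rewrite movesIE rP iteF; first by rewrite ZE halve_dbl.
  by apply; exists m.
have h : ~ enc r ∈ A; last by move=> HP'; apply: h; apply/HA; exists r.
refine (wins (enc r) _ _); first by apply/baireE; exists r.
move=> n p' k [nw ne]; apply: (@ru r (natv nw)) => //.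
case: (dbl_cases (natv nw)) => -[m Em]; last by rewrite {1}rP iteT // Em; apply: od.
by case: (evE e He m) => h _; case: ne; move: h; rewrite -Em.
Qed.

End Games.

(** * Coding points and witnesses by bit sequences *)

Section Coding.
Context {W : world} (d L : N).
Context (L0 : 0 < rn L).
Implicit Types (m n i j k l : N) (e : fn bool) (y : fn N).

Definition Q : R := 1 + rn d * rn L.
Definition xi (n0 : N) (x : V) i : R := coord x i * E (- rn n0) + 1 / 2.
Definition oddn n := exists m, rn n = 2 * rn m + 1.
Definition pcode (a b : R) : R := (a + b) ^+ 2 + a.

(** A bit sequence e codes a vector x, a sequence y and an n0 with |x_i| <= 2 ^ (n0 - 1).  It consists
    of blocks of Q bits.  The first bits of the blocks form the characteristic function of the graph
    of n0, y 0, y 1, ... under the pairing pcode; thus y can be read off without recursion.  The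
    other bits of block k are the binary digits k L + 1, ..., (k + 1) L of each coordinate of x,
    scaled to the unit interval, with the lowest digits (l = 0) first. *)
Definition codes e x y n0 : Prop :=
  (forall j m, rn m = rn j * Q ->
     (e m = true <-> rn j = pcode 0 (rn n0) \/ exists n, rn j = pcode (rn n + 1) (rn (y n)))) /\
  (forall i, rn i < rn d -> 0 <= xi n0 x i < 1) /\
  (forall k l i m, rn l < rn L -> rn i < rn d -> rn m = rn k * Q + 1 + rn l * rn d + rn i ->
     (e m = true <-> oddn (flr (E ((rn k + 1) * rn L - rn l) * xi n0 x i)))).

Lemma isn_Q : isn Q.
Proof. by apply: isnD; [apply: isn1 | apply: isnM; apply: isn_rn]. Qed.
Lemma Q_gt0 : 0 < Q.
Proof.
have : 0 <= rn d * rn L by rewrite mulr_ge0 ?rn_ge0.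
by rewrite /Q; lra.
Qed.

Lemma euclid_uniq (q : R) k k' (a a' : R) : 0 <= a < q -> 0 <= a' < q ->
  rn k * q + a = rn k' * q + a' -> k = k' /\ a = a'.
Proof.
move=> /andP [a0 aq] /andP [a0' aq'] h.
have q0 : 0 < q by lra.
have K : k = k'.
  apply: rn_inj; case: (ltgtP (rn k) (rn k')) => // /rn_discrete hk.
    have : (rn k + 1) * q <= rn k' * q by apply: ler_wpM2r => //; lra.
    by lra.
  have : (rn k' + 1) * q <= rn k * q by apply: ler_wpM2r => //; lra.
  by lra.
by subst k'; split=> //; lra.
Qed.

(** The integer part of the square root of pcode a b is a + b. *)
Lemma pcode_inj (a b a' b' : R) : isn a -> isn b -> isn a' -> isn b' -> pcode a b = pcode a' b' ->
  a = a' /\ b = b'.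
Proof.
move=> na nb na' nb' h.
have g0 x : isn x -> 0 <= x by move=> [n ->]; apply: rn_ge0.
have lt (x y x' y' : R) : isn x -> isn y -> isn x' -> isn y' -> x + y < x' + y' -> pcode x y < pcode x' y'.
  move=> hx hy hx' hy' hs.
  have s1 : x + y + 1 <= x' + y' by apply: isn_discrete => //; apply: isnD.
  have := g0 _ hx; have := g0 _ hy; have := g0 _ hx' => h1 h2 h3.
  have : (x + y + 1) ^+ 2 <= (x' + y') ^+ 2 by rewrite ler_pXn2r // nnegrE; lra.
  rewrite /pcode !expr2; lra.
case: (ltgtP (a + b) (a' + b')) => hs.
- by have := lt _ _ _ _ na nb na' nb' hs; rewrite h ltxx.
- by have := lt _ _ _ _ na' nb' na nb hs; rewrite h ltxx.
by move: h; rewrite /pcode hs => h; split; lra.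
Qed.

Lemma pcode_isn (a b : R) : isn a -> isn b -> isn (pcode a b).
Proof. by move=> ha hb; apply: isnD => //; rewrite expr2; apply: isnM; apply: isnD. Qed.

Lemma round_bound l i : rn l < rn L -> rn i < rn d -> 0 <= 1 + rn l * rn d + rn i < Q /\ 0 < 1 + rn l * rn d + rn i.
Proof.
move=> /rn_discrete hl /rn_discrete hi.
have ? := rn_ge0 l; have ? := rn_ge0 i; have d0 := rn_ge0 d.
have h : 0 <= rn l * rn d by rewrite mulr_ge0.
have : (rn l + 1) * rn d <= rn L * rn d by apply: ler_wpM2r.
by rewrite /Q; split; [apply/andP; split|]; lra.
Qed.

Lemma codes_ex x y n0 : (forall i, rn i < rn d -> 0 <= xi n0 x i < 1) -> exists e, codes e x y n0.
Proof.
move=> hx.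
pose (A := fun m => exists j, rn m = rn j * Q /\
   (rn j = pcode 0 (rn n0) \/ exists n, rn j = pcode (rn n + 1) (rn (y n)))).
pose (B := fun m => exists k l i, rn l < rn L /\ rn i < rn d /\ rn m = rn k * Q + 1 + rn l * rn d + rn i /\
   oddn (flr (E ((rn k + 1) * rn L - rn l) * xi n0 x i))).
pose (e := lam false (fun m => ite (A m \/ B m) true false)).
have eE m : e m = true <-> A m \/ B m.
  rewrite /e lamE; last by rewrite /A /B /oddn /xi /pcode /Q; dfn.
  by case: (classic (A m \/ B m)) => h; [rewrite iteT | rewrite iteF].
exists e; split; last split=> //.
  move=> j m hm; rewrite eE; split=> [[[j' [hj h]]|[k [l [i [hl [hi [h _]]]]]]]|h].
  - have [|||E1 _] := @euclid_uniq Q j j' 0 0; rewrite ?lexx ?Q_gt0 //; first by lra.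
    by rewrite E1.
  - have [b1 b2] := round_bound hl hi.
    have [|||_ e0] := @euclid_uniq Q j k 0 (1 + rn l * rn d + rn i); rewrite ?lexx ?Q_gt0 //; lra.
  - by left; exists j.
move=> k l i m hl hi hm; have [b1 b2] := round_bound hl hi.
rewrite eE; split=> [[[j' [hj h]]|[k' [l' [i' [hl' [hi' [h o]]]]]]]|h].
- have [|||_ e0] := @euclid_uniq Q j' k 0 (1 + rn l * rn d + rn i); rewrite ?lexx ?Q_gt0 //; lra.
- have [b1' b2'] := round_bound hl' hi'.
  have [|||E1 E2] := @euclid_uniq Q k k' (1 + rn l * rn d + rn i) (1 + rn l' * rn d + rn i') => //; first by lra.
  have [|||E3 E4] := @euclid_uniq (rn d) l l' (rn i) (rn i'); rewrite ?rn_ge0 //; first by lra.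
  by move: o; rewrite -E1 -E3 -(rn_inj E4).
- by right; exists k, l, i.
Qed.

(** The digits of y and the bound n0 can be read off an initial segment of a code. *)
Lemma codes_agree e e' x x' y y' n0 n0' K : codes e x y n0 -> codes e' x' y' n0' ->
  (forall m, rn m < rn K * Q -> e m = e' m) ->
  (pcode 0 (rn n0) < rn K -> n0 = n0') /\
  (forall n, pcode (rn n + 1) (rn (y n)) < rn K -> y n = y' n).
Proof.
move=> [c1 _] [c1' _] H.
have step j : rn j < rn K -> (rn j = pcode 0 (rn n0) \/ exists n, rn j = pcode (rn n + 1) (rn (y n))) ->
    (rn j = pcode 0 (rn n0') \/ exists n, rn j = pcode (rn n + 1) (rn (y' n))).
  move=> hj h; have [m hm] : isn (rn j * Q) by apply: isnM; [apply: isn_rn | apply: isn_Q].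
  apply/(c1' j m) => //; rewrite -H; first exact/(c1 j m).
  by rewrite -hm ltr_pM2r // Q_gt0.
have nn n : isn (rn n + 1) by apply: isnD; [apply: isn_rn | apply: isn1].
split=> [h0|n hn].
  have [j hj] : isn (pcode 0 (rn n0)) by apply: pcode_isn; [apply: isn0 | apply: isn_rn].
  rewrite hj in h0; case: (step j h0 (or_introl (esym hj))) => [|[n]]; rewrite -hj.
    by case/pcode_inj; rewrite ?isn0 //; try apply: isn_rn; try apply: isn0; move=> _ /rn_inj.
  case/pcode_inj => //; try apply: isn_rn; try apply: isn0.
  by have := rn_ge0 n => ? ? _; exfalso; lra.
have [j hj] : isn (pcode (rn n + 1) (rn (y n))) by apply: pcode_isn => //; apply: isn_rn.
rewrite hj in hn; case: (step j hn) => [|h|[n' h]]; first by right; exists n.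
  move: h; rewrite -hj; case/pcode_inj => //; try apply: isn_rn; try apply: isn0.
  by have := rn_ge0 n => ? ? _; exfalso; lra.
move: h; rewrite -hj; case/pcode_inj => //; try apply: isn_rn.
by move=> h /rn_inj ->; have -> : n = n' by apply: rn_inj; lra.
Qed.

Lemma flr_halve z : 0 <= z -> flr z = halve (flr (2 * z)).
Proof.
move=> z0; have z2 : 0 <= 2 * z by lra.
have /andP [h1 h2] := flrP z2; move: h1 h2; set n := flr _ => h1 h2.
have n2 : 0 <= rn n / 2 by have := rn_ge0 n; lra.
have /andP [h3 h4] := flrP n2; apply: flr_uniq; rewrite -/(halve n) in h3 h4 *.
have : rn n + 1 <= rn (halve n) + rn (halve n) + 1 + 1.
  have [k Ek] : isn (rn (halve n) + rn (halve n) + 1 + 1) by do 3!(apply: isnD; try apply: isn1); apply: isn_rn.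
  by rewrite Ek; apply: rn_discrete; rewrite -Ek; lra.
by move=> h5; apply/andP; split; lra.
Qed.

Lemma flr_coarse (a z z' : R) j : 0 <= z -> 0 <= z' ->
  flr (E (a + rn j) * z) = flr (E (a + rn j) * z') -> flr (E a * z) = flr (E a * z').
Proof.
move=> z0 z0'; move: j; apply: N_ind; first by dfn.
  by rewrite rn0 addr0.
move=> j IH; rewrite rnS addrA ED E1 => h; apply: IH.
have p u : 0 <= u -> 0 <= E (a + rn j) * u by move=> u0; rewrite mulr_ge0 // ltW ?E_gt0.
rewrite (flr_halve (p _ z0)) (flr_halve (p _ z0')).
by rewrite !mulrA [2 * _]mulrC h.
Qed.

Lemma parity_split n : exists m, rn n = 2 * rn m \/ rn n = 2 * rn m + 1.
Proof.
by case: (dbl_cases n) => -[m ->]; exists m; rewrite ?rnS rn_dbl; [left|right].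
Qed.
Lemma halve_split n m : rn n = 2 * rn m \/ rn n = 2 * rn m + 1 -> halve n = m.
Proof. by move=> h; apply: flr_uniq; case: h => ->; apply/andP; split; lra. Qed.
Lemma odd_even n m : rn n = 2 * rn m -> ~ oddn n.
Proof.
move=> h [k h']; have : 2 * rn m = 2 * rn k + 1 by rewrite -h.
by case: (ltgtP (rn m) (rn k)) => [/rn_discrete|/rn_discrete|]; lra.
Qed.

(** Two points whose codes differ in a high bit of block k but share the low bits of this block
    are far apart: at scale (k + 1) L some coordinate has two different floors of equal parity. *)
Lemma codes_sep e e' x x' y y' n0 k l i m : codes e x y n0 -> codes e' x' y' n0 ->
  rn l < rn L -> rn i < rn d -> rn m = rn k * Q + 1 + rn l * rn d + rn i ->
  (forall m0, rn m0 = rn k * Q + 1 + rn i -> e m0 = e' m0) -> e m <> e' m ->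
  E (rn n0 - (rn k + 1) * rn L) < `|coord x i - coord x' i|.
Proof.
move=> [_ [hx c]] [_ [hx' c']] hl hi hm low dif.
have /andP [x0 x1] := hx i hi; have /andP [x0' x1'] := hx' i hi.
set X := xi n0 x i in x0 x1; set X' := xi n0 x' i in x0' x1'.
pose T := (rn k + 1) * rn L.
set A := flr (E T * X); set A' := flr (E T * X').
have neq : A <> A'.
  move=> eA; apply: dif.
  have [j Ej] : isn (rn l) by apply: isn_rn.
  have : flr (E (T - rn l) * X) = flr (E (T - rn l) * X').
    by apply: (@flr_coarse _ _ _ l) => //; rewrite subrK.
  have h1 := c k l i m hl hi hm; have h2 := c' k l i m hl hi hm.
  move=> eq; have : e m = true <-> e' m = true by rewrite h1 h2 -/X -/X' -/T eq.
  by case: (e m) (e' m) => [] [] // [u v]; [rewrite u | rewrite v].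
have par : oddn A <-> oddn A'.
  have [m0 Em0] : isn (rn k * Q + 1 + rn i).
    by apply: isnD; [apply: isnD; [apply: isnM; [apply: isn_rn|apply: isn_Q] | apply: isn1] | apply: isn_rn].
  have hm0 : rn m0 = rn k * Q + 1 + rn zero * rn d + rn i by rewrite rn0 mul0r addr0 Em0.
  have z0 : rn zero < rn L by rewrite rn0.
  have h1 := c k zero i m0 z0 hi hm0; have h2 := c' k zero i m0 z0 hi hm0.
  rewrite rn0 subr0 in h1 h2; rewrite -/T -/X -/X' -/A -/A' in h1 h2.
  by rewrite -h1 -h2 low.
have far (B B' : N) : (oddn B <-> oddn B') -> rn B < rn B' -> rn B + 2 <= rn B'.
  move=> pB lt; have [b [hb|hb]] := parity_split B; have [b' [hb'|hb']] := parity_split B'.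
  - have : rn b + 1 <= rn b' by apply: rn_discrete; lra.
    by lra.
  - by case: (odd_even hb); apply/pB; exists b'.
  - by case: (odd_even hb'); apply/pB; exists b.
  - have : rn b + 1 <= rn b' by apply: rn_discrete; lra.
    by lra.
have eT := E_gt0 T.
have /andP [f1 f2] : rn A <= E T * X < rn A + 1 by apply: flrP; rewrite mulr_ge0 // ltW.
have /andP [f1' f2'] : rn A' <= E T * X' < rn A' + 1 by apply: flrP; rewrite mulr_ge0 // ltW.
have D : 1 < `|E T * X - E T * X'|.
  case: (ltgtP (rn A) (rn A')) => hA; last by case: neq; apply: rn_inj.
    by have := far _ _ par hA => hf; rewrite ltr0_norm; lra.
  by have := far _ _ (iff_sym par) hA => hf; rewrite gtr0_norm; lra.
have eq : E T * X - E T * X' = (coord x i - coord x' i) * E (T - rn n0) by rewrite ED /X /X' /xi; ring.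
have -> : rn n0 - T = - (T - rn n0) by ring.
by rewrite EN -div1r ltr_pdivrMr ?E_gt0 // -[X in _ * X](gtr0_norm (E_gt0 _)) -normrM -eq.
Qed.

(** Equal digits give equal floors at all scales up to k L, by induction on the scale. *)
Lemma codes_close e e' x x' y y' n0 k i : codes e x y n0 -> codes e' x' y' n0 ->
  (forall m, rn m < rn k * Q -> e m = e' m) -> rn i < rn d ->
  `|coord x i - coord x' i| <= E (rn n0 - rn k * rn L).
Proof.
move=> [_ [hx c]] [_ [hx' c']] H hi.
have /andP [x0 x1] := hx i hi; have /andP [x0' x1'] := hx' i hi.
set X := xi n0 x i in x0 x1; set X' := xi n0 x' i in x0' x1'.
have F : forall j, rn j <= rn k * rn L -> flr (E (rn j) * X) = flr (E (rn j) * X').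
  apply: N_ind; first by dfn.
    by move=> _; rewrite rn0 E0 !mul1r; transitivity zero; [|symmetry];
      apply: flr_uniq; rewrite rn0; apply/andP; split; lra.
  move=> j IH; rewrite rnS => hj.
  have q0 : 0 <= rn j / rn L by rewrite divr_ge0 ?rn_ge0.
  have /andP [q1 q2] := flrP q0; move: q1 q2; set k' := flr _ => q1 q2.
  rewrite ler_pdivlMr // in q1; rewrite ltr_pdivrMr // in q2.
  have [j1 Ej1] : isn (rn j + 1) by exists (suc j); rewrite rnS.
  have [T1 ET] : isn ((rn k' + 1) * rn L).
    by apply: isnM; [apply: isnD; [apply: isn_rn|apply: isn1] | apply: isn_rn].
  have jT : rn j + 1 <= rn T1 by apply: rn_discrete; rewrite -ET.
  have [l El] : isn (rn T1 - (rn j + 1)).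
    by rewrite Ej1; apply: isnB; [apply: isn_rn|apply: isn_rn|rewrite -Ej1].
  have hl : rn l < rn L by rewrite -El -ET; lra.
  have kk : rn k' < rn k.
    rewrite ltNge; apply/negP => h; have : rn k * rn L <= rn k' * rn L by apply: ler_wpM2r => //; apply: ltW.
    by lra.
  have [m Em] : isn (rn k' * Q + 1 + rn l * rn d + rn i).
    apply: isnD; last exact: isn_rn; apply: isnD; last by apply: isnM; apply: isn_rn.
    by apply: isnD; [apply: isnM; [apply: isn_rn|apply: isn_Q]|apply: isn1].
  have [/andP [_ b1] _] := round_bound hl hi.
  have em : e m = e' m.
    apply: H; rewrite -Em.
    have : (rn k' + 1) * Q <= rn k * Q by apply: ler_wpM2r; [apply/ltW/Q_gt0 | apply: rn_discrete].
    by lra.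
  have := c k' l i m hl hi (esym Em); have := c' k' l i m hl hi (esym Em).
  have -> : (rn k' + 1) * rn L - rn l = rn j + 1 by rewrite -El ET; lra.
  rewrite em -/X -/X' => p1 p2.
  have par : oddn (flr (E (rn j + 1) * X)) <-> oddn (flr (E (rn j + 1) * X')) by rewrite -p1 -p2.
  have := IH; have jk : rn j <= rn k * rn L by lra.
  have p u : 0 <= u -> 0 <= E (rn j) * u by move=> u0; rewrite mulr_ge0 // ltW ?E_gt0.
  move/(_ jk); rewrite (flr_halve (p _ x0)) (flr_halve (p _ x0')).
  have two z : 2 * (E (rn j) * z) = E (rn j + 1) * z by rewrite ED E1; ring.
  rewrite !two; move: par; set a := flr _; set b := flr _ => par hab.
  have [u hu] := parity_split a; have [v hv] := parity_split b.
  rewrite (halve_split hu) (halve_split hv) in hab; subst v; apply: rn_inj.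
  case: hu hv => [hu|hu] [hv|hv]; try lra.
    by case: (odd_even hu); apply/par; exists u.
  by case: (odd_even hv); apply/par; exists u.
have [K EK] : isn (rn k * rn L) by apply: isnM; apply: isn_rn.
have := F K; rewrite EK => /(_ (lexx _)) hF.
have eK := E_gt0 (rn K).
have /andP [f1 f2] : rn (flr (E (rn K) * X)) <= E (rn K) * X < rn (flr (E (rn K) * X)) + 1.
  by apply: flrP; rewrite mulr_ge0 // ltW.
have /andP [f1' f2'] : rn (flr (E (rn K) * X')) <= E (rn K) * X' < rn (flr (E (rn K) * X')) + 1.
  by apply: flrP; rewrite mulr_ge0 // ltW.
rewrite hF in f1 f2.
have D : `|E (rn K) * X - E (rn K) * X'| <= 1 by rewrite ler_norml; apply/andP; split; lra.
have eq : E (rn K) * X - E (rn K) * X' = (coord x i - coord x' i) * E (rn K - rn n0) by rewrite ED /X /X' /xi; ring.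
have -> : rn n0 - rn K = - (rn K - rn n0) by ring.
by rewrite EN -div1r ler_pdivlMr ?E_gt0 // -[X in _ * X](gtr0_norm (E_gt0 _)) -normrM -eq.
Qed.

Lemma bounded_coords x : exists n0, forall i, rn i < rn d -> 0 <= xi n0 x i < 1.
Proof.
suff [n0 H] : exists n0, forall i, rn i < rn d -> `|coord x i| < E (rn n0 - 1).
  exists n0 => i /H; rewrite /xi => h.
  have : `|coord x i * E (- rn n0)| < 1 / 2.
    rewrite normrM (gtr0_norm (E_gt0 _)) -ltr_pdivlMr ?E_gt0 // EN invrK.
    by move: h; rewrite ED EN E1; lra.
  by rewrite ltr_norml => /andP [h1 h2]; apply/andP; split; lra.
suff H : forall n, exists n0, forall i, rn i < rn n -> `|coord x i| < E (rn n0 - 1) by apply: H.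
apply: N_ind; first by dfn.
  by exists zero => i; rewrite rn0; have := rn_ge0 i; lra.
move=> n [n0 H].
have [n1 h1] := archimedean (`|lg `|coord x n| | + 1).
have [n2 E2] : isn (rn n0 + rn n1) by apply: isnD; apply: isn_rn.
exists n2 => i; rewrite rnS => hi.
have g1 := rn_ge0 n1; have g0 := rn_ge0 n0.
case: (ltP (rn i) (rn n)) => h.
  by apply: lt_le_trans (H _ h) _; apply: E_le; rewrite -E2; lra.
have -> : i = n by apply: rn_between => //; lra.
case: (ltP 0 `|coord x n|) => c0; last first.
  by apply: le_lt_trans c0 _; apply: E_gt0.
rewrite -[ltLHS](Elg c0); apply: E_lt.
by have := ler_norm (lg `|coord x n|); rewrite -E2; lra.
Qed.
End Coding.

(** * The game *)

Lemma bool_iff (a b : bool) : (a = true <-> b = true) -> a = b.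
Proof. by case: a b => [] [] // [u v]; [rewrite u | rewrite v]. Qed.

Definition upd {W : world} (e : fn bool) (m : N) (b : bool) : fn bool := lam false (fun i => ite (i = m) b (e i)).
Lemma updE {W : world} (e : fn bool) (m : N) b i : upd e m b i = ite (i = m) b (e i).
Proof. by rewrite /upd lamE //; dfn. Qed.
Lemma upd_lt {W : world} (e : fn bool) (m : N) b i : rn i < rn m -> upd e m b i = e i.
Proof. by move=> h; rewrite updE iteF // => im; move: h; rewrite im ltxx. Qed.
Lemma upd_eq {W : world} (e : fn bool) (m : N) b : upd e m b m = b.
Proof. by rewrite updE iteT. Qed.

Section Rules.
Context {W : world} (d L g : N).
Context (L0 : 0 < rn L).
Context (g0 : 0 < rn g).
Implicit Types (m n i j k : N) (e : fn bool) (p : fn N).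
Notation Q := (Q d L).

(** The first 1 + d rounds of each block: a bit for y and the low bits of the coordinates. *)
Definition announced m := exists k, rn k * Q <= rn m /\ rn m <= rn k * Q + rn d.
Definition offer j : R := ite (rn j < rn g) (rn j / rn g) 1.
Definition fac m j (b : bool) : R := ite (announced m) 1 (ite (b = true) (offer j) (1 - offer j)).
Definition mass p e : fn R := rec (1 : R) (fun i x => x * fac i (p i) (e i)).

Lemma DP1_announced : DP1 announced. Proof. by rewrite /announced /Q; dfn. Qed.
Lemma DF3_fac : DF3 fac.
Proof. by have ? := DP1_announced; rewrite /fac /offer; dfn. Qed.
Lemma massP p e : mass p e zero = 1 /\ forall n, mass p e (suc n) = mass p e n * fac n (p n) (e n).
Proof.
have ? := DF3_fac.
have H : DF2 (fun i (x : R) => x * fac i (p i) (e i)) by dfn.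
exact: (recP 1 H).
Qed.
Lemma mass0 p e : mass p e zero = 1. Proof. by case: (massP p e). Qed.
Lemma massS p e n : mass p e (suc n) = mass p e n * fac n (p n) (e n).
Proof. by case: (massP p e). Qed.
Lemma DF2_mass : DF2 mass.
Proof.
have ? := DF3_fac; rewrite /mass; dfn.
Qed.

Lemma offer_bounds j : 0 <= offer j <= 1.
Proof.
rewrite /offer; case: (classic (rn j < rn g)) => h; rewrite ?(iteT _ _ h) ?(iteF _ _ h); last by rewrite ler01 lexx.
apply/andP; split; first by apply: divr_ge0; rewrite ?rn_ge0 // ltW.
by rewrite ler_pdivrMr // mul1r ltW.
Qed.
Lemma fac_bounds m j b : 0 <= fac m j b <= 1.
Proof.
have /andP [h1 h2] := offer_bounds j; rewrite /fac.
case: (classic (announced m)) => a; rewrite ?(iteT _ _ a) ?(iteF _ _ a); first by rewrite ler01 lexx.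
case: b; first by rewrite iteT // h1 h2.
by rewrite iteF //; apply/andP; split; lra.
Qed.
Lemma mass_ge0 p e n : 0 <= mass p e n.
Proof.
move: n; have ? := DF2_mass; apply: N_ind; first by dfn.
  by rewrite mass0.
by move=> n IH; rewrite massS mulr_ge0 //; case/andP: (fac_bounds n (p n) (e n)).
Qed.
Lemma mass_decr p e m n : rn m <= rn n -> mass p e n <= mass p e m.
Proof.
move: n; have ? := DF2_mass; apply: N_ind; first by dfn.
  by rewrite rn0 => h; have -> : m = zero by apply: rn_inj; rewrite rn0; have := rn_ge0 m; lra.
move=> n IH; rewrite rnS => h; case: (leP (rn m) (rn n)) => [/IH h'|/rn_discrete h'].
  rewrite massS; apply: le_trans h'; have /andP [f0 f1] := fac_bounds n (p n) (e n).
  by rewrite -[leRHS]mulr1; apply: ler_wpM2l => //; apply: mass_ge0.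
by have -> : m = suc n by apply: rn_inj; rewrite rnS; lra.
Qed.
Lemma mass_agree p p' e e' n : (forall i, rn i < rn n -> p i = p' i) ->
  (forall i, rn i < rn n -> e i = e' i) -> mass p e n = mass p' e' n.
Proof.
move: n; have ? := DF2_mass; apply: N_ind; first by dfn.
  by rewrite !mass0.
move=> n IH; rewrite rnS => h1 h2; rewrite !massS h1 ?h2; try lra.
by rewrite IH // => i hi; [apply: h1|apply: h2]; lra.
Qed.

(** The bit sequence produced by a run: announced bits are chosen by I; at the other rounds I
    plays j, offering the fraction j / g of the current mass for the bit true, and II
    chooses, except that a bit offered no mass is never chosen. *)
Definition outcome p (q e : fn bool) : Prop := forall m,
  (announced m -> (e m = true <-> p m <> zero)) /\
  (~ announced m -> (e m = true <-> rn g <= rn (p m) \/ (p m <> zero /\ q m = true))).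

Context (t : R) (kap : N -> R) (Rl : V -> fn N -> Prop).
Context (Dkap : DF1 kap).
Context (DRl : DP2 Rl).

(** The mass after k blocks is at most the gauge of a cube of side 2 ^ (- k L) for the exponent t.
    The first kap n0 blocks are exempted; how many depends on the cover to be found if II wins. *)
Definition spread (p : fn N) (e : fn bool) (n0 : N) : Prop := forall k m, kap n0 <= rn k -> rn m = rn k * Q ->
  mass p e m <= E (- (t * rn L * rn k)).
Definition payoff p (q : fn bool) : Prop := exists (e : fn bool) (x : V) (y : fn N) (n0 : N),
  outcome p q e /\ codes d L e x y n0 /\ Rl x y /\ spread p e n0.

Lemma DP2_payoff : DP2 payoff.
Proof.
have ? := DP1_announced; have ? := DF2_mass.
by rewrite /payoff /outcome /codes /spread /oddn /xi /pcode /Q; dfn.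
Qed.

Lemma outcome_uniq p (q e e' : fn bool) : outcome p q e -> outcome p q e' -> e = e'.
Proof.
move=> h h'; apply: fn_ext => m; case: (h m) (h' m) => h1 h2 [h3 h4].
apply: bool_iff; case: (classic (announced m)) => a; first by rewrite h1 // h3.
by rewrite h2 // h4.
Qed.

End Rules.

(** * A strategy of the first player *)

Section WinI.
Context {W : world} (d L g : N).
Context (L0 : 0 < rn L).
Context (g0 : 0 < rn g).
Context (t : R) (kap : N -> R) (Rl : V -> fn N -> Prop).
Context (t0 : 0 < t).
Context (DRl : DP2 Rl).
Context (D : V).
Context (RlD : forall x y, Rl x y -> x ∈ D /\ euc d x).
Context (S : fn bool -> N -> N).
Context (DS : DF2 S).
Context (S_causal : forall (e e' : fn bool) m, (forall i, rn i < rn m -> e i = e' i) -> S e m = S e' m).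
Context (S_wins : forall (p : fn N) (q : fn bool), (forall m, p m = S q m) ->
  payoff d L g t kap Rl p q).
Implicit Types (m n i j k : N) (e : fn bool) (p : fn N).
Notation Q := (Q d L).
Notation announced := (announced d L).

Definition Sf e : fn N := lam zero (S e).
Lemma SfE e m : Sf e m = S e m. Proof. by rewrite /Sf lamE //; dfn. Qed.
Definition play_mass e : fn R := mass d L g (Sf e) e.
Lemma DF1_play_mass : DF1 play_mass.
Proof. by have ? := @DF2_mass _ d L g; rewrite /play_mass /Sf; dfn. Qed.
Lemma play_mass_agree e e' n : (forall i, rn i < rn n -> e i = e' i) -> play_mass e n = play_mass e' n.
Proof.
move=> h; apply: mass_agree => // i hi; rewrite !SfE; apply: S_causal => j hj; apply: h.
exact: lt_trans hj hi.
Qed.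

(** Plays in which each move of II is the resulting bit.  Without this normalization two moves of II
    with the same effect could provoke different continuations by I, and a point would not
    determine its play. *)
Definition legal e : Prop := forall m, (announced m -> (e m = true <-> S e m <> zero)) /\
  (~ announced m -> (rn g <= rn (S e m) -> e m = true) /\ (S e m = zero -> e m = false)).

Lemma DP1_legal : DP1 legal.
Proof. by have ? := @DP1_announced _ d L; rewrite /legal; dfn. Qed.

Lemma legal_wins e : legal e -> exists x y n0, codes d L e x y n0 /\ Rl x y /\
  spread d L g t kap (Sf e) e n0.
Proof.
move=> le; have [|e' [x [y [n0 [pe [ce [Rxy hv]]]]]]] := @S_wins (Sf e) e.
  by move=> m; rewrite SfE.
suff ee : e' = e by subst e'; exists x, y, n0.
apply: outcome_uniq pe _ => m; rewrite SfE; have [h1 h2] := le m; split=> // a.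
have [h3 h4] := h2 a; split=> [et|[|[_ ->]] //]; right; split=> // Sz.
by move: et; rewrite h4.
Qed.

Lemma legal_agree e e' m : legal e -> legal e' -> (forall i, rn i < rn m -> e i = e' i) ->
  (announced m \/ rn g <= rn (S e m) \/ S e m = zero) -> e m = e' m.
Proof.
move=> le le' h; have hS := S_causal h.
have [h1 h2] := le m; have [h1' h2'] := le' m.
case: (classic (announced m)) => a.
  by move=> _; apply: bool_iff; rewrite h1 // h1' // hS.
have [h3 h4] := h2 a; have [h3' h4'] := h2' a; rewrite -hS in h3' h4'.
by case=> [//|[z|z]]; [rewrite h3 // h3' | rewrite h4 // h4'].
Qed.

(** Where II has a real choice, the bit can be prescribed by any causal predicate. *)
Lemma legal_ex (Ch : fn bool -> N -> Prop) : DP2 Ch ->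
  (forall e e' m, (forall i, rn i < rn m -> e i = e' i) -> (Ch e m <-> Ch e' m)) ->
  exists e, legal e /\ forall m, ~ announced m -> rn (S e m) < rn g -> S e m <> zero ->
    (e m = true <-> Ch e m).
Proof.
move=> DC Cna; have Da := @DP1_announced _ d L.
pose (F := fun e m => ite (announced m) (n2b (S e m)) (ite (rn g <= rn (S e m)) true
   (ite (S e m = zero) false (ite (Ch e m) true false)))).
have [||e he] := @fix_ex _ _ _ false F.
- by rewrite /F /n2b; dfn.
- move=> e e' m h; have h' i : rn i < rn m -> e i = e' i by move/nltP; apply: h.
  rewrite /F (S_causal h'); do 3 congr ite.
  have cc := Cna _ _ _ h'; case: (classic (Ch e m)) => c; last by rewrite !iteF // -cc.
  by rewrite !iteT // -cc.
exists e; split=> m; rewrite he /F.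
  split=> a.
    rewrite iteT // /n2b; case: (classic (S e m = zero)) => z; first by rewrite iteT.
    by rewrite iteF.
  rewrite iteF //; split=> [h|z]; first by rewrite iteT.
  by rewrite iteF ?iteT // z rn0; apply/negP; rewrite -ltNge.
move=> a h z; rewrite iteF // iteF; last by apply/negP; rewrite -ltNge.
rewrite iteF //; case: (classic (Ch e m)) => c; by [rewrite iteT | rewrite iteF].
Qed.

(** A bit that is offered no mass is never the outcome. *)
Lemma play_mass_gt0 e n : legal e -> 0 < play_mass e n.
Proof.
move=> le; move: n; have ? := DF1_play_mass; apply: N_ind; first by dfn.
  by rewrite /play_mass mass0.
move=> n IH; rewrite /play_mass massS -/(play_mass e) mulr_gt0 // /fac SfE.
case: (classic (announced n)) => a; first by rewrite iteT.
rewrite iteF //; have [_ /(_ a) [h3 h4]] := le n.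
rewrite /offer; case: (classic (rn (S e n) < rn g)) => h; last first.
  rewrite (iteF _ _ h) iteT // h3 // leNgt; exact/negP.
rewrite (iteT _ _ h); case: (zero_or_suc (S e n)) => z.
  by rewrite iteF ?(h4 z) // z rn0 mul0r subr0.
have s0 : 0 < rn (S e n) by case: z => k ->; rewrite rnS; have := rn_ge0 k; lra.
case: (e n); first by rewrite iteT // divr_gt0.
by rewrite iteF // subr_gt0 ltr_pdivrMr // mul1r.
Qed.

Lemma high_round m : ~ announced m -> exists k l i, rn l < rn L /\ rn i < rn d /\
  0 < rn l /\ rn m = rn k * Q + 1 + rn l * rn d + rn i.
Proof.
move=> na; have Q0 := Q_gt0 d L.
have q0 : 0 <= rn m / Q by rewrite divr_ge0 ?rn_ge0 // ltW.
have /andP [q1 q2] := flrP q0; move: q1 q2; set k := flr _ => q1 q2.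
rewrite ler_pdivlMr // in q1; rewrite ltr_pdivrMr // in q2.
have [kQ EkQ] : isn (rn k * Q) by apply: isnM; [apply: isn_rn|apply: isn_Q].
have h1 : rn k * Q + rn d < rn m by rewrite ltNge; apply/negP => h; apply: na; exists k.
have h2 : rn k * Q + rn d + 1 <= rn m.
  have [s Es] : isn (rn k * Q + rn d) by rewrite EkQ; apply: isnD; apply: isn_rn.
  by rewrite Es; apply: rn_discrete; rewrite -Es.
have [a Ea] : isn (rn m - (rn k * Q + 1)).
  apply: isnB; [exact: isn_rn | by rewrite EkQ; apply: isnD; [apply: isn_rn|apply: isn1] |].
  by have := rn_ge0 d; lra.
have aL : rn a < rn d * rn L by rewrite -Ea; move: q2; rewrite mulrDl /Q; lra.
have ad : rn d <= rn a by rewrite -Ea; lra.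
have d0 : 0 < rn d.
  rewrite lt_def rn_ge0 andbT; apply/eqP => z; move: aL; rewrite z mul0r.
  by have := rn_ge0 a; lra.
have p0 : 0 <= rn a / rn d by rewrite divr_ge0 ?rn_ge0.
have /andP [p1 p2] := flrP p0; move: p1 p2; set l := flr _ => p1 p2.
rewrite ler_pdivlMr // in p1; rewrite ltr_pdivrMr // in p2.
have [i Ei] : isn (rn a - rn l * rn d).
  by apply: isnB => //; [apply: isn_rn | apply: isnM; apply: isn_rn].
exists k, l, i; split.
  rewrite ltNge; apply/negP => h; have : rn L * rn d <= rn l * rn d by apply: ler_wpM2r => //; apply: ltW.
  by lra.
split; first by rewrite -Ei; lra.
split; last by rewrite -Ei -Ea; lra.
rewrite lt_def rn_ge0 andbT; apply/eqP => z; move: p2; rewrite z; lra.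
Qed.

Context (es : fn bool) (n0 K0 : N).
Context (esl : legal es).
Context (hK0 : pcode 0 (rn n0) < rn K0).
Context (xs : V) (ys : fn N).
Context (esc : codes d L es xs ys n0).

(** Agreement with es on K0 blocks ensures that the code has the same n0 as es, so that all the
    points concerned are scaled alike. *)
Definition extends e := forall i, rn i < rn K0 * Q -> e i = es i.
Definition branch e (x : V) (y : fn N) := legal e /\ extends e /\ codes d L e x y n0 /\ Rl x y.

Lemma DP3_branch : DP3 branch.
Proof.
have ? := DP1_legal.
by rewrite /branch /extends /codes /oddn /xi /pcode /Q; dfn.
Qed.

Lemma branch_ex e : legal e -> extends e -> exists x y, branch e x y /\
  forall k m, kap n0 <= rn k -> rn m = rn k * Q -> play_mass e m <= E (- (t * rn L * rn k)).
Proof.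
move=> le xe; have [x [y [n1 [ce [Rxy hv]]]]] := legal_wins le.
have e01 : n0 = n1.
  have [h _] := codes_agree esc ce (fun m hm => esym (xe m hm)); exact: h hK0.
by subst n1; exists x, y.
Qed.

(** At the first difference the round is not announced, so the low bits of the block agree and the
    points are separated by codes_sep. *)
Lemma branch_sep e e' x x' y y' k : branch e x y -> branch e' x' y' ->
  (forall i, rn i < rn d -> `|coord x i - coord x' i| <= E (rn n0 - rn k * rn L)) ->
  forall m, rn m < rn k * Q -> e m = e' m.
Proof.
move=> [le [_ [ce _]]] [le' [_ [ce' _]]] near.
apply: N_sind; first by rewrite /Q; dfn.
move=> m IH hm.
have IH' i : rn i < rn m -> e i = e' i by move=> hi; apply: IH => //; apply: lt_trans hi hm.
case: (classic (announced m)) => a; first by apply: legal_agree => //; left.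
apply: NNPP => dif.
have [k' [l [i [hl [hi [l1 Em]]]]]] := high_round a.
have low m0 : rn m0 = rn k' * Q + 1 + rn i -> e m0 = e' m0.
  move=> E0; apply: IH'; rewrite E0 Em; have : 0 < rn l * rn d.
    by rewrite mulr_gt0 //; apply: le_lt_trans hi; apply: rn_ge0.
  lra.
have := codes_sep L0 ce ce' hl hi Em low dif.
have kk : rn k' < rn k.
  rewrite ltNge; apply/negP => h; have : rn k * Q <= rn k' * Q by apply: ler_wpM2r => //; apply/ltW/Q_gt0.
  have : 0 <= rn l * rn d by rewrite mulr_ge0 ?rn_ge0.
  have := rn_ge0 i; lra.
have kL : (rn k' + 1) * rn L <= rn k * rn L by apply: ler_wpM2r; [apply: ltW | apply: rn_discrete].
have : E (rn n0 - rn k * rn L) <= E (rn n0 - (rn k' + 1) * rn L) by apply: E_le; lra.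
by have := near i hi; lra.
Qed.

Lemma branch_uniq e e' x y y' : branch e x y -> branch e' x y' -> e = e' /\ y = y'.
Proof.
move=> b b'; have ee : e = e'.
  apply: fn_ext => m; apply: (branch_sep (k := suc m) b b') => [i _|].
    by rewrite subrr normr0 ltW // E_gt0.
  have : 0 <= rn d * rn L by rewrite mulr_ge0 ?rn_ge0.
  move=> h; have : 0 <= (rn m + 1) * (rn d * rn L) by rewrite mulr_ge0 //; have := rn_ge0 m; lra.
  by rewrite rnS /Q; lra.
subst e'; split=> //; apply: fn_ext => n.
have [_ [_ [c _]]] := b; have [_ [_ [c' _]]] := b'.
have [K hK] := archimedean (pcode (rn n + 1) (rn (y n))).
by case: (codes_agree (K := K) c c') => // _; apply.
Qed.

(** The witness is a function of the point because a point determines its branch. *)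
Lemma uniformizer_ex : exists B f : V, (forall x, x ∈ B <-> exists e y, branch e x y) /\
  is_fun f B (baire wo) /\
  (forall x z, inrel f x z <-> exists e y, branch e x y /\ z = enc y).
Proof.
have Db := DP3_branch.
have [|B HB] := @separation _ D (fun x => exists e y, branch e x y); first by dfn.
have HB' x : x ∈ B <-> exists e y, branch e x y.
  rewrite HB; split=> [[]|h] //; split=> //.
  by case: h => e [y [_ [_ [_ /RlD []]]]].
pose (P := fun (x z : V) => exists e (y : fn N), branch e x y /\ z = enc y).
have PU x z z' : P x z -> P x z' -> z = z'.
  by move=> [e [y [b ->]]] [e' [y' [b' ->]]]; have [_ ->] := branch_uniq b b'.
have EP x : (exists z, P x z) -> P x (eps wo (P x)) by apply: epsP.
have [||f [Ff If]] := @graph_fun _ V _ B (fun x => eps wo (P x)) (baire wo).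
- by rewrite /DF1; by_eps; [move=> h; apply: PU | rewrite /P; dfn].
- move=> x /HB' [e [y b]]; exists x; split=> //.
  have [|e' [y' [_ ->]]] := EP x; first by exists (enc y), e, y.
  by apply/baireE; exists y'.
exists B, f; split=> //; split=> // x z; rewrite (If x z); split.
  move=> [/HB' [e [y b]] ->].
  by apply: EP; exists (enc y), e, y.
move=> h; split; first by apply/HB'; case: h => e [y [b _]]; exists e, y.
symmetry; apply: epsU => // z' h'; exact: PU h' h.
Qed.

Lemma digits_bound (y : fn N) n : exists K, forall i, rn i < rn n -> pcode (rn i + 1) (rn (y i)) < rn K.
Proof.
move: n; apply: N_ind; first by rewrite /pcode; dfn.
  by exists zero => i; rewrite rn0; have := rn_ge0 i; lra.
move=> n [K H]; have [K' h'] := archimedean (pcode (rn n + 1) (rn (y n))).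
have [K2 E2] : isn (rn K + rn K') by apply: isnD; apply: isn_rn.
have k0 := rn_ge0 K; have k0' := rn_ge0 K'.
exists K2 => i; rewrite rnS -E2 => hi; case: (ltP (rn i) (rn n)) => h.
  by have := H i h; lra.
have -> : i = n by apply: rn_between => //; lra.
lra.
Qed.

Lemma uniformizer_continuous (B f : V) : (forall x, x ∈ B <-> exists e y, branch e x y) ->
  (forall x z, inrel f x z <-> exists e y, branch e x y /\ z = enc y) ->
  is_continuous wK wo (enc d) B f.
Proof.
move=> HB Hf x z n0' xB /Hf [e [y [b ->]]] nw; pose n := natv nw.
have [K hK] := digits_bound y n.
exists (E (rn n0 - rn K * rn L)); split; first exact: E_gt0.
move=> x' z' r x'B /Hf [e' [y' [b' ->]]] hr re i k iin.
have iw : i ∈ wo by apply: (@in_omega_nat _ n).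
have [_ [_ [c Rx]]] := b; have [_ [_ [c' Rx']]] := b'.
have [_ ex] := RlD Rx; have [_ ex'] := RlD Rx'.
have near j : rn j < rn d -> `|coord x j - coord x' j| <= E (rn n0 - rn K * rn L).
  by move=> hj; have := coord_le_dist ex ex' hr hj; lra.
have agr := branch_sep b b' near.
have [_ dg] := codes_agree c c' agr.
have yy : y (natv iw) = y' (natv iw) by apply: dg; apply: hK; apply/nltP.
rewrite !inrelE; split=> /graphP [m /opair_inj [Em ->]]; have Ei : natv iw = m by apply: N_inj.
  by rewrite -Ei yy; apply/graphP; exists (natv iw).
by rewrite -Ei -yy; apply/graphP; exists (natv iw).
Qed.

(** A sequence of sets U n such that the part of U n on branches lies below one node, of kn n
    blocks; c n bounds the mass of this node, and s the total cost. *)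
Section Measure.
Context (U : fn V) (c : fn R) (kn : fn N) (K1 : N).
Context (hK1 : kap n0 <= rn K1).
Context (knK : forall n, rn K1 <= rn (kn n)).
Context (kn_near : forall n x x', x ∈ U n -> x' ∈ U n -> euc d x -> euc d x' ->
  forall i, rn i < rn d -> `|coord x i - coord x' i| <= E (rn n0 - rn (kn n) * rn L)).
Context (cE : forall n, c n = E (- (t * rn L * rn (kn n)))).
Context (ms : N).
Context (hms : rn ms = rn K0 * Q).
Context (s : R).
Context (hs : s < play_mass es ms).
Context (c_sum : forall n, psum c n <= s).

Definition compat n e m := exists x e' y, x ∈ U n /\ branch e' x y /\
  forall i, rn i < rn m -> e' i = e i.
Definition load e m : fn R := lam (0 : R) (fun n => ite (compat n e m) (c n) 0).
(** The covering sets that meet the node of length m on e do not exhaust its mass. *)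
Definition Inv e m := exists gam : R, 0 < gam /\ forall n, psum (load e m) n <= play_mass e m - gam.

Lemma DP3_compat : DP3 compat.
Proof. by have ? := DP3_branch; rewrite /compat; dfn. Qed.
Lemma loadE e m n : load e m n = ite (compat n e m) (c n) 0.
Proof. by have ? := DP3_compat; rewrite /load lamE //; dfn. Qed.
Lemma DP2_Inv : DP2 Inv.
Proof.
have ? := DP3_compat; have ? := DF1_play_mass.
by rewrite /Inv /load; dfn.
Qed.
Lemma c_gt0 n : 0 < c n. Proof. by rewrite cE E_gt0. Qed.
Lemma load_bounds e m n : 0 <= load e m n <= c n.
Proof.
have h := ltW (c_gt0 n); rewrite loadE; case: (classic (compat n e m)) => a.
  by rewrite iteT // h lexx.
by rewrite iteF // lexx h.
Qed.
Lemma compat_agree e e' m n : (forall i, rn i < rn m -> e i = e' i) -> compat n e m -> compat n e' m.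
Proof.
by move=> h [x [e1 [y [xu [b a]]]]]; exists x, e1, y; split=> //; split=> // i hi; rewrite a // h.
Qed.
Lemma load_agree e e' m : (forall i, rn i < rn m -> e i = e' i) -> load e m = load e' m.
Proof.
move=> h; apply: fn_ext => n; rewrite !loadE.
case: (classic (compat n e m)) => a; first by rewrite !iteT //; apply: compat_agree a.
rewrite !iteF // => a'; apply: a; apply: compat_agree a' => i hi; by rewrite h.
Qed.
Lemma Inv_agree e e' m : (forall i, rn i < rn m -> e i = e' i) -> Inv e m -> Inv e' m.
Proof.
move=> h [gam [g1 H]]; exists gam; split=> // n; rewrite -(load_agree h) -(play_mass_agree h); exact: H.
Qed.

Lemma Inv_start : Inv es ms.
Proof.
exists (play_mass es ms - s); split; first by rewrite subr_gt0.
move=> n; have -> : play_mass es ms - (play_mass es ms - s) = s by ring.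
by apply: le_trans (c_sum n); apply: psum_le => i _; case/andP: (load_bounds es ms i).
Qed.

(** Otherwise the mass of the node is at most c n, so that U n alone exhausts it. *)
Lemma compat_deep e m n : legal e -> extends e -> Inv e m -> compat n e m ->
  rn m < rn (kn n) * Q.
Proof.
move=> le xe [gam [g1 H]] cm; rewrite ltNge; apply/negP => h.
have [_ [_ [_ hv]]] := branch_ex le xe.
have [k Ek] : isn (rn (kn n) * Q) by apply: isnM; [apply: isn_rn|apply: isn_Q].
have := hv (kn n) k (le_trans hK1 (knK n)) (esym Ek); rewrite -cE => hc.
have hk : rn k <= rn m by rewrite -Ek.
have := mass_decr d L g0 (Sf e) e hk; rewrite -/(play_mass e) => hd.
have l0 i : 0 <= load e m i by case/andP: (load_bounds e m i).
have := @psum_term _ (load e m) (suc n) n l0; rewrite loadE iteT // rnS => ht.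
have := H (suc n); have : rn n < rn n + 1 by lra.
by move/ht; lra.
Qed.

(** A set that meets the node lies below only one of its children, by compat_deep.  Hence the loads of
    the children add up to at most the load of the node, while their masses add up to its mass. *)
Lemma Inv_step e m : legal e -> extends e -> Inv e m ->
  ~ announced m -> rn (S e m) < rn g -> S e m <> zero ->
  Inv (upd e m false) (suc m) \/ Inv (upd e m true) (suc m).
Proof.
move=> le xe Ie na jg j0; apply: NNPP => H.
have [gam [gm HI]] := Ie.
pose lf := load (upd e m false) (suc m); pose lt := load (upd e m true) (suc m).
have [nf hf] : exists n, play_mass (upd e m false) (suc m) - gam / 2 < psum lf n.
  apply: NNPP => h; apply: H; left; exists (gam / 2); split; first by lra.
  by move=> n; rewrite leNgt; apply/negP => h'; apply: h; exists n.
have [nt ht] : exists n, play_mass (upd e m true) (suc m) - gam / 2 < psum lt n.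
  apply: NNPP => h; apply: H; right; exists (gam / 2); split; first by lra.
  by move=> n; rewrite leNgt; apply/negP => h'; apply: h; exists n.
have [n En] : isn (rn nf + rn nt) by apply: isnD; apply: isn_rn.
have g1 := rn_ge0 nf; have g2 := rn_ge0 nt.
have l0 b i : 0 <= load (upd e m b) (suc m) i by case/andP: (load_bounds (upd e m b) (suc m) i).
have hf' : psum lf nf <= psum lf n by apply: psum_mono; [exact: l0 | rewrite -En; lra].
have ht' : psum lt nt <= psum lt n by apply: psum_mono; [exact: l0 | rewrite -En; lra].
have Vb b : play_mass (upd e m b) (suc m) = play_mass e m * fac d L g m (S e m) b.
  have ag i : rn i < rn m -> upd e m b i = e i by exact: upd_lt.
  by rewrite /play_mass massS -/(play_mass (upd e m b)) (play_mass_agree ag) SfE upd_eq (S_causal ag).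
have fs : fac d L g m (S e m) false + fac d L g m (S e m) true = 1.
  rewrite /fac !(iteF _ _ na) iteF // iteT //; lra.
have : psum lf n + psum lt n <= psum (load e m) n.
  have [|lb hlb] := @mkfn _ R _ (fun i => lf i + lt i); first by dfn.
  rewrite -(@psum_add _ lf lt lb) //; apply: psum_le => i _; rewrite hlb.
  have sub b : compat i (upd e m b) (suc m) -> compat i e m.
    move=> [x [e1 [y [xu [br a]]]]]; exists x, e1, y; split=> //; split=> // i' hi'.
    by rewrite a ?upd_lt //; rewrite rnS; lra.
  rewrite /lf /lt !loadE.
  case: (classic (compat i (upd e m false) (suc m))) => cf; rewrite ?(iteT _ _ cf) ?(iteF _ _ cf);
  case: (classic (compat i (upd e m true) (suc m))) => ct; rewrite ?(iteT _ _ ct) ?(iteF _ _ ct) ?add0r ?addr0.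
  - have dp := compat_deep le xe Ie (sub _ cf).
    have [x [e1 [y [xu [br a]]]]] := cf; have [x' [e1' [y' [xu' [br' a']]]]] := ct.
    have [_ [_ [_ Rx]]] := br; have [_ [_ [_ Rx']]] := br'.
    have [_ ex] := RlD Rx; have [_ ex'] := RlD Rx'.
    have mm : rn m < rn (suc m) by rewrite rnS; lra.
    have := branch_sep br br' (kn_near xu xu' ex ex') dp.
    by rewrite a // a' // !upd_eq.
  - by rewrite iteT //; apply: sub cf.
  - by rewrite iteT //; apply: sub ct.
  - case: (classic (compat i e m)) => h; rewrite ?(iteT _ _ h) ?(iteF _ _ h) //; exact/ltW/c_gt0.
have := HI n; rewrite !Vb in hf ht.
have : play_mass e m * fac d L g m (S e m) false + play_mass e m * fac d L g m (S e m) true = play_mass e m.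
  by rewrite -mulrDr fs mulr1.
by lra.
Qed.

(** Always following a node whose mass is not exhausted leads to a point outside all the sets. *)
Lemma branch_uncovered : exists e x y, branch e x y /\ forall n, ~ x ∈ U n.
Proof.
have ? := DP2_Inv.
pose (Ch := fun e m => (rn m < rn ms /\ es m = true) \/
  (rn ms <= rn m /\ ~ Inv (upd e m false) (suc m))).
have agu e e' m b : (forall i, rn i < rn m -> e i = e' i) -> forall i, rn i < rn (suc m) ->
    upd e m b i = upd e' m b i.
  move=> h i; rewrite rnS => hi; case: (ltP (rn i) (rn m)) => im; first by rewrite !upd_lt // h.
  have -> : i = m by apply: rn_between.
  by rewrite !upd_eq.
have [||e [le eC]] := @legal_ex Ch.
- by rewrite /Ch /upd; dfn.
- move=> e e' m h; have iv : Inv (upd e m false) (suc m) <-> Inv (upd e' m false) (suc m).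
    split; apply: Inv_agree; apply: agu => // i hi; by rewrite h.
  by rewrite /Ch iv.
have xe : extends e.
  move=> i; rewrite -hms; move: i; apply: N_sind; first by dfn.
  move=> m IH hm; have IH' i : rn i < rn m -> e i = es i by move=> hi; apply: IH => //; apply: lt_trans hi hm.
  case: (classic (announced m)) => a; first by apply: legal_agree => //; left.
  case: (leP (rn g) (rn (S e m))) => j; first by apply: legal_agree => //; right; left.
  case: (classic (S e m = zero)) => z; first by apply: legal_agree => //; right; right.
  apply: bool_iff; rewrite eC // /Ch; split=> [[[_ ->]|[h _]] //|h]; last by left.
  by move: h; rewrite leNgt hm.
have IA : forall m, rn ms <= rn m -> Inv e m.
  have start m : rn ms = rn m -> Inv e m.
    move=> /rn_inj <-; apply: (@Inv_agree es e ms) Inv_start => i; rewrite hms => hi.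
    by rewrite xe.
  apply: N_ind; first by dfn.
    by rewrite rn0 => h; apply: start; rewrite rn0; have := rn_ge0 ms; lra.
  move=> m IH; rewrite le_eqVlt => /orP [/eqP|]; first exact: start.
  rewrite rnS => h; have hm : rn ms <= rn m by rewrite leNgt; apply/negP => /rn_discrete; lra.
  have Im := IH hm.
  have self b : e m = b -> Inv (upd e m b) (suc m) -> Inv e (suc m).
    move=> eb; apply: Inv_agree => i; rewrite rnS => hi; case: (ltP (rn i) (rn m)) => im; first by rewrite upd_lt.
    have -> : i = m by apply: rn_between.
    by rewrite upd_eq.
  have forced : play_mass e (suc m) = play_mass e m -> Inv e (suc m).
    move=> EV; have [gam [g1 H]] := Im; exists gam; split=> // n; rewrite EV.
    apply: le_trans (H n); apply: psum_le => i _; rewrite !loadE.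
    case: (classic (compat i e (suc m))) => ci; rewrite ?(iteT _ _ ci) ?(iteF _ _ ci).
      rewrite iteT //; move: ci => [x [e1 [y [xu [br a]]]]]; exists x, e1, y; split=> //; split=> // i' hi'.
      by apply: a; rewrite rnS; lra.
    case: (classic (compat i e m)) => h'; rewrite ?(iteT _ _ h') ?(iteF _ _ h') //; exact/ltW/c_gt0.
  have [l1 l2] := le m.
  case: (classic (announced m)) => a.
    by apply: forced; rewrite /play_mass massS /fac iteT // mulr1.
  have [l3 l4] := l2 a.
  case: (leP (rn g) (rn (S e m))) => j.
    apply: forced; rewrite /play_mass massS /fac iteF // SfE (l3 j) iteT // /offer iteF ?mulr1 //.
    by apply/negP; rewrite -leNgt.
  case: (classic (S e m = zero)) => z.
    apply: forced; rewrite /play_mass massS /fac iteF // SfE (l4 z) iteF // z /offer rn0 iteT // mul0r subr0 mulr1 //.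
  have := eC m a j z; rewrite /Ch => hC.
  case: (classic (Inv (upd e m false) (suc m))) => I0.
    apply: (self false) => //; apply/negP => et.
    have [[h' _]|[_ //]] := hC.1 et.
    by move: h'; rewrite ltNge hm.
  have et : e m = true by apply/hC; right.
  by case: (Inv_step le xe Im a j z) => // I1; apply: (self true).
have [x [y [br _]]] := branch_ex le xe.
exists e, x, y; split=> // n xu.
have [m Em] : isn (rn (kn n) * Q + rn ms).
  by apply: isnD; [apply: isnM; [apply: isn_rn|apply: isn_Q]|apply: isn_rn].
have kq : 0 <= rn (kn n) * Q by rewrite mulr_ge0 ?rn_ge0 // ltW // Q_gt0.
have Im : Inv e m by apply: IA; rewrite -Em; lra.
have cm : compat n e m by exists x, e, y.
by have := compat_deep le xe Im cm; rewrite -Em; have := rn_ge0 ms; lra.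
Qed.
End Measure.

Lemma geometric_sum : exists f : fn R, (forall n, f n = E (- (rn n + 1))) /\ forall n, psum f n <= 1.
Proof.
have [|f Hf] := @mkfn _ R _ (fun n => E (- (rn n + 1))); first by dfn.
exists f; split=> // n; suff -> : psum f n = 1 - E (- rn n) by have := E_gt0 (- rn n); lra.
move: n; apply: N_ind; first by dfn.
  by rewrite psum0 rn0 oppr0 E0 subrr.
move=> n IH; rewrite psumS IH Hf rnS opprD ED.
have -> : E (-1) = 1 / 2 by rewrite EN E1 div1r.
by field.
Qed.

(** A set of diameter r > 0 is assigned to the number of blocks at scale r, where the masses are at most
    a constant times r ^ t <= r ^ u.  The sets of diameter 0 are assigned to nodes so deep that
    they contribute at most zeta altogether. *)
Lemma uniformizer_dim (B : V) : (forall x, x ∈ B <-> exists e y, branch e x y) ->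
  forall u, 0 <= u -> hausdorff_null wo (enc d) B u -> t <= u.
Proof.
move=> HB u u0 nB; rewrite leNgt; apply/negP => ut.
have [ms hms] : isn (rn K0 * Q) by apply: isnM; [apply: isn_rn|apply: isn_Q].
have v0 := play_mass_gt0 ms esl; set v := play_mass es ms in v0.
have tL : 0 < t * rn L by rewrite mulr_gt0.
have [k1 hk1] := archimedean (kap n0); have [k2 hk2] := archimedean (rn n0 / rn L).
rewrite ltr_pdivrMr // in hk2.
have [K1 EK1] : isn (rn k1 + rn k2) by apply: isnD; apply: isn_rn.
have k10 := rn_ge0 k1; have k20 := rn_ge0 k2.
have K1L : rn n0 <= rn K1 * rn L.
  rewrite -EK1 mulrDl; have : 0 <= rn k1 * rn L by rewrite mulr_ge0 // ltW.
  by lra.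
have eTL := E_gt0 (t * rn L).
pose eta := v / (4 * E (t * rn L)); pose zeta := v / 4.
have eta0 : 0 < eta by rewrite divr_gt0 // mulr_gt0.
have zeta0 : 0 < zeta by rewrite divr_gt0.
have [U [w [Ue [Uc [Ud [w0 ws]]]]]] := cover_elim u0 (nB _ _ (E_gt0 (rn n0 - rn K1 * rn L)) eta0).
pose (Cond := fun n k => rn K1 <= rn k /\
  (forall x x' : V, x ∈ U n -> x' ∈ U n -> forall i, rn i < rn d ->
     `|coord x i - coord x' i| <= E (rn n0 - rn k * rn L)) /\
  E (- (t * rn L * rn k)) <= E (t * rn L) * w n + zeta * E (- (rn n + 1))).
have Cex n : exists k, Cond n k.
  have P0 : 0 <= zeta * E (- (rn n + 1)) by rewrite mulr_ge0 ?ltW // E_gt0.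
  have Q0 : 0 <= E (t * rn L) * w n by rewrite mulr_ge0 // ltW.
  (* sets without extension are put in a node so deep that its bound is negligible *)
  have thin : (forall x x' : V, x ∈ U n -> x' ∈ U n -> forall i, rn i < rn d ->
      coord x i = coord x' i) -> exists k, Cond n k.
    move=> same; have [k3 hk3] := archimedean ((rn n + 1 - lg zeta) / (t * rn L)).
    rewrite ltr_pdivrMr // in hk3.
    have [k Ek] : isn (rn K1 + rn k3) by apply: isnD; apply: isn_rn.
    have k30 := rn_ge0 k3; have K10 := rn_ge0 K1.
    exists k; split; first by rewrite -Ek; lra.
    split; first by move=> x x' xu xu' i hi; rewrite (same x x') // subrr normr0 ltW // E_gt0.
    have : E (- (t * rn L * rn k)) <= zeta * E (- (rn n + 1)).
      rewrite -{1}(Elg zeta0) -ED; apply: E_le; rewrite -Ek.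
      have : 0 <= t * rn L * rn K1 by rewrite mulr_ge0 // ltW.
      by lra.
    by lra.
  have cd r x x' i : is_diam (enc d) (U n) r -> x ∈ U n -> x' ∈ U n -> rn i < rn d ->
      `|coord x i - coord x' i| <= r.
    move=> [hr _] xu xu' hi; have [r' hr'] := dist_ex (Ue _ _ xu) (Ue _ _ xu').
    exact: le_trans (coord_le_dist (Ue _ _ xu) (Ue _ _ xu') hr' hi) (hr _ _ _ xu xu' hr').
  case: (Ud n) => [em|[r [hr [re rv]]]]; first by apply: thin => x x' /em.
  case: (leP r 0) => r0.
    apply: thin => x x' xu xu' i hi; apply/eqP; rewrite -subr_eq0 -normr_le0.
    exact: le_trans (cd _ _ _ _ hr xu xu' hi) r0.
  have lr : lg r <= rn n0 - rn K1 * rn L by rewrite -[leRHS]lgE; apply: lg_le.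
  have pos : 0 <= (rn n0 - lg r) / rn L.
    have : 0 <= rn K1 * rn L by rewrite mulr_ge0 ?rn_ge0 // ltW.
    by move=> h; rewrite divr_ge0 ?rn_ge0 //; lra.
  have /andP [f1 f2] := flrP pos; move: f1 f2; set k := flr _ => f1 f2.
  rewrite ler_pdivlMr // in f1; rewrite ltr_pdivrMr // in f2.
  exists k; split.
    rewrite leNgt; apply/negP => /rn_discrete h.
    have : (rn k + 1) * rn L <= rn K1 * rn L by apply: ler_wpM2r => //; exact: ltW.
    by lra.
  split.
    move=> x x' xu xu' i hi; apply: le_trans (cd _ _ _ _ hr xu xu' hi) _.
    by rewrite -{1}(Elg r0); apply: E_le; lra.
  rewrite rv // -ED.
  have : E (- (t * rn L * rn k)) <= E (t * rn L + u * lg r).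
    apply: E_le.
    have n00 := rn_ge0 n0.
    have h1 : t * (rn n0 - lg r) <= t * ((rn k + 1) * rn L) by apply: ler_wpM2l; apply: ltW.
    have h2 : 0 <= t * rn n0 by rewrite mulr_ge0 // ltW.
    have h3 : 0 <= (t - u) * - lg r by rewrite mulr_ge0 ?subr_ge0 ?oppr_ge0 //; [apply: ltW | lra].
    by lra.
  by lra.
have [kn knP] : exists kn : fn N, forall n, Cond n (kn n).
  pose (least := fun n k => Cond n k /\ forall k', Cond n k' -> rn k <= rn k').
  have lU n k k' : least n k -> least n k' -> k = k'.
    by move=> [h1 h2] [h3 h4]; apply: rn_inj; apply/eqP; rewrite eq_le h2 ?h4.
  have [|kn Hk] := @mkfn _ N _ (fun n => eps zero (least n)).
    rewrite /DF1; by_eps; first by move=> h; apply: lU.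
    by rewrite /least /Cond; dfn.
  exists kn => n; rewrite Hk; suff [] : least n (eps zero (least n)) by [].
  apply: epsP; have [|k [h1 h2]] := @N_least _ (Cond n) _ (Cex n); first by rewrite /Cond; dfn.
  by exists k.
have [|c Hc] := @mkfn _ R _ (fun n => E (- (t * rn L * rn (kn n)))); first by dfn.
have csum n : psum c n <= v / 2.
  have [f [Hf fs]] := geometric_sum.
  have [|f1 Hf1] := @mkfn _ R _ (fun n => E (t * rn L) * w n); first by dfn.
  have [|f2 Hf2] := @mkfn _ R _ (fun n => zeta * f n); first by dfn.
  have [|f3 Hf3] := @mkfn _ R _ (fun n => f1 n + f2 n); first by dfn.
  apply: (@le_trans _ _ (psum f3 n)).
    by apply: psum_le => i _; rewrite Hc Hf3 Hf1 Hf2 Hf; case: (knP i) => _ [].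
  rewrite (psum_add _ Hf3) (psum_scale _ Hf1) (psum_scale _ Hf2).
  have h1 : E (t * rn L) * psum w n <= v / 4.
    have -> : v / 4 = E (t * rn L) * eta by rewrite /eta; field; rewrite gt_eqF.
    by apply: ler_wpM2l => //; apply: ltW.
  have h2 : zeta * psum f n <= v / 4 by rewrite -[leRHS]mulr1; apply: ler_wpM2l => //; apply: ltW.
  by lra.
have [|||||e [x [y [br nU]]]] := @branch_uncovered U c kn K1 _ _ _ Hc ms (esym hms) (v / 2).
- by rewrite -EK1; lra.
- by move=> n; case: (knP n).
- by move=> n z z' zu zu' _ _; case: (knP n) => _ [h _]; apply: h.
- by rewrite -/v; lra.
- exact: csum.
have [n xu] : exists n, x ∈ U n by apply: Uc; apply/HB; exists e, y.
by case: (nU n).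
Qed.

End WinI.

(** * A strategy of the second player *)

Section WinII.
Context {W : world} (d L g : N).
Context (L0 : 0 < rn L).
Context (g0 : 0 < rn g).
Context (t : R) (kap : N -> R) (Rl : V -> fn N -> Prop).
Context (Dkap : DF1 kap).
Context (DRl : DP2 Rl).
Context (D : V).
Context (D_dom : forall x, x ∈ D -> euc d x /\ exists y, Rl x y).
Context (T : fn N -> N -> bool).
Context (DT : DF2 T).
Context (T_causal : forall (p p' : fn N) m, (forall i, rn i <= rn m -> p i = p' i) -> T p m = T p' m).
Context (T_wins : forall (p : fn N) (q : fn bool), (forall m, q m = T p m) ->
  ~ payoff d L g t kap Rl p q).
Implicit Types (m n i j k : N) (e : fn bool) (p : fn N).
Notation Q := (Q d L).
Notation announced := (announced d L).

Definition put p m j : fn N := lam zero (fun i => ite (i = m) j (p i)).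
Lemma putE p m j i : put p m j i = ite (i = m) j (p i).
Proof. by rewrite /put lamE //; dfn. Qed.

(** The bit that results at round m if I plays j there; the threshold is the least j for which it
    is true.  Playing the threshold j or its predecessor I can make the bit what he wants, and the
    fractions of the mass offered to the two bits add up to 1 + 1 / g. *)
Definition yields p m j : Prop := rn g <= rn j \/ (j <> zero /\ T (put p m j) m = true).
Definition is_threshold p m j : Prop := yields p m j /\ forall j', yields p m j' -> rn j <= rn j'.
Definition threshold p m : N := eps zero (is_threshold p m).

Lemma DP3_yields : DP3 yields.
Proof. by rewrite /yields /put; dfn. Qed.
Lemma threshold_uniq p m j j' : is_threshold p m j -> is_threshold p m j' -> j = j'.
Proof. by move=> [h1 h2] [h3 h4]; apply: rn_inj; apply/eqP; rewrite eq_le h2 ?h4. Qed.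
Lemma DF2_threshold : DF2 threshold.
Proof.
have ? := DP3_yields; rewrite /DF2 /threshold; by_eps; first by move=> h; apply: threshold_uniq.
by rewrite /is_threshold; dfn.
Qed.
Lemma thresholdP p m : is_threshold p m (threshold p m).
Proof.
have ? := DP3_yields.
apply: epsP; have [||j [h1 h2]] := @N_least _ (yields p m); first by dfn.
  by exists g; left.
by exists j.
Qed.
Lemma put_agree p p' m j : (forall i, rn i < rn m -> p i = p' i) ->
  forall i, rn i <= rn m -> put p m j i = put p' m j i.
Proof.
move=> h i hi; rewrite !putE; case: (classic (i = m)) => im; first by rewrite !iteT.
rewrite !iteF //; apply: h; rewrite lt_neqAle hi andbT; by apply/eqP => /rn_inj.
Qed.
Lemma threshold_agree p p' m : (forall i, rn i < rn m -> p i = p' i) -> threshold p m = threshold p' m.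
Proof.
move=> h; have yy j : yields p m j <-> yields p' m j.
  by rewrite /yields (T_causal (put_agree j h)).
apply: (@threshold_uniq p m); first exact: thresholdP.
have [h1 h2] := thresholdP p' m; split; first exact/yy.
by move=> j /yy; apply: h2.
Qed.
Lemma threshold_bounds p m : 1 <= rn (threshold p m) /\ rn (threshold p m) <= rn g.
Proof.
have [h1 h2] := thresholdP p m; split; last by apply: h2; left.
case: (zero_or_suc (threshold p m)) => [z|[j ->]]; last by rewrite rnS; have := rn_ge0 j; lra.
by case: h1; rewrite z; [rewrite rn0 leNgt g0 | case].
Qed.

Definition prd n : N := flr (rn n - 1).
Lemma rn_prd n : 1 <= rn n -> rn (prd n) = rn n - 1.
Proof.
move=> h; case: (zero_or_suc n) h => [->|[j ->]]; first by rewrite rn0; lra.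
by move=> _; apply: isn_flr; rewrite rnS addrK; apply: isn_rn.
Qed.

Definition answer e p m : N := ite (announced m) (ite (e m = true) (suc zero) zero)
  (ite (e m = true) (threshold p m) (prd (threshold p m))).
(** The moves of I that make e the outcome. *)
Definition steer e : fn N := eps (cfn zero) (fun p => forall m, p m = answer e p m).

Lemma DF3_answer : DF3 answer.
Proof.
have ? := @DP1_announced _ d L; have ? := DF2_threshold.
by rewrite /answer /prd; dfn.
Qed.
Lemma steer_agree e e' p p' n : (forall m, p m = answer e p m) -> (forall m, p' m = answer e' p' m) ->
  (forall i, rn i < rn n -> e i = e' i) -> forall i, rn i < rn n -> p i = p' i.
Proof.
move=> hp hp' h; apply: N_sind; first by dfn.
move=> m IH hm; rewrite hp hp' /answer h //.
by rewrite (@threshold_agree p p') // => i hi; apply: IH => //; apply: lt_trans hi hm.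
Qed.
Lemma steerP e m : steer e m = answer e (steer e) m.
Proof.
have ? := DF3_answer; move: m.
apply: (@epsP _ (cfn zero) (fun p : fn N => forall m, p m = answer e p m)).
apply: (@fix_ex _ _ _ zero (answer e)); first by dfn.
move=> p p' m h; rewrite /answer (@threshold_agree p p') // => i /nltP; exact: h.
Qed.
Lemma DF1_steer : DF1 steer.
Proof.
have ? := DF3_answer; rewrite /DF1 /steer; by_eps; last by dfn.
move=> h p p' hp hp'; apply: fn_ext => m; apply: (@steer_agree h.2 h.2 p p' (suc m)) => //.
by rewrite rnS; lra.
Qed.

Definition steer_mass e : fn R := mass d L g (steer e) e.
Lemma DF1_steer_mass : DF1 steer_mass.
Proof. by have ? := @DF2_mass _ d L g; have ? := DF1_steer; rewrite /steer_mass; dfn. Qed.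
Lemma steer_mass_agree e e' n : (forall i, rn i < rn n -> e i = e' i) -> steer_mass e n = steer_mass e' n.
Proof.
move=> h; apply: mass_agree => //; apply: steer_agree h; exact: steerP.
Qed.

Lemma steer_outcome e : outcome d L g (steer e) (lam false (T (steer e))) e.
Proof.
move=> m; rewrite steerP /answer; split=> a.
  rewrite iteT //; case: (classic (e m = true)) => h; first by rewrite iteT //; split=> // _; apply: suc_neq0.
  by rewrite iteF //; split=> // /(_ erefl).
rewrite iteF // lamE; last by dfn.
have [y1 y2] := thresholdP (steer e) m; have [t1 t2] := threshold_bounds (steer e) m.
have Tput j : steer e m = j -> T (steer e) m = T (put (steer e) m j) m.
  move=> hj; apply: T_causal => i hi; rewrite putE; case: (classic (i = m)) => im; last by rewrite iteF.
  by rewrite iteT // im.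
have sE := steerP e m; rewrite /answer (iteF _ _ a) in sE.
case: (classic (e m = true)) => h.
  rewrite (iteT _ _ h) in sE *; split=> // _.
  by case: y1 => [y1|[z y1]]; [left | right; rewrite (Tput _ sE)].
rewrite (iteF _ _ h) in sE *; split=> // h'; exfalso.
have : rn (threshold (steer e) m) <= rn (prd (threshold (steer e) m)).
  by apply: y2; rewrite /yields -(Tput _ sE).
by rewrite rn_prd //; lra.
Qed.

(** I loses the run that follows a code of an element of the relation, so the bound on the masses
    must fail. *)
Lemma steer_concentrates e x y n0 : codes d L e x y n0 -> Rl x y -> exists k m,
  kap n0 <= rn k /\ rn m = rn k * Q /\ E (- (t * rn L * rn k)) < steer_mass e m.
Proof.
move=> ce Rxy; apply: NNPP => H.
apply: (@T_wins (steer e) (lam false (T (steer e)))); first by move=> m; rewrite lamE //; dfn.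
exists e, x, y, n0; split; first exact: steer_outcome.
do 2!split=> //; move=> k m hk hm; rewrite leNgt; apply/negP => h.
by apply: H; exists k, m.
Qed.

Context (hg : 1 + 1 / rn g <= E (1 / Q)).

(** E (cost m) is the factor by which steering may increase the total mass at round m: 2 if the bit
    is announced, 1 + 1 / g otherwise. *)
Definition cost : fn R := lam (0 : R) (fun m => ite (announced m) 1 (1 / Q)).
Lemma costE m : cost m = ite (announced m) 1 (1 / Q).
Proof. by have ? := @DP1_announced _ d L; rewrite /cost lamE //; dfn. Qed.

Lemma offer_le j : rn j <= rn g -> offer g j = rn j / rn g.
Proof.
rewrite /offer le_eqVlt => /orP [/eqP ->|h]; last by rewrite iteT.
by rewrite iteF ?ltxx // divff // gt_eqF.
Qed.

Lemma steer_mass_split e m : steer_mass (upd e m false) (suc m) + steer_mass (upd e m true) (suc m) <= steer_mass e m * E (cost m).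
Proof.
have ag b i : rn i < rn m -> upd e m b i = e i by exact: upd_lt.
have Wb b : steer_mass (upd e m b) (suc m) = steer_mass e m * fac d L g m (answer (upd e m b) (steer e) m) b.
  have st : forall i, rn i < rn m -> steer (upd e m b) i = steer e i.
    by apply: steer_agree (ag b); exact: steerP.
  rewrite /steer_mass massS -/(steer_mass (upd e m b)) (steer_mass_agree (ag b)) steerP upd_eq.
  by rewrite /answer (threshold_agree st).
rewrite !Wb -mulrDr; apply: ler_wpM2l; first exact: mass_ge0.
rewrite costE /fac /answer; case: (classic (announced m)) => a.
  by rewrite !(iteT _ _ a) E1; lra.
rewrite !(iteF _ _ a) !upd_eq !(iteT _ _ (erefl true)) !(@iteF _ (false = true)) //.
have [t1 t2] := threshold_bounds (steer e) m.
rewrite !offer_le ?rn_prd //; last by lra.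
apply: le_trans hg; rewrite le_eqVlt; apply/orP; left; apply/eqP; field; by rewrite gt_eqF.
Qed.

(** In each block d + 1 rounds are announced, and the at most Q others cost 1 / Q each. *)
Lemma cost_block k m : rn m = rn k * Q -> psum cost m <= rn k * (rn d + 2).
Proof.
have Q0 := Q_gt0 d L; have d0 := rn_ge0 d.
have Q1 : 1 <= Q by have : 0 <= rn d * rn L; [rewrite mulr_ge0 ?rn_ge0 | rewrite /Q; lra].
have iQ : 1 / Q <= 1 by rewrite ler_pdivrMr // mul1r.
move: k m; apply: N_ind; first by rewrite /Q; dfn.
  by move=> m; rewrite rn0 !mul0r -rn0 => /rn_inj ->; rewrite psum0 rn0.
move=> k IH m; rewrite rnS mulrDl mul1r => hm.
have [m0 hm0] : isn (rn k * Q) by apply: isnM; [apply: isn_rn|apply: isn_Q].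
have := IH m0 (esym hm0) => {}IH.
suff H : forall i m', rn m' = rn m0 + rn i -> rn i <= Q -> psum cost m' <= psum cost m0 + rn i /\
    psum cost m' <= psum cost m0 + (rn d + 1) + rn i / Q.
  have [i Ei] := isn_Q d L.
  have [||_] := H i m; rewrite -?Ei //; first by rewrite hm hm0.
  by rewrite divff ?gt_eqF //; lra.
apply: N_ind; first by rewrite /Q; dfn.
  move=> m'; rewrite rn0 addr0 => /rn_inj -> _; rewrite mul0r; split; lra.
move=> i IHi m'; rewrite rnS => hm' hi.
have [m1 Em1] : isn (rn m0 + rn i) by apply: isnD; apply: isn_rn.
have -> : m' = suc m1 by apply: rn_inj; rewrite rnS -Em1 hm'; ring.
have [|h1 h2] := IHi m1 (esym Em1); first by lra.
rewrite psumS costE; case: (classic (announced m1)) => a.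
  rewrite (iteT _ _ a).
  have id : rn i <= rn d.
    case: a => k' [a1 a2].
    have kk : k' = k.
      have b1 : 0 <= rn m1 - rn k' * Q < Q.
        have : Q > rn d.
          have : rn d * 1 <= rn d * rn L.
            apply: ler_wpM2l => //; have : 0 + 1 <= rn L by rewrite -rn0; apply: rn_discrete; rewrite rn0.
            by rewrite add0r.
          by rewrite /Q; lra.
        by move=> h; apply/andP; split; lra.
      have b2 : 0 <= rn i < Q by rewrite rn_ge0 /=; lra.
      by have [|K _] := euclid_uniq (k := k') (k' := k) b1 b2; first by rewrite hm0 -Em1; ring.
    by move: a2; rewrite kk hm0 -Em1; lra.
  have : 0 <= (rn i + 1) / Q by rewrite divr_ge0 ?ltW //; have := rn_ge0 i; lra.
  by split; lra.
rewrite (iteF _ _ a); split; first by lra.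
have -> : (rn i + 1) / Q = rn i / Q + 1 / Q by field; rewrite gt_eqF.
by lra.
Qed.

(** The number with binary expansion 1 e_0 ... e_(m-1), which enumerates the finite bit sequences. *)
Definition num e : fn R := rec (1 : R) (fun m x => 2 * x + ite (e m = true) 1 0).
Lemma numP e : num e zero = 1 /\ forall m, num e (suc m) = 2 * num e m + ite (e m = true) 1 0.
Proof.
have H : DF2 (fun m (x : R) => 2 * x + ite (e m = true) 1 0) by dfn.
exact: (recP 1 H).
Qed.
Lemma num0 e : num e zero = 1. Proof. by case: (numP e). Qed.
Lemma numS e m : num e (suc m) = 2 * num e m + ite (e m = true) 1 0.
Proof. by case: (numP e). Qed.
Lemma DF1_num : DF1 num. Proof. by rewrite /num; dfn. Qed.

Lemma num_isn e m : isn (num e m) /\ 1 <= num e m.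
Proof.
have ? := DF1_num; move: m; apply: N_ind; first by dfn.
  by rewrite num0; split=> //; apply: isn1.
move=> m [IH1 IH2]; rewrite numS.
have -> : 2 * num e m = num e m + num e m by ring.
case: (classic (e m = true)) => h; rewrite ?(iteT _ _ h) ?(iteF _ _ h).
  split; last by lra.
  by apply: isnD; [apply: isnD | apply: isn1].
by split; [apply: isnD; [apply: isnD | apply: isn0] | lra].
Qed.

Lemma num_inj e e' m m' : num e m = num e' m' -> m = m' /\ forall i, rn i < rn m -> e i = e' i.
Proof.
have ? := DF1_num; move: m m'; apply: N_ind; first by dfn.
  move=> m'; case: (zero_or_suc m') => [->|[j ->]].
    by move=> _; split=> // i; rewrite rn0; have := rn_ge0 i; lra.
  have [_ h1] := num_isn e' j; rewrite num0 numS.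
  case: (classic (e' j = true)) => h; rewrite ?(iteT _ _ h) ?(iteF _ _ h) => ?; exfalso; lra.
move=> m IH m'; case: (zero_or_suc m') => [->|[j ->]].
  have [_ h1] := num_isn e m; rewrite num0 numS.
  case: (classic (e m = true)) => h; rewrite ?(iteT _ _ h) ?(iteF _ _ h) => ?; exfalso; lra.
rewrite !numS => E.
have [n1 _] := num_isn e m; have [n2 _] := num_isn e' j.
have [Eb En] : e m = e' j /\ num e m = num e' j.
  move: E; case: (e m) (e' j) => [] []; rewrite ?(iteT _ _ (erefl true)) ?(@iteF _ (false = true)) //.
  - by move=> h; split=> //; lra.
  - by case: (ltgtP (num e m) (num e' j)) => [/isn_discrete|/isn_discrete|] h ?; try (have := h n1 n2); try (have := h n2 n1); lra.
  - by case: (ltgtP (num e m) (num e' j)) => [/isn_discrete|/isn_discrete|] h ?; try (have := h n1 n2); try (have := h n2 n1); lra.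
  - by move=> h; split=> //; lra.
have [mj H] := IH j En; subst j; split=> // i; rewrite rnS => hi.
case: (ltP (rn i) (rn m)) => im; first exact: H.
by have -> : i = m by apply: rn_between.
Qed.

Lemma num_agree e e' m : (forall i, rn i < rn m -> e i = e' i) -> num e m = num e' m.
Proof.
have ? := DF1_num; move: m; apply: N_ind; first by dfn.
  by rewrite !num0.
move=> m IH; rewrite rnS => h; rewrite !numS h ?IH //; last by lra.
by move=> i hi; apply: h; lra.
Qed.

Lemma num_upd e m b : num (upd e m b) (suc m) = 2 * num e m + ite (b = true) 1 0.
Proof. by rewrite numS upd_eq (@num_agree _ e) // => i; apply: upd_lt. Qed.

Lemma num_surj n : 1 <= rn n -> exists e m, rn n = num e m.
Proof.
have ? := DF1_num; move: n; apply: N_sind; first by dfn.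
move=> n IH h; case: (dbl_cases n) => -[j Ej].
  have hj := rn_dbl j; have j1 : 1 <= rn j.
    case: (zero_or_suc j) => [z|[i Ei]]; last by rewrite Ei rnS; have := rn_ge0 i; lra.
    by exfalso; move: h; rewrite Ej hj z rn0; lra.
  have [|e [m hm]] := IH j _ j1; first by rewrite Ej hj; lra.
  by exists (upd e m false), (suc m); rewrite num_upd iteF // Ej hj hm addr0.
have hj := rn_dbl j.
case: (zero_or_suc j) => [z|[i Ei]].
  exists (cfn false), zero; rewrite num0 Ej rnS hj z rn0; ring.
have j1 : 1 <= rn j by rewrite Ei rnS; have := rn_ge0 i; lra.
have [|e [m hm]] := IH j _ j1; first by rewrite Ej rnS hj; lra.
by exists (upd e m true), (suc m); rewrite num_upd iteT // Ej rnS hj hm.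
Qed.

(** Normalized by the costs, and by a geometric factor that makes the sum over all lengths finite. *)
Definition weight e m : R := steer_mass e m * E (- (psum cost m + rn m / Q)).
Lemma DF2_weight : DF2 weight.
Proof. by have ? := DF1_steer_mass; rewrite /weight; dfn. Qed.
Lemma weight_split e m : weight (upd e m false) (suc m) + weight (upd e m true) (suc m) <=
  E (- (1 / Q)) * weight e m.
Proof.
rewrite /weight -mulrDl.
have -> : E (- (psum cost (suc m) + rn (suc m) / Q)) =
    E (- cost m) * (E (- (1 / Q)) * E (- (psum cost m + rn m / Q))).
  rewrite -!ED psumS rnS; congr E; field; by rewrite gt_eqF // Q_gt0.
have cc : E (cost m) * E (- cost m) = 1 by rewrite -ED subrr E0.
apply: (@le_trans _ _ (steer_mass e m * E (cost m) * (E (- cost m) * (E (- (1 / Q)) * E (- (psum cost m + rn m / Q)))))).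
  by apply: ler_wpM2r (steer_mass_split e m); rewrite !mulr_ge0 // ltW // E_gt0.
rewrite le_eqVlt; apply/orP; left; apply/eqP.
transitivity (E (cost m) * E (- cost m) * (E (- (1 / Q)) * (steer_mass e m * E (- (psum cost m + rn m / Q))))); first by ring.
by rewrite cc mul1r.
Qed.

Lemma steer_mass_ge0 e m : 0 <= steer_mass e m. Proof. exact: mass_ge0. Qed.
Lemma weight_ge0 e m : 0 <= weight e m.
Proof. by rewrite /weight mulr_ge0 ?steer_mass_ge0 // ltW // E_gt0. Qed.
Lemma weight_agree e e' m : (forall i, rn i < rn m -> e i = e' i) -> weight e m = weight e' m.
Proof. by move=> h; rewrite /weight (steer_mass_agree h). Qed.

(** Pairing the children of each node gives S (2 n) <= 1 + rho S n <= 1 + rho S (2 n) for the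
    partial sums S, with rho = E (- (1 / Q)), because the root has weight 1. *)
Lemma weights_sum : exists f : fn R, (forall n, 0 <= f n) /\
  (forall e m n, rn n = num e m -> f n = weight e m) /\
  forall n, psum f n * (1 - E (- (1 / Q))) <= 1.
Proof.
have ? := DF2_weight; have ? := DF1_num.
pose (P := fun n (v : R) => exists e m, rn n = num e m /\ v = weight e m).
have PU n v v' : P n v -> P n v' -> v = v'.
  move=> [e [m [h ->]]] [e' [m' [h' ->]]].
  have [mm ee] : m = m' /\ forall i, rn i < rn m -> e i = e' i by apply: num_inj; rewrite -h.
  by subst m'; apply: weight_agree.
have [|f Hf] := @mkfn _ R _ (fun n => eps (0 : R) (P n)).
  by rewrite /DF1; by_eps; [move=> h; apply: PU | rewrite /P; dfn].
have fE e m n : rn n = num e m -> f n = weight e m.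
  move=> h; rewrite Hf; apply: epsU; first by exists e, m.
  by move=> v hv; apply: PU hv _; exists e, m.
have f0 n : 0 <= f n.
  case: (leP 1 (rn n)) => h; first by have [e [m hm]] := num_surj h; rewrite (fE _ _ _ hm) weight_ge0.
  rewrite Hf epsN // => -[v [e [m [hm _]]]].
  by have [_] := num_isn e m; rewrite -hm; lra.
exists f; split=> //; split=> //.
have [|f2 Hf2] := @mkfn _ R _ (fun i => f (dbl i) + f (suc (dbl i))); first by rewrite /dbl; dfn.
have [|f3 Hf3] := @mkfn _ R _ (fun i => E (- (1 / Q)) * f i); first by dfn.
have [|f4 Hf4] := @mkfn _ R _ (fun i => ite (i = zero) (1 : R) 0); first by dfn.
have [|f5 Hf5] := @mkfn _ R _ (fun i => f3 i + f4 i); first by dfn.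
have fz : f zero = 0.
  rewrite Hf epsN // => -[v [e [m [hm _]]]].
  by have [_] := num_isn e m; rewrite -hm rn0; lra.
have le25 i : f2 i <= f5 i.
  rewrite Hf2 Hf5 Hf3 Hf4; case: (zero_or_suc i) => [->|[j Ej]].
    rewrite dbl_zero fz mulr0 !add0r iteT // (fE (cfn false) zero) ?num0 ?rnS ?rn0 ?add0r //.
    by rewrite /weight /steer_mass mass0 psum0 rn0 mul0r addr0 oppr0 E0 mul1r.
  have i1 : 1 <= rn i by rewrite Ej rnS; have := rn_ge0 j; lra.
  have [e [m hm]] := num_surj i1.
  rewrite iteF ?addr0; last by rewrite Ej; apply: suc_neq0.
  rewrite (fE e m i) // (fE (upd e m false) (suc m) (dbl i)); last by rewrite num_upd iteF // rn_dbl hm addr0.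
  rewrite (fE (upd e m true) (suc m) (suc (dbl i))); last by rewrite num_upd iteT // rnS rn_dbl hm.
  exact: weight_split.
have f4s n : psum f4 n <= 1.
  suff [h _] : psum f4 n <= 1 /\ (n = zero -> psum f4 n = 0) by [].
  move: n; apply: N_ind; first by dfn.
    by rewrite psum0; split=> //; lra.
  move=> n [h1 h2]; rewrite psumS Hf4; split; last by move/suc_neq0.
  case: (classic (n = zero)) => z; first by rewrite iteT // h2 // add0r.
  by rewrite iteF // addr0.
move=> n; have r1 : E (- (1 / Q)) <= 1.
  by have := @E_le _ (- (1 / Q)) 0; rewrite E0; apply; rewrite oppr_le0 divr_ge0 // ltW // Q_gt0.
have s1 : psum f n <= psum f (dbl n) by apply: psum_mono => //; rewrite rn_dbl; have := rn_ge0 n; lra.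
have s2 : psum f (dbl n) = psum f2 n.
  apply: (@psum_pairs _ f f2) => // [i j hj|]; last exact: rn_dbl.
  have -> : j = dbl i by apply: rn_inj; rewrite rn_dbl.
  exact: Hf2.
have s3 : psum f2 n <= psum f5 n by apply: psum_le => i _; apply: le25.
have s5 := psum_add n Hf5; have s6 := psum_scale n Hf3; have s7 := f4s n.
have e0 : 0 <= E (- (1 / Q)) by apply/ltW/E_gt0.
have s8 := psum_ge0 n f0.
by rewrite mulrBr mulr1 [X in _ - X]mulrC; lra.
Qed.

Lemma rn_le_E (n : N) : rn n <= E (rn n).
Proof.
suff : rn n + 1 <= E (rn n) by lra.
move: n; apply: N_ind; first by dfn.
  by rewrite rn0 E0; lra.
by move=> n IH; rewrite rnS ED E1; have := rn_ge0 n; lra.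
Qed.

Context (s eps0 eta : R).
Context (s0 : 0 < s).
Context (eps00 : 0 < eps0).
Context (eta0 : 0 < eta).
Context (hL : rn d + 4 <= rn L * (s - t)).
Context (kap1 : forall n0, pcode 0 (rn n0) < kap n0).
Context (kap2 : forall n0, s * (rn d + rn n0) - lg (eta * (1 - E (- (1 / Q)))) <= kap n0).
Context (kap3 : forall n0, rn d + rn n0 - lg eps0 <= kap n0).

(** The covering sets are the cubes whose mass along the steered run exceeds E (- (t L k)).  Such a
    cube has gauge about E (- (s L k)), and since L (s - t) >= d + 4 this is less than its weight
    times eta', whatever factor up to E ((d + 3) k) the weight has lost. *)
Lemma win_II_covers : has_cover wo (enc d) D s eps0 eta.
Proof.
have ? := DF1_steer_mass; have ? := DF1_num.
have [f [f0 [fE fs]]] := weights_sum.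
have iQ : 0 < 1 / Q by rewrite divr_gt0 // Q_gt0.
have q0 : 0 < 1 - E (- (1 / Q)).
  by rewrite subr_gt0; have := @E_lt _ (- (1 / Q)) 0; rewrite E0; apply; rewrite oppr_lt0.
pose eta' := eta * (1 - E (- (1 / Q))).
have eta'0 : 0 < eta' by rewrite mulr_gt0.
pose (P := fun n x => exists e k m y n0, codes d L e x y n0 /\ Rl x y /\ kap n0 <= rn k /\
   rn m = rn k * Q /\ rn n = num e m /\ E (- (t * rn L * rn k)) < steer_mass e m).
have DP : DP2 P by rewrite /P /codes /oddn /xi /pcode /Q; dfn.
pose (isU := fun n b => forall x, x ∈ b <-> x ∈ D /\ P n x).
pose (U := fun n => eps wo (isU n)).
have UP n x : x ∈ U n <-> x ∈ D /\ P n x.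
  move: x; apply: (@epsP _ wo (isU n)).
  by apply: (@separation _ D (P n)); dfn.
have DU : DF1 U.
  rewrite /DF1 /U; by_eps; last by rewrite /isU; dfn.
  by move=> h b b' hb hb'; apply: ext => x; rewrite hb hb'.
have [|h Hh] := @mkfn _ R _ (fun n => eta' * f n); first by dfn.
have L1 : 1 <= rn L by have := @rn_discrete _ zero L; rewrite rn0 add0r; apply.
apply: (@cover_intro _ d D U h) => //.
- by move=> n x /UP [/D_dom []].
- move=> x xD; have [_ [y Rxy]] := D_dom xD.
  have [n0 hn0] := bounded_coords d x; have [e ce] := codes_ex L y hn0.
  have [k [m [hk [hm hw]]]] := steer_concentrates ce Rxy.
  have [[n hn] _] := num_isn e m.
  by exists n; apply/UP; split=> //; exists e, k, m, y, n0.
- by move=> n; rewrite Hh mulr_ge0 // ltW.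
- move=> n [x /UP [xD [e [k [m [y [n0 [ce [Rxy [hk [hm [hn hw]]]]]]]]]]]].
  have k0 : 0 <= rn k by apply: rn_ge0.
  have kL : rn k <= rn k * rn L by rewrite -[leLHS]mulr1; apply: ler_wpM2l.
  exists (E (rn d + rn n0 - rn k * rn L)); split; first exact: E_gt0.
  split.
    by rewrite -[leRHS](Elg eps00); apply: E_le; have := kap3 n0; lra.
  split.
    rewrite lgE Hh (fE e m n hn) /weight.
    apply: (@le_trans _ _ (eta' * (E (- (t * rn L * rn k)) * E (- (psum cost m + rn m / Q))))).
      rewrite -{1}(Elg eta'0) -!ED; apply: E_le.
      have -> : rn m / Q = rn k by rewrite hm mulfK // gt_eqF // Q_gt0.
      have c1 := cost_block hm; have c2 := kap2 n0.
      have c3 : rn k * (rn d + 4) <= rn k * (rn L * (s - t)) by apply: ler_wpM2l.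
      rewrite -/eta' in c2; lra.
    apply: ler_wpM2l; first exact: ltW.
    by apply: ler_wpM2r; [apply/ltW/E_gt0 | apply: ltW].
  move=> z z' r /UP [zD Pz] /UP [z'D Pz'] hr.
  have dd (u : V) : P n u -> exists e' y', codes d L e' u y' n0 /\ forall i, rn i < rn m -> e' i = e i.
    move=> [e' [k' [m' [y' [n0' [ce' [_ [_ [hm' [hn' _]]]]]]]]]].
    have [mm ee] : m = m' /\ forall i, rn i < rn m -> e i = e' i by apply: num_inj; rewrite -hn.
    subst m'; have n00 : n0 = n0'.
      have agr i : rn i < rn k * Q -> e i = e' i by rewrite -hm; apply: ee.
      by have [h1 _] := codes_agree ce ce' agr; apply: h1; apply: lt_le_trans hk.
    by subst n0'; exists e', y'; split=> // i hi; rewrite ee.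
  have [e1 [y1 [c1 a1]]] := dd _ Pz; have [e2 [y2 [c2 a2]]] := dd _ Pz'.
  have near i : rn i < rn d -> `|coord z i - coord z' i| <= E (rn n0 - rn k * rn L).
    by apply: codes_close c1 c2 _ => // j hj; rewrite a1 ?a2 // hm.
  have [ez _] := D_dom zD; have [ez' _] := D_dom z'D.
  apply: le_trans (dist_le ez ez' hr (ltW (E_gt0 _)) near) _.
  rewrite -addrA [leRHS]ED; apply: ler_wpM2r; [exact/ltW/E_gt0 | exact: rn_le_E].
move=> n; rewrite (psum_scale n Hh) /eta' -mulrA -[leRHS]mulr1.
by apply: ler_wpM2l; [exact: ltW | rewrite mulrC].
Qed.

End WinII.

(** * The uniformization theorem *)

Section Conclusion.
Context {W : world} (d : N).

Lemma win_I_uniformizes (L g : N) (L0 : 0 < rn L) (g0 : 0 < rn g) (t : R) (kap : N -> R)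
    (Rl : V -> fn N -> Prop) (t0 : 0 < t) (DRl : DP2 Rl) (D : V)
    (RlD : forall x y, Rl x y -> x ∈ D /\ euc d x) (S : fn bool -> N -> N) (DS : DF2 S)
    (S_causal : forall (e e' : fn bool) m, (forall i, rn i < rn m -> e i = e' i) -> S e m = S e' m)
    (S_wins : forall (p : fn N) (q : fn bool), (forall m, p m = S q m) -> payoff d L g t kap Rl p q) :
  exists B f : V, incl B D /\ (forall u, 0 <= u -> hausdorff_null wo (enc d) B u -> t <= u) /\
    is_fun f B (baire wo) /\ is_continuous wK wo (enc d) B f /\
    forall x z, inrel f x z -> exists y, z = enc y /\ Rl x y.
Proof.
have [||es [esl _]] := @legal_ex _ d L g g0 S DS S_causal (fun _ _ => False).
- by dfn.
- by [].
have [xs [ys [n0 [esc _]]]] := legal_wins DS S_wins esl.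
have [K0 hK0] := archimedean (pcode 0 (rn n0)).
have [B [f [HB [Ff Hf]]]] := uniformizer_ex g L0 DRl RlD DS S_causal es n0 K0.
exists B, f; split.
  by move=> x /HB [e [y [_ [_ [_ /RlD []]]]]].
split; first exact: (uniformizer_dim L0 g0 t0 DRl RlD DS S_causal S_wins esl hK0 esc HB).
split=> //; split; first exact: (uniformizer_continuous L0 RlD S_causal HB Hf).
by move=> x z /Hf [e [y [[_ [_ [_ Rxy]]] ->]]]; exists y.
Qed.

(** The parameters: L makes the gain E (L (s - t)) per block outweigh the factor E (d + 2) lost by
    steering, g makes 1 + 1 / g at most E (1 / Q), and kap makes the exempted scales so many that
    the cover obtained from a strategy of II is finer than eps0 and of total gauge at most eta. *)
Theorem dichotomy (Rl : V -> fn N -> Prop) (DRl : DP2 Rl) (D : V) (t s eps0 eta : R) :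
  AD wM -> (forall x y, Rl x y -> x ∈ D /\ euc d x) ->
  (forall x, x ∈ D -> euc d x /\ exists y, Rl x y) ->
  0 < t -> t < s -> 0 < eps0 -> 0 < eta ->
  has_cover wo (enc d) D s eps0 eta \/
  exists B f : V, incl B D /\ (forall u, 0 <= u -> hausdorff_null wo (enc d) B u -> t <= u) /\
    is_fun f B (baire wo) /\ is_continuous wK wo (enc d) B f /\
    forall x z, inrel f x z -> exists y, z = enc y /\ Rl x y.
Proof.
move=> ad RlD D_dom t0 ts e0 eta0.
have st : 0 < s - t by lra.
have d0 := rn_ge0 d.
have [L hL] := archimedean ((rn d + 4) / (s - t)).
rewrite ltr_pdivrMr // in hL.
have L0 : 0 < rn L by rewrite -(ltr_pM2r st) mul0r; lra.
have Q0 := Q_gt0 d L.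
have E1Q : 1 < E (1 / Q d L) by rewrite -[ltLHS]E0; apply: E_lt; rewrite divr_gt0.
have dE : 0 < E (1 / Q d L) - 1 by lra.
have [g hg] := archimedean (1 / (E (1 / Q d L) - 1)).
have g0 : 0 < rn g by apply: le_lt_trans hg; rewrite divr_ge0 // ltW.
rewrite ltr_pdivrMr // in hg.
have hg' : 1 + 1 / rn g <= E (1 / Q d L).
  by rewrite -lerBrDl ler_pdivrMr // ltW // mulrC.
pose (kap := fun n0 => pcode 0 (rn n0) + 1 + `|s * (rn d + rn n0) - lg (eta * (1 - E (- (1 / Q d L))))| +
   `|rn d + rn n0 - lg eps0|).
have Dkap : DF1 kap by rewrite /kap /pcode; dfn.
have pr0 n0 : 0 <= pcode 0 (rn n0) by rewrite /pcode addr0 sqr_ge0.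
have := determinacy ad (DP2_payoff d L g t Dkap DRl).
case=> [[S [DS [Sc Sw]]]|[T [DT [Tc Tw]]]]; [right|left].
  exact: (win_I_uniformizes L0 g0 t0 DRl RlD DS Sc Sw).
have n1 x : 0 <= `|x : R| by apply: normr_ge0.
apply: (win_II_covers L0 g0 Dkap DRl D_dom DT Tc Tw hg') => //.
- by apply: lt_trans ts.
- by apply: ltW.
- move=> n0; rewrite /kap; have := n1 (s * (rn d + rn n0) - lg (eta * (1 - E (- (1 / Q d L))))).
  by have := n1 (rn d + rn n0 - lg eps0); lra.
- move=> n0; rewrite /kap; have := ler_norm (s * (rn d + rn n0) - lg (eta * (1 - E (- (1 / Q d L))))).
  by have := n1 (rn d + rn n0 - lg eps0); have := pr0 n0; lra.
- move=> n0; rewrite /kap; have := n1 (s * (rn d + rn n0) - lg (eta * (1 - E (- (1 / Q d L))))).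
  by have := ler_norm (rn d + rn n0 - lg eps0); have := pr0 n0; lra.
Qed.

(** An exponent s strictly between delta' and the dimension of D is not null for D, so dichotomy with
    t = delta' yields the uniformization.  For delta' <= 0 the empty set will do. *)
Theorem uniformization (ad : AD wM) (delta : R) (Rel D : V)
    (hR : is_relation wK wo (enc d) Rel) (hD : is_dom wK wo (enc d) Rel D)
    (hdim : HD_ge wo (enc d) D delta) (delta' : R) (lt_delta : delta' < delta) :
  exists B f : V, incl B D /\ HD_ge wo (enc d) B delta' /\
    is_fun f B (baire wo) /\ is_continuous wK wo (enc d) B f /\
    (forall x y, x ∈ B -> inrel f x y -> inrel Rel x y).
Proof.
case: (leP delta' 0) => [d'0|d'0].
  exists (enc zero), (enc zero); split; first by move=> z /zeroP.
  split.
    apply: (HD_subset (A := D) (a := delta)) => //; first by move=> z /zeroP.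
    by move=> s s0 _; apply: le_trans s0.
  split; first by split=> x /zeroP.
  by split=> [x y n /zeroP|x y /zeroP].
have [h [hh dh]] := hdim; have [h1 h2] := hh.
have [s [s1 s2]] : exists s, delta' < s /\ s < h by exists ((delta' + h) / 2); lra.
have nn : ~ hausdorff_null wo (enc d) D s.
  move=> /h1 hs; have /hs : 0 <= s by lra.
  by lra.
have [e0 [eta [e00 [eta0 nc]]]] : exists e0 eta : R, 0 < e0 /\ 0 < eta /\ ~ has_cover wo (enc d) D s e0 eta.
  apply: NNPP => H; apply: nn => e0 eta e00 eta0; apply: NNPP => nc.
  by apply: H; exists e0, eta.
pose (Rl := fun (x : V) (y : fn N) => inrel Rel x (enc y)).
have DRl : DP2 Rl by rewrite /Rl; dfn.
have RlE x y : Rl x y -> x ∈ D /\ euc d x.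
  move=> Rxy; have [p [hp pR]] := Rxy.
  have [x' [y' [ex [by' hp']]]] := hR p pR.
  move: hp hp' => /is_opairE -> /is_opairE /opair_inj [E1 E2].
  by subst x'; split=> //; apply/hD; split=> //; exists (enc y); split=> //; rewrite E2.
have Dd x : x ∈ D -> euc d x /\ exists y, Rl x y.
  by move=> /hD [ex [y [/baireE [f ->] Rxy]]]; split=> //; exists f.
have [/nc //|[B [f [BD [Bt [Ff [Cf Rf]]]]]]] := dichotomy DRl ad RlE Dd d'0 s1 e00 eta0.
exists B, f; split=> //; split; first exact: (HD_subset BD hdim).
do 2!split=> //.
by move=> x z xB /Rf [y [-> Rxy]].
Qed.
End Conclusion.

Theorem theorem5 (M : set_structure) (hZF : ZF M) (hAD : AD M)
    (K : real_line M) (w : M) (hw : is_omega w)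
    (d : M) (hd : d ∈ w) (hd1 : ~ is_empty d)
    (delta : K) (R : M) (hR : is_relation K w d R)
    (D : M) (hD : is_dom K w d R D) (hdim : HD_ge w d D delta)
    (delta' : K) (hdelta' : delta' < delta) :
  exists B f : M,
    incl B D /\ HD_ge w d B delta' /\
    is_fun f B (baire w) /\ is_continuous K w d B f /\
    (forall x y : M, x ∈ B -> inrel f x y -> inrel R x y).
Proof.
exact: (@uniformization (World hZF K hw) (@natv (World hZF K hw) d hd) hAD delta R D
  hR hD hdim delta' hdelta').
Qed.
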